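(* Let $J$ be a nonnegative integer or half-integer, and let $q$ be either a positive real number or a complex number of modulus $1$ that is not a root of unity (generic $q\in S^1$). Consider the functional equation $$Q_{Jq}(q^2\eta)\,(1+\eta)=Q_{Jq}(\eta)\,(1+q^{-2J}\eta),$$ which defines the factor $Q_{Jq}(\eta)$ in the basis functions $\Psi^J_{MNq}$, up to a multiplicative factor $f_{Jq}(\eta)$ with $f_{Jq}(q^2\eta)=f_{Jq}(\eta)$. A solution $Q_{Jq}(\eta)$ of this equation is given as follows. (i) If $J$ is an integer, and either $q\in\mathbb{R}^+$ or $q\in S^1$ is generic, $$Q_{Jq}(\eta)=\prod_{k=0}^{J-1}\frac{1}{1+\eta\,q^{-2J+2k}} .$$ (ii) If $J$ is a half-integer (i.e. $J\in\frac12+\mathbb{Z}_{\ge 0}$) and $q\in\mathbb{R}^+$, $$Q_{Jq}(\eta)=\prod_{k=0}^{\infty}\frac{1+q^{2k}\eta}{1+q^{-2J+2k}\eta}\quad\text{if }0<q<1,\qquad Q_{Jq}(\eta)=\prod_{k=0}^{\infty}\frac{1+q^{-2J-2k-2}\eta}{1+q^{-2k-2}\eta}\quad\text{if }q>1 .$$ (iii) If $J$ is a half-integer (i.e. $J\in\frac12+\mathbb{Z}_{\ge 0}$) and $q=e^{i\tau}\in S^1$ is generic, with $-\pi<\tau<\pi$, $$Q_{Jq}(\eta)=\exp\left\{L_q\left(q^{-2J-1}\eta\right)-L_q\left(q^{-1}\eta\right)\right\},$$ where, for $0<\eta<\infty$, $L_q$ admits the integral representation $$L_q(\eta)=\frac{1}{2\pi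 i}\int_0^{\infty}\frac{dt}{t(1+t)}\ln\left(1+\eta\,t^{\tau/\pi}\right)\quad\text{if }0<\tau<\pi,$$ $$L_q(\eta)=-\frac{1}{2\pi i}\int_0^{\infty}\frac{dt}{t(1+t)}\ln\left(1+\eta\,t^{-\tau/\pi}\right)\quad\text{if }-\pi<\tau<0 .$$
   Context: The functions $Q_{Jq}(\eta)$ enter the basis functions of the $(2J+1)$-dimensional irreducible representation of the quantum algebra $\mathrm{su}_q(2)$ realized on functions of a complex variable $z$ and its conjugate $\bar z$: $$\Psi^J_{MNq}(z,\bar z)=N^J_{MNq}\,Q_{Jq}(\eta)\,q^{-NM/2}\,R^J_{MNq}(\eta)\,\bar z^{\,M+N},\qquad \eta=z\bar z,$$ where $N^J_{MNq}$ is a constant and $R^J_{MNq}$ is a polynomial in $\eta$. The only condition imposed on $Q_{Jq}$ is the functional equation in the claim, so that ''the function $Q_{Jq}$ is given by'' a formula means that the formula provides a solution of that equation. The variable $\eta$ ranges over $0<\eta<\infty$; empty products equal $1$. In case (iii), multiplication of the argument by a power $q^{a}=e^{ia\tau}$ is understood as the shift $\ln\eta\mapsto\ln\eta+ia\tau$. That is, put $E_q(x)=\exp\{L_q(e^x)\}$ for real $x$, and continue $E_q$ meromorphically to complex $x$; then $Q_{Jq}(\eta)=E_q(\ln\eta-i(2J+1)\tau)/E_q(\ln\eta-i\tau)$, and $Q_{Jq}(q^2\eta)$ is obtained from this by replacing $\ln\eta$ by $\ln\eta+2i\tau$. *)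

(* Defs.v *)
From Stdlib Require Import Reals ZArith.
From Coquelicot Require Import Coquelicot.

Open Scope C_scope.

(** The spin J is carried by the natural number [twoJ] = 2J: J is an integer
    when [twoJ] is even and a (proper) half-integer when [twoJ] is odd.  All
    powers of q that occur, such as q^{-2J+2k}, then have integer exponents. *)

Definition Cpowz (q : C) (m : Z) : C :=
  match m with
  | Z0 => 1
  | Zpos p => Cpow q (Pos.to_nat p)
  | Zneg p => / Cpow q (Pos.to_nat p)
  end.

Definition Cexp (z : C) : C :=
  ((exp (Re z) * cos (Im z))%R, (exp (Re z) * sin (Im z))%R).

Definition positive_real (q : C) : Prop :=
  exists r : R, (0 < r)%R /\ q = RtoC r.

Definition generic_phase (q : C) : Prop :=
  Cmod q = 1%R /\ forall m : nat, (0 < m)%nat -> Cpow q m <> 1.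

(** [pt eta] represents the point eta > 0 in the coordinate of which Q is a
    function, and [dil] is multiplication of the argument by q^2 in that
    coordinate. *)

Definition solves_in (pt : R -> C) (dil : C -> C) (q : C) (twoJ : nat)
    (Q : C -> C) : Prop :=
  forall eta : R, (0 < eta)%R ->
    Q (dil (pt eta)) * (1 + eta)
    = Q (pt eta) * (1 + Cpowz q (- Z.of_nat twoJ) * eta).

Definition solves (q : C) (twoJ : nat) (Q : C -> C) : Prop :=
  solves_in RtoC (fun z => Cpow q 2 * z) q twoJ Q.

(** Here q = e^{i tau}, and Q is a function of ln eta. *)
Definition solves_log (tau : R) (q : C) (twoJ : nat) (Q : C -> C) : Prop :=
  solves_in (fun eta => RtoC (ln eta)) (fun x => x + 2 * Ci * tau) q twoJ Q.

Definition determined_up_to_periodic (pt : R -> C) (dil : C -> C) (q : C)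
    (twoJ : nat) : Prop :=
  forall Q0 Q : C -> C,
    solves_in pt dil q twoJ Q0 ->
    (forall eta : R, (0 < eta)%R ->
       Q0 (pt eta) <> 0 /\ Q0 (dil (pt eta)) <> 0) ->
    (solves_in pt dil q twoJ Q <->
     exists f : C -> C,
       forall eta : R, (0 < eta)%R ->
         f (dil (pt eta)) = f (pt eta) /\
         Q (pt eta) = f (pt eta) * Q0 (pt eta) /\
         Q (dil (pt eta)) = f (dil (pt eta)) * Q0 (dil (pt eta))).

Fixpoint Cprod (u : nat -> C) (N : nat) : C :=
  match N with
  | O => 1
  | S k => Cprod u k * u k
  end.

Definition ex_inf_prod (u : nat -> C) : Prop :=
  exists l : C, l <> 0 /\
    filterlim (Cprod u) eventually (@locally C_UniformSpace l).

(** Meaningful only under [ex_inf_prod u]. *)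
Definition inf_prod (u : nat -> C) : C :=
  (real (Lim_seq (fun N => Re (Cprod u N))),
   real (Lim_seq (fun N => Im (Cprod u N)))).

Definition Q_integer_factor (q : C) (twoJ : nat) (eta : C) (k : nat) : C :=
  1 + eta * Cpowz q (- Z.of_nat twoJ + 2 * Z.of_nat k).

Definition Q_integer (q : C) (J : nat) (eta : C) : C :=
  Cprod (fun k => 1 / Q_integer_factor q (2 * J) eta k) J.

Definition Q_small_factor (q : C) (twoJ : nat) (eta : C) (k : nat) : C :=
  (1 + Cpowz q (2 * Z.of_nat k) * eta)
  / (1 + Cpowz q (- Z.of_nat twoJ + 2 * Z.of_nat k) * eta).

Definition Q_large_factor (q : C) (twoJ : nat) (eta : C) (k : nat) : C :=
  (1 + Cpowz q (- Z.of_nat twoJ - 2 * Z.of_nat k - 2) * eta)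
  / (1 + Cpowz q (- 2 * Z.of_nat k - 2) * eta).

Definition L_integrand (sigma eta t : R) : R :=
  (/ (t * (1 + t)) * ln (1 + eta * Rpower t (sigma / PI)))%R.

Definition L_integral (sigma eta : R) : R :=
  RInt_gen (L_integrand sigma eta) (at_right 0) (Rbar_locally p_infty).

(** The last branch is meant for tau < 0; for tau = 0 the integral diverges. *)
Definition L_q (tau eta : R) : C :=
  if Rlt_dec 0 tau
  then 1 / (2 * PI * Ci) * L_integral tau eta
  else - (1 / (2 * PI * Ci) * L_integral (- tau) eta).

Definition C_differentiable (f : C -> C) (z : C) : Prop :=
  @ex_derive C_AbsRing C_NormedModule f z.

(** The value of [f] at [z0] itself is irrelevant, so a pole may carry any
    value; regularity at a point has to be asserted separately. *)
Definition meromorphic_at (f : C -> C) (z0 : C) : Prop :=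
  exists (k : nat) (g : C -> C),
    @locally C_UniformSpace z0 (fun z => C_differentiable g z) /\
    @locally C_UniformSpace z0
      (fun z => z <> z0 -> f z = g z / Cpow (z - z0) k).

(** By the identity theorem, two such functions agree wherever both are
    differentiable. *)
Definition continues_E_q (tau : R) (E : C -> C) : Prop :=
  (forall z : C, meromorphic_at E z) /\
  (forall x : R, E (RtoC x) = Cexp (L_q tau (exp x))).

(** Q as a function of x = ln eta. *)
Definition Q_phase (tau : R) (twoJ : nat) (E : C -> C) (x : C) : C :=
  E (x - Ci * (INR twoJ + 1)%R * tau) / E (x - Ci * tau).

(** Differentiability of [E] ensures that the values entering [Q_phase] at [x]
    are those of the continuation and not arbitrary values at poles. *)
Definition Q_phase_regular (tau : R) (twoJ : nat) (E : C -> C) (x : C) : Prop :=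
  C_differentiable E (x - Ci * (INR twoJ + 1)%R * tau) /\
  C_differentiable E (x - Ci * tau) /\
  E (x - Ci * tau) <> 0.

(* Main.v *)
Require Import Defs.
From Stdlib Require Import Reals ZArith Lra Lia Psatz.
From Coquelicot Require Import Coquelicot.
Local Open Scope R_scope.

(** Parts (i) and (ii) telescope: multiplying [eta] by [q^2] shifts the index of
    the factors of the product.  For part (iii) put [sigma = |tau| / PI] and
    [F z = 1 / (2 PI i) * int log (1 + e^(z + sigma s)) / (1 + e^s) ds], which is
    [+- L_q (e^z)] on the real line and holomorphic for [|Im z| < PI].  For
    [0 < theta < PI] the contour of [F (z + i sigma theta)] may be moved to
    [Im s = - theta], so that [F (z + i sigma theta) - F (z - i sigma theta)] is
    the integral of [log (1 + e^(z + sigma r))] against [1 / PI] times a Poisson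
    kernel of mass [theta] that concentrates at [r = 0] as [theta] tends to [PI].
    In the limit [F (z + i |tau|) - F (z - i |tau|) = log (1 + e^z)].  Its
    exponential continues [exp F] from the strip [|Im z| <= |tau|] to the whole
    plane, the factors [1 + e^w] producing zeros and simple poles, and the
    equation for [Q] is the quotient of two instances of it; genericity of [q]
    keeps the points involved away from the zeros of the factors. *)

(** * Complex derivatives *)

(** Cauchy's theorem is not invoked. The derivatives of the exponential, of [log1pexp] and of [Fint]
    come from quadratic remainder bounds, which survive integration against the kernel, and the
    contour is moved by real calculus through the Cauchy-Riemann equations. The limit theta -> PI
    replaces a residue computation, because at theta = PI the contours would run through the poles
    of 1 / (1 + e^s) at s = +- i PI. Since the kernel is even, only a second difference of order r^2
    is integrated against it; this gives the explicit rate O(sin theta), and continuity does the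
    rest because z +- i |tau| still lie in the strip. Part (iii) rests on parity: 2J + 1 is even, so
    the numerators of Q sit at even multiples of tau and meet only factors 1 + e^x q^m with m odd,
    which genericity keeps away from zero. The denominators sit at +- i tau, on the edge of the
    central strip, where the continuation is still the exponential of +- F and cannot vanish. *)

Definition is_cderive (f : C -> C) (z l : C) : Prop :=
  @is_derive C_AbsRing C_NormedModule f z l.

Lemma is_cderive_eps (f : C -> C) (z l : C) :
  is_cderive f z l <->
  forall eps : posreal, exists d : posreal, forall w : C, Cmod (w - z) < d ->
    Cmod (f w - f z - (w - z) * l)%C <= eps * Cmod (w - z)%C.
Proof.
split.
- intros [_ H] eps.
  destruct (H z (fun P HP => HP) eps) as [d Hd].
  exists d; intros w Hw; exact (Hd w Hw).
- intros H; split; [exact (@is_linear_scal_l C_AbsRing C_NormedModule l)|].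
  intros x Hx eps.
  rewrite <- (is_filter_lim_locally_unique _ _ Hx); clear x Hx.
  destruct (H eps) as [d Hd]; exists d; intros w Hw; exact (Hd w Hw).
Qed.

(* The two canonical normed modules on [C] carry different uniform structures,
   so that the product and composition rules of Coquelicot do not unify with
   derivatives in [C_NormedModule]. *)
Lemma is_cderive_AbsRing (f : C -> C) (z l : C) :
  is_cderive f z l <->
  @is_derive C_AbsRing (AbsRing_NormedModule C_AbsRing) f z l.
Proof.
split; intros [_ H]; split; try exact H; apply is_linear_scal_l.
Qed.

Lemma is_cderive_plus (f g : C -> C) (z lf lg : C) :
  is_cderive f z lf -> is_cderive g z lg ->
  is_cderive (fun w => f w + g w)%C z (lf + lg)%C.
Proof. exact (@is_derive_plus C_AbsRing C_NormedModule f g z lf lg). Qed.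

Lemma is_cderive_minus (f g : C -> C) (z lf lg : C) :
  is_cderive f z lf -> is_cderive g z lg ->
  is_cderive (fun w => f w - g w)%C z (lf - lg)%C.
Proof. exact (@is_derive_minus C_AbsRing C_NormedModule f g z lf lg). Qed.

Lemma is_cderive_mult (f g : C -> C) (z lf lg : C) :
  is_cderive f z lf -> is_cderive g z lg ->
  is_cderive (fun w => f w * g w)%C z (lf * g z + f z * lg)%C.
Proof.
rewrite !is_cderive_AbsRing; intros Hf Hg.
exact (@is_derive_mult C_AbsRing f g z lf lg Hf Hg Cmult_comm).
Qed.

Lemma is_cderive_comp (f g : C -> C) (z lf lg : C) :
  is_cderive f (g z) lf -> is_cderive g z lg ->
  is_cderive (fun w => f (g w)) z (lg * lf)%C.
Proof.
intros Hf Hg; apply is_cderive_AbsRing in Hg.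
exact (@is_derive_comp C_AbsRing C_NormedModule f g z lf lg Hf Hg).
Qed.

Lemma is_cderive_const (c z : C) : is_cderive (fun _ => c) z 0%C.
Proof. exact (@is_derive_const C_AbsRing C_NormedModule c z). Qed.

Lemma is_cderive_id (z : C) : is_cderive (fun w => w) z 1%C.
Proof. apply is_cderive_AbsRing. exact (@is_derive_id C_AbsRing z). Qed.

Lemma is_cderive_continuous (f : C -> C) (z l : C) :
  is_cderive f z l -> @continuous C_UniformSpace C_UniformSpace f z.
Proof.
intros H P HP.
assert (Hc := @ex_derive_continuous C_AbsRing C_NormedModule f z (ex_intro _ l H)).
apply locally_C. exact (Hc P HP).
Qed.

Lemma is_cderive_ext_loc (f g : C -> C) (z l : C) :
  @locally C_UniformSpace z (fun w => f w = g w) ->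
  is_cderive f z l -> is_cderive g z l.
Proof.
intros H; apply locally_C in H.
exact (@is_derive_ext_loc C_AbsRing C_NormedModule f g z l H).
Qed.

Lemma continuous_C_eps (f : C -> C) (z : C) (eps : posreal) :
  @continuous C_UniformSpace C_UniformSpace f z ->
  exists d : posreal, forall w : C, Cmod (w - z) < d -> Cmod (f w - f z)%C < eps.
Proof.
intros H.
assert (H1 : @locally C_UniformSpace z (fun w => Cmod (f w - f z)%C < eps)).
{ refine (H (fun v => Cmod (v - f z)%C < eps) _); apply locally_C. exists eps; intros y Hy; exact Hy. }
apply locally_C in H1; destruct H1 as [d Hd].
exists d; intros w Hw; exact (Hd w Hw).
Qed.

Lemma is_cderive_inv (z : C) : z <> 0%C -> is_cderive Cinv z (- / (z * z))%C.
Proof.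
intros Hz; apply is_cderive_eps; intros eps.
assert (Hm : 0 < Cmod z) by (apply Cmod_gt_0; exact Hz).
(* The remainder is (w - z)^2 / (w z^2). The first bound forces |w| >= |z| / 2, and the second then
   makes |w - z| / (|w| |z|^2) at most [eps]. *)
assert (Hd : 0 < Rmin (Cmod z / 2) (eps * (Cmod z * Cmod z * Cmod z) / 2)).
{ apply Rmin_pos; [lra|]. destruct eps as [e He]; simpl.
  assert (0 < e * (Cmod z * Cmod z * Cmod z)); [|lra].
  repeat apply Rmult_lt_0_compat; assumption. }
exists (mkposreal _ Hd); intros w Hw; simpl in Hw.
assert (H1 := Rlt_le_trans _ _ _ Hw (Rmin_l _ _)).
assert (H2 := Rlt_le_trans _ _ _ Hw (Rmin_r _ _)).
assert (Hw2 : Cmod z / 2 <= Cmod w).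
{ assert (Ht := Cmod_triangle w (z - w)%C).
  replace (w + (z - w))%C with z in Ht by ring.
  replace (Cmod (z - w)) with (Cmod (w - z)) in Ht; [lra|].
  rewrite <- Cmod_opp; f_equal; ring. }
assert (Hw0 : w <> 0%C) by (apply Cmod_gt_0; lra).
replace (/ w - / z - (w - z) * - / (z * z))%C
  with ((w - z) * ((w - z) / (w * (z * z))))%C by (field; auto).
rewrite Cmod_mult, Rmult_comm; apply Rmult_le_compat_r; [apply Cmod_ge_0|].
rewrite Cmod_div, !Cmod_mult by (repeat apply Cmult_neq_0; auto).
apply Rmult_le_reg_r with (Cmod w * (Cmod z * Cmod z)).
{ repeat apply Rmult_lt_0_compat; lra. }
unfold Rdiv; rewrite Rmult_assoc, Rinv_l, Rmult_1_r.
2: { apply Rgt_not_eq; repeat apply Rmult_lt_0_compat; lra. }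
apply Rlt_le, Rlt_le_trans with (1 := H2).
destruct eps as [e He]; simpl.
replace (e * (Cmod z * Cmod z * Cmod z) / 2)
  with (e * (Cmod z * Cmod z) * (Cmod z / 2)) by field.
replace (e * (Cmod w * (Cmod z * Cmod z)))
  with (e * (Cmod z * Cmod z) * Cmod w) by ring.
apply Rmult_le_compat_l; [|exact Hw2].
apply Rlt_le; repeat apply Rmult_lt_0_compat; assumption.
Qed.

Lemma Cmod_le_Rabs (z : C) : Cmod z <= Rabs (Re z) + Rabs (Im z).
Proof.
destruct z as [x y]; unfold Re, Im; simpl.
replace (x, y) with (RtoC x + RtoC y * Ci)%C
  by (unfold Cplus, Cmult, Ci, RtoC; simpl; f_equal; ring).
apply Rle_trans with (1 := Cmod_triangle _ _).
rewrite Cmod_mult, Cmod_Ci, !Cmod_R; lra.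
Qed.

Lemma im_le_Cmod (z : C) : Rabs (Im z) <= Cmod z.
Proof.
apply Rle_trans with (2 := Rmax_Cmod z); apply Rmax_r.
Qed.

(** Restricting a complex function to a real line and splitting it into components makes the real
    mean value theorem and [auto_derive] available. The factor [v] in [v * l] comes from the chain
    rule. *)
Definition is_line_derive (f : C -> C) (p v : C) (s : R) (l : C) : Prop :=
  is_derive (fun t : R => Re (f (p + RtoC t * v)%C)) s (Re (v * l)%C) /\
  is_derive (fun t : R => Im (f (p + RtoC t * v)%C)) s (Im (v * l)%C).

Lemma is_cderive_line (f : C -> C) (p v l : C) (s : R) :
  is_cderive f (p + RtoC s * v)%C l ->
  is_line_derive f p v s l.
Proof.
intros H.
assert (Hk : forall eps : posreal, exists d : posreal, forall t : R,
  Rabs (t - s) < d ->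
  Cmod (f (p + RtoC t * v) - f (p + RtoC s * v) - RtoC (t - s) * (v * l))%C
  <= eps * Rabs (t - s)).
{ intros eps; assert (H' := proj1 (is_cderive_eps _ _ _) H); clear H.
  (* Dividing by 1 + |v| rather than |v| covers the degenerate direction v = 0. *)
  assert (Hv : 0 < 1 + Cmod v) by (assert (H0 := Cmod_ge_0 v); lra).
  assert (He : 0 < eps / (1 + Cmod v)).
  { apply Rdiv_lt_0_compat; [apply cond_pos|exact Hv]. }
  destruct (H' (mkposreal _ He)) as [d Hd]; simpl in Hd.
  assert (Hd' : 0 < d / (1 + Cmod v)).
  { apply Rdiv_lt_0_compat; [apply cond_pos|exact Hv]. }
  exists (mkposreal _ Hd'); simpl; intros t Ht.
  assert (Hm : Cmod (p + RtoC t * v - (p + RtoC s * v)) = Rabs (t - s) * Cmod v).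
  { rewrite <- Cmod_R, <- Cmod_mult; f_equal; rewrite RtoC_minus; ring. }
  assert (Ha := Rabs_pos (t - s)).
  assert (Hb : Rabs (t - s) * (1 + Cmod v) < d).
  { apply Rmult_lt_reg_r with (/ (1 + Cmod v)); [apply Rinv_0_lt_compat; lra|].
    rewrite Rmult_assoc, Rinv_r, Rmult_1_r by lra; exact Ht. }
  specialize (Hd (p + RtoC t * v)%C).
  replace ((p + t * v - (p + s * v)) * l)%C with (RtoC (t - s) * (v * l))%C in Hd
    by (rewrite RtoC_minus; ring).
  rewrite Hm in Hd.
  apply Rle_trans with (1 := Hd ltac:(nra)).
  replace (eps / (1 + Cmod v) * (Rabs (t - s) * Cmod v))
    with (eps * Rabs (t - s) * (Cmod v / (1 + Cmod v))) by (field; lra).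
  rewrite <- (Rmult_1_r (eps * Rabs (t - s))) at 2.
  apply Rmult_le_compat_l.
  { apply Rmult_le_pos; [apply Rlt_le, cond_pos|exact Ha]. }
  apply Rmult_le_reg_r with (1 + Cmod v); [exact Hv|].
  unfold Rdiv; rewrite Rmult_assoc, Rinv_l by lra; lra. }
split; (split; [apply (@is_linear_scal_l R_AbsRing R_NormedModule)|]);
  intros x Hx eps; rewrite <- (is_filter_lim_locally_unique _ _ Hx); clear x Hx;
  destruct (Hk eps) as [d Hd]; exists d; intros t Ht; specialize (Hd t Ht);
  (refine (Rle_trans _ _ _ _ Hd));
  [refine (Rle_trans _ _ _ _ (re_le_Cmod _))
  |refine (Rle_trans _ _ _ _ (im_le_Cmod _))]; apply Req_le;
  unfold norm, minus, plus, opp, scal; simpl; unfold abs, mult; simpl; f_equal;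
  unfold Re, Im; simpl; ring.
Qed.

(** Two mean values write the remainder as [f'' d * c] with 0 <= d <= c <= 1. The sharper Taylor
    constant 1/2 would bring nothing later. *)
Lemma second_order_bound (f f' f'' : R -> R) (M : R) :
  (forall t, 0 <= t <= 1 -> is_derive f t (f' t)) ->
  (forall t, 0 <= t <= 1 -> is_derive f' t (f'' t)) ->
  (forall t, 0 <= t <= 1 -> Rabs (f'' t) <= M) ->
  Rabs (f 1 - f 0 - f' 0) <= M.
Proof.
intros H1 H2 HM.
assert (cont : forall (g g' : R -> R) t, is_derive g t (g' t) -> continuity_pt g t).
{ intros g g' t H; apply continuity_pt_filterlim.
  apply (@ex_derive_continuous R_AbsRing R_NormedModule); exists (g' t); exact H. }
destruct (MVT_gen f 0 1 f') as [c [Hc Ec]].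
{ intros x Hx; rewrite Rmin_left, Rmax_right in Hx by lra; apply H1; lra. }
{ intros x Hx; rewrite Rmin_left, Rmax_right in Hx by lra; apply (cont f f'), H1; lra. }
rewrite Rmin_left, Rmax_right in Hc by lra.
destruct (MVT_gen f' 0 c f'') as [d [Hd Ed]].
{ intros x Hx; rewrite Rmin_left, Rmax_right in Hx by lra; apply H2; lra. }
{ intros x Hx; rewrite Rmin_left, Rmax_right in Hx by lra; apply (cont f' f''), H2; lra. }
rewrite Rmin_left, Rmax_right in Hd by lra.
replace (f 1 - f 0 - f' 0) with (f'' d * c) by (rewrite Ec; lra).
rewrite Rabs_mult, (Rabs_pos_eq c) by lra.
specialize (HM d ltac:(lra)); assert (H0 := Rabs_pos (f'' d)); nra.
Qed.

(** The mean value theorem fails for complex values, so it is applied to the real and imaginary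
    parts separately; adding the two bounds costs the factor 2. *)
Lemma complex_second_order_bound (f f1 f2 : C -> C) (z h : C) (M : R) :
  (forall t, 0 <= t <= 1 -> is_line_derive f z h t (f1 (z + RtoC t * h)%C)) ->
  (forall t, 0 <= t <= 1 -> is_line_derive f1 z h t (f2 (z + RtoC t * h)%C)) ->
  (forall t, 0 <= t <= 1 -> Cmod (f2 (z + RtoC t * h)%C) <= M) ->
  Cmod (f (z + h) - f z - h * f1 z)%C <= 2 * M * (Cmod h * Cmod h).
Proof.
intros H1 H2 HM.
assert (Hb : forall t, 0 <= t <= 1 ->
  Cmod (h * (h * f2 (z + RtoC t * h)))%C <= M * (Cmod h * Cmod h)).
{ intros t Ht; rewrite !Cmod_mult; specialize (HM t Ht).
  assert (H0 := Cmod_ge_0 h); assert (H3 : 0 <= Cmod h * Cmod h) by nra; nra. }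
assert (Hlin : forall t : R, 0 <= t <= 1 ->
  is_derive (fun t : R => Re (h * f1 (z + RtoC t * h)%C)%C) t
    (Re (h * (h * f2 (z + RtoC t * h)))%C) /\
  is_derive (fun t : R => Im (h * f1 (z + RtoC t * h)%C)%C) t
    (Im (h * (h * f2 (z + RtoC t * h)))%C)).
{ intros t Ht; destruct (H2 t Ht) as [Ha Hb']; split.
  - apply (is_derive_ext (fun t : R => Re h * Re (f1 (z + RtoC t * h)%C)
      - Im h * Im (f1 (z + RtoC t * h)%C))); [reflexivity|].
    apply (@is_derive_minus R_AbsRing R_NormedModule); apply is_derive_scal; assumption.
  - apply (is_derive_ext (fun t : R => Re h * Im (f1 (z + RtoC t * h)%C)
      + Im h * Re (f1 (z + RtoC t * h)%C))); [reflexivity|].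
    apply (@is_derive_plus R_AbsRing R_NormedModule); apply is_derive_scal; assumption. }
apply Rle_trans with (1 := Cmod_le_Rabs _).
replace (2 * M * (Cmod h * Cmod h))
  with (M * (Cmod h * Cmod h) + M * (Cmod h * Cmod h)) by ring.
apply Rplus_le_compat.
- assert (H := second_order_bound _ _ _ (M * (Cmod h * Cmod h))
    (fun t Ht => proj1 (H1 t Ht)) (fun t Ht => proj1 (Hlin t Ht))
    (fun t Ht => Rle_trans _ _ _ (re_le_Cmod _) (Hb t Ht))).
  cbv beta in H.
  replace (z + RtoC 1 * h)%C with (z + h)%C in H by ring.
  replace (z + RtoC 0 * h)%C with z in H by ring.
  exact H.
- assert (H := second_order_bound _ _ _ (M * (Cmod h * Cmod h))
    (fun t Ht => proj2 (H1 t Ht)) (fun t Ht => proj2 (Hlin t Ht))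
    (fun t Ht => Rle_trans _ _ _ (im_le_Cmod _) (Hb t Ht))).
  cbv beta in H.
  replace (z + RtoC 1 * h)%C with (z + h)%C in H by ring.
  replace (z + RtoC 0 * h)%C with z in H by ring.
  exact H.
Qed.

(** A remainder of order |h|^2 with an explicit constant can be integrated over a parameter, which
    an epsilon-delta condition cannot without uniformity. This form is what permits differentiation
    under the integral sign in [ex_cderive_Fint]. *)
Lemma is_cderive_of_quadratic (f : C -> C) (z l : C) (d : posreal) (M : R) :
  0 <= M ->
  (forall h : C, Cmod h < d ->
     Cmod (f (z + h) - f z - h * l)%C <= M * (Cmod h * Cmod h)) ->
  is_cderive f z l.
Proof.
intros HM H; apply is_cderive_eps; intros eps.
assert (Hd : 0 < Rmin d (eps / (M + 1))).
{ apply Rmin_pos; [apply cond_pos|]; apply Rdiv_lt_0_compat; [apply cond_pos|lra]. }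
exists (mkposreal _ Hd); intros w Hw; simpl in Hw.
assert (H1 := Rlt_le_trans _ _ _ Hw (Rmin_l _ _)).
assert (H2 := Rlt_le_trans _ _ _ Hw (Rmin_r _ _)).
specialize (H (w - z)%C H1).
replace (z + (w - z))%C with w in H by ring.
apply Rle_trans with (1 := H).
assert (H3 : Cmod (w - z)%C * (M + 1) < eps).
{ apply Rmult_lt_reg_r with (/ (M + 1)); [apply Rinv_0_lt_compat; lra|].
  rewrite Rmult_assoc, Rinv_r, Rmult_1_r by lra; exact H2. }
assert (H0 := Cmod_ge_0 (w - z)%C); nra.
Qed.

(** * The complex exponential *)

Lemma Cexp_plus (z w : C) : Cexp (z + w)%C = (Cexp z * Cexp w)%C.
Proof.
unfold Cexp, Cmult, Cplus, Re, Im; simpl; rewrite exp_plus, cos_plus, sin_plus; f_equal; ring.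
Qed.

Lemma Cexp_RtoC (x : R) : Cexp (RtoC x) = RtoC (exp x).
Proof. unfold Cexp, RtoC, Re, Im; simpl; rewrite cos_0, sin_0; f_equal; ring. Qed.

Lemma Cexp_0 : Cexp 0%C = 1%C.
Proof. rewrite Cexp_RtoC, exp_0; reflexivity. Qed.

Lemma Cmod_Cexp (z : C) : Cmod (Cexp z) = exp (Re z).
Proof.
unfold Cmod, Cexp; simpl.
replace (_ + _) with (exp (Re z) * exp (Re z) * (Rsqr (sin (Im z)) + Rsqr (cos (Im z))))
  by (unfold Rsqr; ring).
rewrite sin2_cos2, Rmult_1_r; apply sqrt_square, Rlt_le, exp_pos.
Qed.

Lemma Cexp_neq_0 (z : C) : Cexp z <> 0%C.
Proof. apply Cmod_gt_0; rewrite Cmod_Cexp; apply exp_pos. Qed.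

Lemma Cexp_opp (z : C) : Cexp (- z)%C = (/ Cexp z)%C.
Proof.
assert (H : (Cexp z * Cexp (- z) = 1)%C).
{ rewrite <- Cexp_plus, <- Cexp_0; f_equal; ring. }
assert (H0 := Cexp_neq_0 z).
replace (Cexp (- z)) with (/ Cexp z * (Cexp z * Cexp (- z)))%C by (field; exact H0).
rewrite H; ring.
Qed.

Lemma Cexp_line_derive (p v : C) (s : R) :
  is_line_derive Cexp p v s (Cexp (p + RtoC s * v)%C).
Proof.
destruct p as [a b], v as [c d]; split; unfold Cexp, Cmult, Cplus, Re, Im, RtoC; simpl;
  auto_derive; trivial; unfold Rminus; ring.
Qed.

Lemma is_cderive_Cexp (z : C) : is_cderive Cexp z (Cexp z).
Proof.
(* On the disc |h| < 1 the second derivative has modulus at most exp (Re z + 1); the factor 2 is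
   that of [complex_second_order_bound]. *)
apply is_cderive_of_quadratic with (d := mkposreal 1 Rlt_0_1)
  (M := 2 * exp (Re z + 1)); simpl.
{ assert (H := exp_pos (Re z + 1)); lra. }
intros h Hh; apply complex_second_order_bound with (f2 := Cexp);
  [intros; apply Cexp_line_derive|intros; apply Cexp_line_derive|].
intros t Ht; rewrite Cmod_Cexp.
assert (H := re_le_Cmod h).
assert (H1 : Re (z + RtoC t * h)%C <= Re z + 1).
{ replace (Re (z + RtoC t * h)%C) with (Re z + t * Re h) by (unfold Re; simpl; ring).
  assert (H2 := Rle_abs (Re h)); nra. }
destruct H1 as [H1|H1]; [apply Rlt_le, exp_increasing, H1|rewrite H1; lra].
Qed.

(** * The branch of log (1 + e^w) on the strip |Im w| < PI *)

(* On the strip [|Im w| < PI] this is the principal branch of [log (1 + e^w)]: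
   the argument is read off from [1 + e^w = 2 e^(w/2) cosh (w/2)], where
   [cosh (w/2)] lies in the right half plane. *)
Definition log1pexp (w : C) : C :=
  (ln (1 + 2 * exp (Re w) * cos (Im w) + exp (Re w) * exp (Re w)) / 2,
   Im w / 2 + atan ((exp (Re w) - 1) / (exp (Re w) + 1)
                    * (sin (Im w / 2) / cos (Im w / 2)))).

Definition logistic (w : C) : C := (Cexp w / (1 + Cexp w))%C.

Definition logistic' (w : C) : C := (Cexp w / ((1 + Cexp w) * (1 + Cexp w)))%C.

Lemma cos_half_pos (v : R) : Rabs v < PI -> 0 < cos (v / 2).
Proof. intros H; apply Rabs_def2 in H; apply cos_gt_0; lra. Qed.

Lemma Cmod_sqr (z : C) : Cmod z * Cmod z = Re z * Re z + Im z * Im z.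
Proof.
unfold Cmod; rewrite sqrt_sqrt; [unfold Re, Im; ring|].
simpl; nra.
Qed.

Lemma Cmod_1_Cexp_sqr (w : C) :
  Cmod (1 + Cexp w)%C * Cmod (1 + Cexp w)%C
  = 1 + 2 * exp (Re w) * cos (Im w) + exp (Re w) * exp (Re w).
Proof.
rewrite Cmod_sqr; destruct w as [u v]; unfold Cexp, Cplus, RtoC, Re, Im; simpl.
assert (H := sin2_cos2 v); unfold Rsqr in H.
replace (exp u * exp u) with (exp u * exp u * (sin v * sin v + cos v * cos v))
  by (rewrite H; ring).
ring.
Qed.

(** For w = u + i v the squares of the two sides differ by sin (v/2)^2 (1 - e^u)^2. The bound keeps
    1 + e^w away from zero uniformly on every narrower strip and feeds the estimates of [fermi],
    [logistic] and [logistic']. *)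
Lemma Cmod_1_Cexp_ge (w : C) : Rabs (Im w) < PI ->
  cos (Im w / 2) * (1 + exp (Re w)) <= Cmod (1 + Cexp w)%C.
Proof.
intros Hw; assert (Hc := cos_half_pos _ Hw); assert (HX := exp_pos (Re w)).
apply Rsqr_incr_0_var; [|apply Cmod_ge_0]; unfold Rsqr; rewrite Cmod_1_Cexp_sqr.
replace (cos (Im w)) with (2 * (cos (Im w / 2) * cos (Im w / 2)) - 1).
2: { replace (cos (Im w)) with (cos (2 * (Im w / 2))) by (f_equal; field).
  rewrite cos_2a_cos; ring. }
assert (H1 : cos (Im w / 2) <= 1) by apply COS_bound.
set (c := cos (Im w / 2)) in *; set (X := exp (Re w)) in *.
assert (0 <= (1 - c * c) * ((1 - X) * (1 - X))); [|lra].
apply Rmult_le_pos; [nra|apply Rle_0_sqr].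
Qed.

Lemma one_Cexp_neq_0 (w : C) : Rabs (Im w) < PI -> (1 + Cexp w)%C <> 0%C.
Proof.
intros Hw; apply Cmod_gt_0, Rlt_le_trans with (2 := Cmod_1_Cexp_ge _ Hw).
assert (H := cos_half_pos _ Hw); assert (HX := exp_pos (Re w)); nra.
Qed.

Lemma logistic_parts (w : C) :
  0 < 1 + 2 * exp (Re w) * cos (Im w) + exp (Re w) * exp (Re w) ->
  logistic w =
  ((exp (Re w) * cos (Im w) + exp (Re w) * exp (Re w))
     / (1 + 2 * exp (Re w) * cos (Im w) + exp (Re w) * exp (Re w)),
   exp (Re w) * sin (Im w)
     / (1 + 2 * exp (Re w) * cos (Im w) + exp (Re w) * exp (Re w))).
Proof.
destruct w as [u v]; unfold logistic, Cdiv, Cinv, Cmult, Cexp, Cplus, RtoC, Re, Im.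
simpl; intros Hp.
assert (H := sin2_cos2 v); unfold Rsqr in H.
set (X := exp u) in *; set (K := cos v) in *; set (S := sin v) in *.
assert (HD : (1 + X * K) ^ 2 + (0 + X * S) ^ 2 = 1 + 2 * X * K + X * X) by
  (replace (X * X) with (X * X * (S * S + K * K)) by (rewrite H; ring); ring).
simpl in HD; rewrite HD.
set (D := 1 + 2 * X * K + X * X) in *.
replace (X * X) with (X * X * (S * S + K * K)) by (rewrite H; ring).
f_equal; field; lra.
Qed.

(** Only derivatives along real lines are computed from the explicit components. Complex
    differentiability is recovered from them in [is_cderive_log1pexp] through the bound on
    [logistic']. *)
Lemma log1pexp_line_derive (p v : C) (s : R) :
  Rabs (Im (p + RtoC s * v)%C) < PI ->
  is_line_derive log1pexp p v s (logistic (p + RtoC s * v)%C).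
Proof.
intros Hs; assert (Hc := cos_half_pos _ Hs).
assert (Hn := Cmod_1_Cexp_sqr (p + RtoC s * v)%C).
assert (Hn0 := proj1 (Cmod_gt_0 _) (one_Cexp_neq_0 _ Hs)).
assert (Hp : 0 < Cmod (1 + Cexp (p + s * v)) * Cmod (1 + Cexp (p + s * v))) by nra.
rewrite Hn in Hp; clear Hn Hn0 Hs.
rewrite logistic_parts by exact Hp.
destruct p as [a b], v as [c d]; unfold is_line_derive, log1pexp.
assert (E1 : forall t, Re ((a, b) + RtoC t * (c, d))%C = a + t * c)
  by (intros; unfold Re; simpl; ring).
assert (E2 : forall t, Im ((a, b) + RtoC t * (c, d))%C = b + t * d)
  by (intros; unfold Im; simpl; ring).
rewrite E1, E2 in *.
set (X := exp (a + s * c)) in *.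
assert (HX : 0 < X) by apply exp_pos.
split.
- apply (is_derive_ext (fun t => ln (1 + 2 * exp (a + t * c) * cos (b + t * d)
    + exp (a + t * c) * exp (a + t * c)) / 2)).
  { intros t; cbv beta; rewrite E1, E2; reflexivity. }
  auto_derive; fold X; [exact Hp|].
  unfold Re, Cmult; simpl; field; lra.
- apply (is_derive_ext (fun t => (b + t * d) / 2
    + atan ((exp (a + t * c) - 1) / (exp (a + t * c) + 1)
      * (sin ((b + t * d) / 2) / cos ((b + t * d) / 2))))).
  { intros t; cbv beta; rewrite E1, E2; reflexivity. }
  auto_derive; fold X; [unfold Rdiv in Hc; repeat split; lra|].
  replace (b + s * d) with (2 * ((b + s * d) / 2)) in Hp by field.
  replace (cos (b + s * d)) with (cos (2 * ((b + s * d) / 2))) by (f_equal; field).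
  replace (sin (b + s * d)) with (sin (2 * ((b + s * d) / 2))) by (f_equal; field).
  unfold Rdiv in *.
  set (h := (b + s * d) * / 2) in *.
  rewrite cos_2a, sin_2a in *.
  assert (H := sin2_cos2 h); unfold Rsqr in H.
  set (K := cos h) in *; set (S := sin h) in *.
  unfold Im, Cmult; simpl.
  (* The left side is the denominator produced by the derivative of [atan]; it is |1 + e^w|^2
     written with the half angle. *)
  assert (HE : K * K * (X + 1) * (X + 1) + S * S * (X - 1) * (X - 1)
    = 1 + 2 * X * (K * K - S * S) + X * X).
  { replace (1 + 2 * X * (K * K - S * S) + X * X)
      with ((1 + X * X) * (S * S + K * K) + 2 * X * (K * K - S * S))
      by (rewrite H; ring); ring. }
  transitivity (d / 2 + (2 * X * c * S * K + (X * X - 1) * (d / 2) * (S * S + K * K))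
    / (K * K * (X + 1) * (X + 1) + S * S * (X - 1) * (X - 1))).
  { field; repeat split; lra. }
  rewrite H, HE; field; lra.
Qed.

Lemma is_cderive_logistic (w : C) :
  (1 + Cexp w)%C <> 0%C -> is_cderive logistic w (logistic' w).
Proof.
intros Hw.
replace (logistic' w) with
  (Cexp w * / (1 + Cexp w)
   + Cexp w * ((0 + Cexp w) * - / ((1 + Cexp w) * (1 + Cexp w))))%C
  by (unfold logistic'; field; exact Hw).
apply (is_cderive_mult Cexp (fun w => / (1 + Cexp w))%C); [apply is_cderive_Cexp|].
apply (is_cderive_comp Cinv (fun w => 1 + Cexp w)%C); [apply is_cderive_inv, Hw|].
apply (is_cderive_plus (fun _ => 1%C)); [apply is_cderive_const|apply is_cderive_Cexp].
Qed.

Lemma strip_convex (z h : C) (V t : R) :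
  Rabs (Im z) <= V -> Rabs (Im (z + h)%C) <= V -> 0 <= t <= 1 ->
  Rabs (Im (z + RtoC t * h)%C) <= V.
Proof.
intros H1 H2 Ht; apply Rabs_le_between in H1; apply Rabs_le_between in H2.
apply Rabs_le_between.
replace (Im (z + h)%C) with (Im z + Im h) in H2 by (unfold Im; simpl; ring).
replace (Im (z + RtoC t * h)%C) with (Im z + t * Im h) by (unfold Im; simpl; ring).
nra.
Qed.

Lemma cos_half_le (v V : R) : Rabs v <= V -> V < PI -> cos (V / 2) <= cos (v / 2).
Proof.
intros H HV.
assert (H0 := Rabs_pos v).
replace (cos (v / 2)) with (cos (Rabs v / 2)).
{ destruct H as [H|H]; [|rewrite H; lra]; apply Rlt_le, cos_decreasing_1; lra. }
unfold Rabs; destruct (Rcase_abs v); [|reflexivity].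
rewrite <- cos_neg; f_equal; field.
Qed.

Lemma Cmod_1_Cexp_ge_strip (w : C) (V : R) : Rabs (Im w) <= V -> V < PI ->
  cos (V / 2) * (1 + exp (Re w)) <= Cmod (1 + Cexp w)%C.
Proof.
intros H HV.
assert (HX := exp_pos (Re w)); assert (Hc := cos_half_le _ _ H HV).
apply Rle_trans with (2 := Cmod_1_Cexp_ge w ltac:(lra)); nra.
Qed.

Lemma Cmod_logistic'_le (w : C) (V : R) : Rabs (Im w) <= V -> V < PI ->
  Cmod (logistic' w) <= / (cos (V / 2) * cos (V / 2))
     * (exp (Re w) / ((1 + exp (Re w)) * (1 + exp (Re w)))).
Proof.
intros H HV.
assert (H0 := one_Cexp_neq_0 w ltac:(lra)).
unfold logistic'; rewrite Cmod_div, Cmod_mult, Cmod_Cexp by (apply Cmult_neq_0; exact H0).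
assert (Hc := Cmod_1_Cexp_ge_strip _ _ H HV); assert (HX := exp_pos (Re w)).
assert (HV0 : 0 < cos (V / 2)).
{ apply cos_half_pos; rewrite Rabs_pos_eq; [exact HV|].
  apply Rle_trans with (2 := H), Rabs_pos. }
set (c := cos (V / 2)) in *; set (X := exp (Re w)) in *; set (m := Cmod (1 + Cexp w)%C) in *.
replace (/ (c * c) * (X / ((1 + X) * (1 + X))))
  with (X / ((c * (1 + X)) * (c * (1 + X)))) by (field; lra).
apply Rmult_le_compat_l; [lra|]; apply Rinv_le_contravar.
{ apply Rmult_lt_0_compat; nra. }
apply Rmult_le_compat; try exact Hc; nra.
Qed.

Lemma log1pexp_second_order (z h : C) (V M : R) :
  Rabs (Im z) <= V -> Rabs (Im (z + h)%C) <= V -> V < PI ->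
  (forall t, 0 <= t <= 1 -> Cmod (logistic' (z + RtoC t * h)%C) <= M) ->
  Cmod (log1pexp (z + h) - log1pexp z - h * logistic z)%C <= 2 * M * (Cmod h * Cmod h).
Proof.
intros H1 H2 HV HM; apply complex_second_order_bound with (f2 := logistic'); [| |exact HM];
  intros t Ht; assert (Hs := strip_convex z h V t H1 H2 Ht).
- apply log1pexp_line_derive; lra.
- apply is_cderive_line, is_cderive_logistic, one_Cexp_neq_0; lra.
Qed.

Lemma first_order_bound (f f' : R -> R) (M : R) :
  (forall t, 0 <= t <= 1 -> is_derive f t (f' t)) ->
  (forall t, 0 <= t <= 1 -> Rabs (f' t) <= M) ->
  Rabs (f 1 - f 0) <= M.
Proof.
intros H1 HM.
destruct (MVT_gen f 0 1 f') as [c [Hc Ec]].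
{ intros x Hx; rewrite Rmin_left, Rmax_right in Hx by lra; apply H1; lra. }
{ intros x Hx; rewrite Rmin_left, Rmax_right in Hx by lra.
  apply continuity_pt_filterlim, (@ex_derive_continuous R_AbsRing R_NormedModule).
  exists (f' x); apply H1; lra. }
rewrite Rmin_left, Rmax_right in Hc by lra.
rewrite Ec, Rminus_0_r, Rmult_1_r; apply HM, Hc.
Qed.

Lemma complex_first_order_bound (f f1 : C -> C) (z h : C) (M : R) :
  (forall t, 0 <= t <= 1 -> is_line_derive f z h t (f1 (z + RtoC t * h)%C)) ->
  (forall t, 0 <= t <= 1 -> Cmod (f1 (z + RtoC t * h)%C) <= M) ->
  Cmod (f (z + h) - f z)%C <= 2 * M * Cmod h.
Proof.
intros H1 HM.
assert (Hb : forall t, 0 <= t <= 1 -> Cmod (h * f1 (z + RtoC t * h))%C <= M * Cmod h).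
{ intros t Ht; rewrite Cmod_mult; specialize (HM t Ht).
  assert (H0 := Cmod_ge_0 h); nra. }
apply Rle_trans with (1 := Cmod_le_Rabs _).
replace (2 * M * Cmod h) with (M * Cmod h + M * Cmod h) by ring.
apply Rplus_le_compat.
- assert (H := first_order_bound _ _ _ (fun t Ht => proj1 (H1 t Ht))
    (fun t Ht => Rle_trans _ _ _ (re_le_Cmod _) (Hb t Ht))).
  cbv beta in H.
  replace (z + RtoC 1 * h)%C with (z + h)%C in H by ring.
  replace (z + RtoC 0 * h)%C with z in H by ring.
  exact H.
- assert (H := first_order_bound _ _ _ (fun t Ht => proj2 (H1 t Ht))
    (fun t Ht => Rle_trans _ _ _ (im_le_Cmod _) (Hb t Ht))).
  cbv beta in H.
  replace (z + RtoC 1 * h)%C with (z + h)%C in H by ring.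
  replace (z + RtoC 0 * h)%C with z in H by ring.
  exact H.
Qed.

Lemma log1pexp_RtoC (x : R) : log1pexp (RtoC x) = RtoC (ln (1 + exp x)).
Proof.
unfold log1pexp, RtoC, Re, Im; simpl.
rewrite cos_0; replace (0 / 2) with 0 by field; rewrite sin_0, cos_0.
assert (HX := exp_pos x).
replace (1 + 2 * exp x * 1 + exp x * exp x) with ((1 + exp x) * (1 + exp x)) by ring.
rewrite ln_mult by lra.
replace ((exp x - 1) / (exp x + 1) * (0 / 1)) with 0 by (field; lra).
rewrite atan_0; f_equal; field.
Qed.

Lemma Cexp_log1pexp (w : C) : Rabs (Im w) < PI ->
  Cexp (log1pexp w) = (1 + Cexp w)%C.
Proof.
intros Hs; assert (Hc := cos_half_pos _ Hs).
assert (Hn := Cmod_1_Cexp_sqr w).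
assert (Hn0 := proj1 (Cmod_gt_0 _) (one_Cexp_neq_0 _ Hs)).
assert (Hp : 0 < Cmod (1 + Cexp w)%C * Cmod (1 + Cexp w)%C) by nra.
rewrite Hn in Hp; clear Hn Hn0 Hs.
destruct w as [u v]; unfold Cexp, log1pexp, Cplus, RtoC, Re, Im in *; simpl in *.
assert (HX := exp_pos u).
replace (ln (1 + 2 * exp u * cos v + exp u * exp u) / 2)
  with (ln (sqrt (1 + 2 * exp u * cos v + exp u * exp u))).
2: { assert (Hq := sqrt_lt_R0 _ Hp).
  rewrite <- (sqrt_sqrt _ (Rlt_le _ _ Hp)) at 2; rewrite ln_mult by exact Hq; field. }
rewrite exp_ln by (apply sqrt_lt_R0, Hp).
rewrite cos_plus, sin_plus, cos_atan, sin_atan.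
replace (cos v) with (cos (2 * (v / 2))) in * by (f_equal; field).
replace (sin v) with (sin (2 * (v / 2))) by (f_equal; field).
rewrite cos_2a, sin_2a in *.
assert (H := sin2_cos2 (v / 2)); unfold Rsqr in *.
set (K := cos (v / 2)) in *; set (S := sin (v / 2)) in *; set (X := exp u) in *.
set (D := 1 + 2 * X * (K * K - S * S) + X * X) in *.
assert (HE : D = K * K * (X + 1) * (X + 1) + S * S * (X - 1) * (X - 1)).
{ unfold D; replace (1 + 2 * X * (K * K - S * S) + X * X)
    with ((1 + X * X) * (S * S + K * K) + 2 * X * (K * K - S * S))
    by (rewrite H; ring); ring. }
(* Both cos (atan y) and sin (atan y) carry the factor 1 / sqrt (1 + y^2); with this value the
   [sqrt D] in it cancels against the modulus [sqrt D] of the exponential. *)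
assert (Hq : sqrt (1 + (X - 1) / (X + 1) * (S / K) * ((X - 1) / (X + 1) * (S / K)))
  = sqrt D / ((X + 1) * K)).
{ replace (1 + (X - 1) / (X + 1) * (S / K) * ((X - 1) / (X + 1) * (S / K)))
    with (D / (((X + 1) * K) * ((X + 1) * K))) by (rewrite HE; field; lra).
  assert (0 < (X + 1) * K) by nra.
  rewrite sqrt_div by nra; rewrite sqrt_square by lra; reflexivity. }
rewrite Hq; assert (Hd := sqrt_lt_R0 _ Hp).
f_equal.
- transitivity ((X + 1) * K * K - (X - 1) * S * S); [field; lra|].
  transitivity (S * S + K * K + X * (K * K - S * S)); [ring|rewrite H; reflexivity].
- transitivity (S * (X + 1) * K + K * (X - 1) * S); [field; lra|ring].
Qed.

Lemma Cmod_logistic_le (w : C) (V : R) : Rabs (Im w) <= V -> V < PI ->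
  Cmod (logistic w) <= / cos (V / 2) * exp (Re w).
Proof.
intros H HV.
assert (H0 := one_Cexp_neq_0 w ltac:(lra)).
unfold logistic; rewrite Cmod_div, Cmod_Cexp by exact H0.
assert (Hc := Cmod_1_Cexp_ge_strip _ _ H HV); assert (HX := exp_pos (Re w)).
assert (HV0 : 0 < cos (V / 2)).
{ apply cos_half_pos; rewrite Rabs_pos_eq; [exact HV|].
  apply Rle_trans with (2 := H), Rabs_pos. }
rewrite Rmult_comm; apply Rmult_le_compat_l; [lra|]; apply Rinv_le_contravar; nra.
Qed.

(** On the real axis ln (1 + e^x) <= e^x, and a vertical path of length |Im w| adds at most its
    length times the bound of [logistic]. Exponential growth is crude on the right, where the true
    growth is linear, but a single bound then serves both ends of the line. *)
Lemma Cmod_log1pexp_le (w : C) (V : R) : Rabs (Im w) <= V -> V < PI ->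
  Cmod (log1pexp w) <= (1 + 2 * V / cos (V / 2)) * exp (Re w).
Proof.
intros H HV.
assert (HX := exp_pos (Re w)); assert (Hv := Rabs_pos (Im w)).
assert (HV0 : 0 < cos (V / 2)).
{ apply cos_half_pos; rewrite Rabs_pos_eq; lra. }
set (h := (RtoC (Im w) * Ci)%C).
assert (Ew : w = (RtoC (Re w) + h)%C).
{ destruct w as [a b]; unfold h, Cplus, Cmult, RtoC, Ci, Re, Im; simpl; f_equal; ring. }
assert (Eh : Cmod h = Rabs (Im w)).
{ unfold h; rewrite Cmod_mult, Cmod_Ci, Cmod_R; ring. }
assert (Him : forall t, Im (RtoC (Re w) + RtoC t * h)%C = t * Im w).
{ intros t; unfold h, Cplus, Cmult, RtoC, Ci, Re, Im; simpl; ring. }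
assert (Hre : forall t, Re (RtoC (Re w) + RtoC t * h)%C = Re w).
{ intros t; unfold h, Cplus, Cmult, RtoC, Ci, Re, Im; simpl; ring. }
assert (Hst : forall t, 0 <= t <= 1 -> Rabs (Im (RtoC (Re w) + RtoC t * h)%C) <= V).
{ intros t Ht; rewrite Him, Rabs_mult, (Rabs_pos_eq t) by lra; nra. }
assert (Hb := complex_first_order_bound log1pexp logistic (RtoC (Re w)) h
  (/ cos (V / 2) * exp (Re w))).
rewrite <- Ew, Eh in Hb.
assert (Hd : Cmod (log1pexp w - log1pexp (RtoC (Re w)))%C
  <= 2 * (/ cos (V / 2) * exp (Re w)) * V).
{ apply Rle_trans with (1 := Hb
    (fun t Ht => log1pexp_line_derive _ _ _ (Rle_lt_trans _ _ _ (Hst t Ht) HV))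
    (fun t Ht => Rle_trans _ _ _ (Cmod_logistic_le _ _ (Hst t Ht) HV)
       (Req_le _ _ (f_equal (fun u => / cos (V / 2) * exp u) (Hre t))))).
  apply Rmult_le_compat_l; [|exact H].
  assert (0 < / cos (V / 2)) by (apply Rinv_0_lt_compat, HV0); nra. }
rewrite log1pexp_RtoC in Hd.
replace (log1pexp w) with (log1pexp w - RtoC (ln (1 + exp (Re w)))
  + RtoC (ln (1 + exp (Re w))))%C by ring.
apply Rle_trans with (1 := Cmod_triangle _ _).
replace ((1 + 2 * V / cos (V / 2)) * exp (Re w))
  with (2 * (/ cos (V / 2) * exp (Re w)) * V + exp (Re w)) by (field; lra).
apply Rplus_le_compat; [exact Hd|].
assert (H1 : ln 1 <= ln (1 + exp (Re w))) by (apply ln_le; lra).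
rewrite ln_1 in H1; rewrite Cmod_R, Rabs_pos_eq by exact H1.
assert (H2 := exp_ineq1_le (exp (Re w))).
rewrite <- (ln_exp (exp (Re w))) at 2; apply ln_le; lra.
Qed.

Lemma is_cderive_log1pexp (w : C) :
  Rabs (Im w) < PI -> is_cderive log1pexp w (logistic w).
Proof.
(* [V] lies halfway between |Im w| and PI, so a disc of radius (PI - |Im w|) / 2 around w stays in
   the closed strip of half-width [V] < PI. *)
intros Hw; set (V := (Rabs (Im w) + PI) / 2).
assert (Hv := Rabs_pos (Im w)).
assert (HV0 : 0 < cos (V / 2)).
{ apply cos_half_pos; rewrite Rabs_pos_eq; unfold V; lra. }
assert (Hd : 0 < (PI - Rabs (Im w)) / 2) by lra.
assert (Hi : 0 < / (cos (V / 2) * cos (V / 2))) by (apply Rinv_0_lt_compat; nra).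
apply is_cderive_of_quadratic with (d := mkposreal _ Hd)
  (M := 2 * / (cos (V / 2) * cos (V / 2))); [lra|].
simpl; intros h Hh.
assert (H1 : Rabs (Im (w + h)%C) <= V).
{ replace (Im (w + h)%C) with (Im w + Im h) by (unfold Im; simpl; ring).
  assert (H2 := im_le_Cmod h); assert (H3 := Rabs_triang (Im w) (Im h)); unfold V; lra. }
assert (H2 : Rabs (Im w) <= V) by (unfold V; lra).
apply log1pexp_second_order with (V := V); try assumption; [unfold V; lra|].
intros t Ht; assert (Hs := strip_convex w h V t H2 H1 Ht).
apply Rle_trans with (1 := Cmod_logistic'_le _ V Hs ltac:(unfold V; lra)).
rewrite <- (Rmult_1_r (/ _)) at 2; apply Rmult_le_compat_l; [lra|].
assert (HX := exp_pos (Re (w + t * h)%C)); set (X := exp _) in *.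
apply Rmult_le_reg_r with ((1 + X) * (1 + X)); [nra|].
unfold Rdiv; rewrite Rmult_assoc, Rinv_l by nra; nra.
Qed.

(** * Integrals over the real line *)

(** A total definition by symmetric intervals. Under exponential domination the limit exists, and by
    [IntR_approx] it does not depend on how the two ends go to infinity. *)
Definition IntR (f : R -> R) : R :=
  real (Lim_seq (fun n => RInt f (- INR n) (INR n))).

Definition exp_dominated (a M : R) (f : R -> R) : Prop :=
  (forall s, continuous f s) /\ forall s, Rabs (f s) <= M * exp (- a * Rabs s).

Lemma ex_RInt_cont (f : R -> R) (a b : R) :
  (forall s, continuous f s) -> ex_RInt f a b.
Proof. intros H; apply (@ex_RInt_continuous R_CompleteNormedModule); intros; apply H. Qed.

Lemma is_RInt_exp_lin (k A B : R) : k <> 0 ->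
  is_RInt (fun s => exp (k * s)) A B ((exp (k * B) - exp (k * A)) / k).
Proof.
intros Hk.
replace ((exp (k * B) - exp (k * A)) / k)
  with (minus (exp (k * B) / k) (exp (k * A) / k))
  by (unfold minus, plus, opp; simpl; field; exact Hk).
apply (@is_RInt_derive R_CompleteNormedModule (fun s => exp (k * s) / k)).
- intros x _; auto_derive; [exact I|]; field; exact Hk.
- intros x _; apply (@ex_derive_continuous R_AbsRing R_NormedModule).
  auto_derive; exact I.
Qed.

Section Domination.

Variables (a M : R) (f : R -> R).
Hypothesis (Ha : 0 < a).
Hypothesis (Hf : exp_dominated a M f).

Lemma exp_dominated_M_nonneg : 0 <= M.
Proof.
destruct Hf as [_ H]; specialize (H 0); rewrite Rabs_R0, Rmult_0_r, exp_0 in H.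
assert (H0 := Rabs_pos (f 0)); lra.
Qed.

Lemma RInt_tail_right (A B : R) : 0 <= A <= B ->
  Rabs (RInt f A B) <= M / a * exp (- a * A).
Proof.
intros HAB; destruct Hf as [Hc Hd]; assert (HM := exp_dominated_M_nonneg).
assert (HE : is_RInt (fun s => M * exp (- a * s)) A B
  (M * ((exp (- a * B) - exp (- a * A)) / - a)))
  by exact (is_RInt_scal _ _ _ M _ (is_RInt_exp_lin (- a) A B ltac:(lra))).
apply Rle_trans with (RInt (fun s => Rabs (f s)) A B).
{ apply abs_RInt_le; [lra|apply ex_RInt_cont, Hc]. }
apply Rle_trans with (RInt (fun s => M * exp (- a * s)) A B).
{ apply RInt_le; [lra| |eexists; exact HE|].
  - apply ex_RInt_cont; intros s; apply (continuous_comp f Rabs); [apply Hc|].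
    apply continuous_Rabs.
  - intros x Hx; apply Rle_trans with (1 := Hd x); rewrite Rabs_pos_eq by lra.
    apply Rle_refl. }
rewrite (is_RInt_unique _ _ _ _ HE).
assert (H1 := exp_pos (- a * B)); assert (H2 := exp_pos (- a * A)).
replace (M * ((exp (- a * B) - exp (- a * A)) / - a))
  with (M / a * (exp (- a * A) - exp (- a * B))) by (field; lra).
apply Rmult_le_compat_l; [|lra]; apply Rdiv_le_0_compat; assumption.
Qed.

Lemma RInt_tail_left (A B : R) : 0 <= A <= B ->
  Rabs (RInt f (- B) (- A)) <= M / a * exp (- a * A).
Proof.
intros HAB; destruct Hf as [Hc Hd]; assert (HM := exp_dominated_M_nonneg).
assert (HE : is_RInt (fun s => M * exp (a * s)) (- B) (- A)
  (M * ((exp (a * - A) - exp (a * - B)) / a)))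
  by exact (is_RInt_scal _ _ _ M _ (is_RInt_exp_lin a (- B) (- A) ltac:(lra))).
apply Rle_trans with (RInt (fun s => Rabs (f s)) (- B) (- A)).
{ apply abs_RInt_le; [lra|apply ex_RInt_cont, Hc]. }
apply Rle_trans with (RInt (fun s => M * exp (a * s)) (- B) (- A)).
{ apply RInt_le; [lra| |eexists; exact HE|].
  - apply ex_RInt_cont; intros s; apply (continuous_comp f Rabs); [apply Hc|].
    apply continuous_Rabs.
  - intros x Hx; apply Rle_trans with (1 := Hd x); rewrite Rabs_left by lra.
    apply Req_le; do 2 f_equal; ring. }
rewrite (is_RInt_unique _ _ _ _ HE).
assert (H1 := exp_pos (a * - B)).
replace (a * - A) with (- a * A) by ring.
assert (H2 := exp_pos (- a * A)).
replace (M * ((exp (- a * A) - exp (a * - B)) / a))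
  with (M / a * (exp (- a * A) - exp (a * - B))) by (field; lra).
apply Rmult_le_compat_l; [|lra]; apply Rdiv_le_0_compat; assumption.
Qed.

Lemma RInt_nested (A B A' B' : R) : 0 <= A <= A' -> 0 <= B <= B' ->
  Rabs (RInt f (- A') B' - RInt f (- A) B)
  <= M / a * (exp (- a * A) + exp (- a * B)).
Proof.
intros HA HB; assert (Hc := proj1 Hf).
assert (HI := fun x y => ex_RInt_cont f x y Hc).
assert (E : RInt f (- A') B' - RInt f (- A) B
  = RInt f (- A') (- A) + RInt f B B').
{ rewrite <- (RInt_Chasles f (- A') (- A) B') by apply HI.
  rewrite <- (RInt_Chasles f (- A) B B') by apply HI.
  unfold plus; simpl; ring. }
rewrite E; apply Rle_trans with (1 := Rabs_triang _ _).
rewrite Rmult_plus_distr_l; apply Rplus_le_compat;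
  [apply RInt_tail_left|apply RInt_tail_right]; assumption.
Qed.

Lemma exp_tail_small (eps : R) : 0 < eps ->
  exists N : nat, forall x, INR N <= x -> M / a * (exp (- a * x) + exp (- a * x)) < eps.
Proof.
intros He; assert (HM := exp_dominated_M_nonneg).
(* By e^(-y) <= 1/y the two tails together are at most 2 (M/a) / (a x), which is below [eps] for x >
   K. *)
set (K := 2 * (M / a) / (a * eps)).
assert (HK : 0 <= K).
{ unfold K; apply Rdiv_le_0_compat; [|nra].
  apply Rmult_le_pos; [lra|apply Rdiv_le_0_compat; assumption]. }
exists (S (Z.to_nat (up K))); intros x Hx.
assert (HKx : K < x).
{ apply Rlt_le_trans with (2 := Hx); rewrite S_INR, INR_IZR_INZ, Z2Nat.id.
  - destruct (archimed K); lra.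
  - destruct (archimed K) as [H _]; apply le_IZR; lra. }
assert (Hx1 := exp_ineq1_le (a * x)).
assert (Hx0 : 0 < a * x) by nra.
assert (E : exp (- a * x) = / exp (a * x)) by (rewrite <- exp_Ropp; f_equal; ring).
rewrite E; assert (H1 : / exp (a * x) <= / (a * x)) by (apply Rinv_le_contravar; lra).
assert (Hq : 0 <= M / a) by (apply Rdiv_le_0_compat; assumption).
apply Rle_lt_trans with (2 * (M / a) * / (a * x)); [nra|].
apply Rmult_lt_reg_r with (a * x); [exact Hx0|].
rewrite Rmult_assoc, Rinv_l, Rmult_1_r by lra.
apply Rmult_lt_reg_r with (/ (a * eps)); [apply Rinv_0_lt_compat; nra|].
replace (eps * (a * x) * / (a * eps)) with x by (field; lra); exact HKx.
Qed.

Lemma is_lim_IntR :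
  is_lim_seq (fun n => RInt f (- INR n) (INR n)) (IntR f).
Proof.
assert (HC : ex_lim_seq_cauchy (fun n => RInt f (- INR n) (INR n))).
{ intros eps; destruct (exp_tail_small (eps / 2)) as [N HN].
  { apply is_pos_div_2. }
  exists N.
  assert (Hn : forall n, (N <= n)%nat ->
    Rabs (RInt f (- INR n) (INR n) - RInt f (- INR N) (INR N)) < eps / 2).
  { intros n Hn; apply Rle_lt_trans with (2 := HN (INR N) (Rle_refl _)).
    apply RInt_nested; split; try apply pos_INR; apply le_INR, Hn. }
  intros n m Hn1 Hm1.
  replace (RInt f (- INR n) (INR n) - RInt f (- INR m) (INR m))
    with ((RInt f (- INR n) (INR n) - RInt f (- INR N) (INR N))
      - (RInt f (- INR m) (INR m) - RInt f (- INR N) (INR N))) by ring.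
  apply Rle_lt_trans with (1 := Rabs_triang _ _); rewrite Rabs_Ropp.
  assert (H1 := Hn n Hn1); assert (H2 := Hn m Hm1); lra. }
apply ex_lim_seq_cauchy_corr in HC; destruct HC as [l Hl].
unfold IntR; rewrite (is_lim_seq_unique _ _ Hl); exact Hl.
Qed.

(** The ends vary independently, as they do in the improper integral defining [L_q]; the estimate is
    the limit of [RInt_nested] as the outer interval grows. *)
Lemma IntR_approx (A B : R) : 0 <= A -> 0 <= B ->
  Rabs (RInt f (- A) B - IntR f) <= M / a * (exp (- a * A) + exp (- a * B)).
Proof.
intros HA HB.
assert (HL : is_lim_seq (fun n => Rabs (RInt f (- INR n) (INR n) - RInt f (- A) B))
  (Rabs (IntR f - RInt f (- A) B))).
{ apply (is_lim_seq_abs _ (Finite (IntR f - RInt f (- A) B))).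
  apply is_lim_seq_minus'; [apply is_lim_IntR|apply is_lim_seq_const]. }
rewrite Rabs_minus_sym.
refine (is_lim_seq_le_loc _ _ (Finite _) (Finite _) _ HL (is_lim_seq_const _)).
exists (Z.to_nat (up (Rmax A B))); intros n Hn.
assert (Hm : Rmax A B <= INR n).
{ apply le_INR in Hn; apply Rle_trans with (2 := Hn).
  rewrite INR_IZR_INZ, Z2Nat.id.
  - destruct (archimed (Rmax A B)); lra.
  - destruct (archimed (Rmax A B)) as [H _]; apply le_IZR.
    assert (H1 := Rmax_l A B); lra. }
assert (H1 := Rmax_l A B); assert (H2 := Rmax_r A B).
apply RInt_nested; lra.
Qed.

Lemma IntR_bound : Rabs (IntR f) <= 2 * (M / a).
Proof.
(* At A = B = 0 the finite integral vanishes and the whole integral is the error term. *)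
assert (H := IntR_approx 0 0 (Rle_refl _) (Rle_refl _)).
rewrite Ropp_0, RInt_point, Rmult_0_r, exp_0 in H; unfold zero in H; simpl in H.
rewrite Rminus_0_l, Rabs_Ropp in H; lra.
Qed.

End Domination.

Lemma IntR_lim_unique (f : R -> R) (l : R) :
  is_lim_seq (fun n => RInt f (- INR n) (INR n)) l -> IntR f = l.
Proof. intros H; unfold IntR; rewrite (is_lim_seq_unique _ _ H); reflexivity. Qed.

Lemma IntR_ext (f g : R -> R) : (forall s, f s = g s) -> IntR f = IntR g.
Proof.
intros H; unfold IntR; f_equal; apply Lim_seq_ext; intros n; apply RInt_ext.
intros; apply H.
Qed.

Lemma IntR_lin (a M1 M2 c1 c2 : R) (f g : R -> R) : 0 < a ->
  exp_dominated a M1 f -> exp_dominated a M2 g ->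
  IntR (fun s => c1 * f s + c2 * g s) = c1 * IntR f + c2 * IntR g.
Proof.
intros Ha Hf Hg; apply IntR_lim_unique.
apply is_lim_seq_ext with
  (fun n => c1 * RInt f (- INR n) (INR n) + c2 * RInt g (- INR n) (INR n)).
{ intros n; symmetry; apply is_RInt_unique.
  assert (H1 := RInt_correct _ _ _ (ex_RInt_cont f (- INR n) (INR n) (proj1 Hf))).
  assert (H2 := RInt_correct _ _ _ (ex_RInt_cont g (- INR n) (INR n) (proj1 Hg))).
  exact (is_RInt_plus _ _ _ _ _ _ (is_RInt_scal _ _ _ c1 _ H1)
    (is_RInt_scal _ _ _ c2 _ H2)). }
apply is_lim_seq_plus'.
- apply (is_lim_seq_scal_l _ c1 (Finite _)), (is_lim_IntR a M1); assumption.
- apply (is_lim_seq_scal_l _ c2 (Finite _)), (is_lim_IntR a M2); assumption.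
Qed.

Lemma IntR_even (a M : R) (f : R -> R) : 0 < a -> exp_dominated a M f ->
  IntR (fun s => f (- s)) = IntR f.
Proof.
intros Ha Hf; apply IntR_lim_unique.
apply is_lim_seq_ext with (2 := is_lim_IntR a M f Ha Hf); intros n; symmetry.
assert (H := ex_RInt_cont f (- (- INR n)) (- INR n) (proj1 Hf)).
assert (H1 := is_RInt_comp_opp _ _ _ _ (RInt_correct _ _ _ H)).
apply is_RInt_opp in H1; rewrite Ropp_involutive in H1.
apply (is_RInt_ext _ (fun s => f (- s))) in H1.
2: { intros x _; apply opp_opp. }
rewrite (is_RInt_unique _ _ _ _ H1).
apply (opp_RInt_swap f), ex_RInt_cont, (proj1 Hf).
Qed.

(** * Integrals of complex-valued functions *)

Definition IntC (f : R -> C) : C :=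
  (IntR (fun s => Re (f s)), IntR (fun s => Im (f s))).

Definition Cexp_dominated (a M : R) (f : R -> C) : Prop :=
  (forall s, continuous (fun t => Re (f t)) s) /\
  (forall s, continuous (fun t => Im (f t)) s) /\
  forall s, Cmod (f s) <= M * exp (- a * Rabs s).

Lemma exp_dominated_Re (a M : R) (f : R -> C) :
  Cexp_dominated a M f -> exp_dominated a M (fun s => Re (f s)).
Proof.
intros [H1 [H2 H3]]; split; [exact H1|intros s].
apply Rle_trans with (2 := H3 s), re_le_Cmod.
Qed.

Lemma exp_dominated_Im (a M : R) (f : R -> C) :
  Cexp_dominated a M f -> exp_dominated a M (fun s => Im (f s)).
Proof.
intros [H1 [H2 H3]]; split; [exact H2|intros s].
apply Rle_trans with (2 := H3 s), im_le_Cmod.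
Qed.

Lemma Cexp_dominated_plus (a M1 M2 : R) (f g : R -> C) :
  Cexp_dominated a M1 f -> Cexp_dominated a M2 g ->
  Cexp_dominated a (M1 + M2) (fun s => f s + g s)%C.
Proof.
intros [F1 [F2 F3]] [G1 [G2 G3]]; split; [|split]; intros s.
- apply (@continuous_plus R_UniformSpace R_AbsRing R_NormedModule
    (fun t => Re (f t)) (fun t => Re (g t))); auto.
- apply (@continuous_plus R_UniformSpace R_AbsRing R_NormedModule
    (fun t => Im (f t)) (fun t => Im (g t))); auto.
- apply Rle_trans with (1 := Cmod_triangle _ _).
  rewrite Rmult_plus_distr_r; apply Rplus_le_compat; auto.
Qed.

Lemma Cexp_dominated_scal (a M : R) (c : C) (f : R -> C) :
  Cexp_dominated a M f -> Cexp_dominated a (Cmod c * M) (fun s => c * f s)%C.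
Proof.
intros [F1 [F2 F3]]; split; [|split]; intros s.
- apply (@continuous_minus R_UniformSpace R_AbsRing R_NormedModule
    (fun t => Re c * Re (f t)) (fun t => Im c * Im (f t)));
    apply (@continuous_scal_r R_UniformSpace R_AbsRing R_NormedModule); auto.
- apply (@continuous_plus R_UniformSpace R_AbsRing R_NormedModule
    (fun t => Re c * Im (f t)) (fun t => Im c * Re (f t)));
    apply (@continuous_scal_r R_UniformSpace R_AbsRing R_NormedModule); auto.
- rewrite Cmod_mult, Rmult_assoc; apply Rmult_le_compat_l; [apply Cmod_ge_0|apply F3].
Qed.

Lemma IntC_ext (f g : R -> C) : (forall s, f s = g s) -> IntC f = IntC g.
Proof. intros H; unfold IntC; f_equal; apply IntR_ext; intros; rewrite H; reflexivity. Qed.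

Lemma IntC_plus (a M1 M2 : R) (f g : R -> C) : 0 < a ->
  Cexp_dominated a M1 f -> Cexp_dominated a M2 g ->
  IntC (fun s => f s + g s)%C = (IntC f + IntC g)%C.
Proof.
intros Ha Hf Hg; unfold IntC, Cplus at 3; simpl; f_equal.
- rewrite <- (Rmult_1_l (IntR (fun s => Re (f s)))), <- (Rmult_1_l (IntR (fun s => Re (g s)))).
  rewrite <- (IntR_lin a M1 M2) by (auto; apply exp_dominated_Re; assumption).
  apply IntR_ext; intros s; unfold Re; simpl; ring.
- rewrite <- (Rmult_1_l (IntR (fun s => Im (f s)))), <- (Rmult_1_l (IntR (fun s => Im (g s)))).
  rewrite <- (IntR_lin a M1 M2) by (auto; apply exp_dominated_Im; assumption).
  apply IntR_ext; intros s; unfold Im; simpl; ring.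
Qed.

Lemma IntC_scal (a M : R) (c : C) (f : R -> C) : 0 < a -> Cexp_dominated a M f ->
  IntC (fun s => c * f s)%C = (c * IntC f)%C.
Proof.
intros Ha Hf; unfold IntC, Cmult at 3; simpl; f_equal.
- transitivity (Re c * IntR (fun s => Re (f s)) + - Im c * IntR (fun s => Im (f s))).
  + rewrite <- (IntR_lin a M M);
      [|exact Ha|apply exp_dominated_Re; assumption|apply exp_dominated_Im; assumption].
    apply IntR_ext; intros s; unfold Re, Im; simpl; ring.
  + unfold Re, Im; ring.
- transitivity (Re c * IntR (fun s => Im (f s)) + Im c * IntR (fun s => Re (f s))).
  + rewrite <- (IntR_lin a M M);
      [|exact Ha|apply exp_dominated_Im; assumption|apply exp_dominated_Re; assumption].
    apply IntR_ext; intros s; unfold Re, Im; simpl; ring.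
  + unfold Re, Im; ring.
Qed.

Lemma IntC_even (a M : R) (f : R -> C) : 0 < a -> Cexp_dominated a M f ->
  IntC (fun s => f (- s)) = IntC f.
Proof.
intros Ha Hf; unfold IntC; f_equal.
- exact (IntR_even a M _ Ha (exp_dominated_Re _ _ _ Hf)).
- exact (IntR_even a M _ Ha (exp_dominated_Im _ _ _ Hf)).
Qed.

Lemma IntC_bound (a M : R) (f : R -> C) : 0 < a -> Cexp_dominated a M f ->
  Cmod (IntC f) <= 4 * (M / a).
Proof.
intros Ha Hf; apply Rle_trans with (1 := Cmod_le_Rabs _); unfold IntC; simpl.
assert (H1 := IntR_bound a M _ Ha (exp_dominated_Re _ _ _ Hf)).
assert (H2 := IntR_bound a M _ Ha (exp_dominated_Im _ _ _ Hf)).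
unfold Re, Im in *; simpl in *; lra.
Qed.

Lemma continuous_line (f : C -> C) (p v : C) (s : R) :
  (exists l, is_cderive f (p + RtoC s * v)%C l) ->
  continuous (fun t : R => Re (f (p + RtoC t * v)%C)) s /\
  continuous (fun t : R => Im (f (p + RtoC t * v)%C)) s.
Proof.
intros [l Hl]; destruct (is_cderive_line _ _ _ _ _ Hl) as [H1 H2].
split; apply (@ex_derive_continuous R_AbsRing R_NormedModule); eexists; eassumption.
Qed.

Lemma Cexp_dominated_line (a M : R) (f : C -> C) (p v : C) :
  (forall s : R, exists l, is_cderive f (p + RtoC s * v)%C l) ->
  (forall s : R, Cmod (f (p + RtoC s * v)%C) <= M * exp (- a * Rabs s)) ->
  Cexp_dominated a M (fun s => f (p + RtoC s * v)%C).
Proof.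
intros H1 H2; split; [|split]; [| |exact H2]; intros s;
  apply (continuous_line f p v s (H1 s)).
Qed.

Lemma Cexp_dominated_ext (a M : R) (f g : R -> C) :
  (forall s, f s = g s) -> Cexp_dominated a M f -> Cexp_dominated a M g.
Proof.
intros H [F1 [F2 F3]]; split; [|split]; intros s.
- apply (continuous_ext (fun t => Re (f t))); [intros; rewrite H; reflexivity|apply F1].
- apply (continuous_ext (fun t => Im (f t))); [intros; rewrite H; reflexivity|apply F2].
- rewrite <- H; apply F3.
Qed.

(** * Moving the line of integration *)

(* [P] and [Q] stand for conjugate harmonic functions: [dP/dy = dQ/dx]. *)
Lemma RInt_shift_bound (lo hi y b M : R) (P Q D : R -> R -> R) :
  lo < 0 < hi -> lo < y < hi -> 0 <= b ->
  (forall u x, lo < u < hi -> is_derive (fun u' => P u' x) u (D u x)) ->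
  (forall u x, lo < u < hi -> is_derive (fun x' => Q u x') x (D u x)) ->
  (forall u x, lo < u < hi -> continuity_2d_pt D u x) ->
  (forall u x, lo < u < hi -> continuous (fun x' => P u x') x) ->
  (forall u, lo < u < hi -> Rabs (Q u b) <= M /\ Rabs (Q u (- b)) <= M) ->
  Rabs (RInt (P y) (- b) b - RInt (P 0) (- b) b) <= 2 * M * Rabs y.
Proof.
intros H0 Hy Hb HP HQ HD HC HM.
(* Differentiation under the integral sign replaces dP/du by dQ/dx, whose integral is a difference
   of end values. Only the two vertical sides of the rectangle contribute. *)
assert (Hder : forall u, lo < u < hi ->
  is_derive (fun u' => RInt (fun x => P u' x) (- b) b) u (Q u b - Q u (- b))).
{ intros u Hu.
  assert (Hloc : locally u (fun u' => lo < u' < hi)).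
  { apply (open_and (fun x => lo < x) (fun x => x < hi) (open_gt lo) (open_lt hi)).
    exact Hu. }
  assert (HDx : forall x, continuous (fun x' => D u x') x).
  { intros x; apply continuity_pt_filterlim; intros e He.
    destruct (HD u x Hu (mkposreal e He)) as [d Hd]; exists d; split; [apply cond_pos|].
    intros x' [_ Hx']; apply (Hd u x'); [|exact Hx'].
    rewrite Rminus_diag, Rabs_R0; apply cond_pos. }
  assert (HI : is_RInt (fun x => Derive (fun u' => P u' x) u) (- b) b (Q u b - Q u (- b))).
  { apply is_RInt_ext with (fun x => D u x).
    { intros x _; symmetry; apply is_derive_unique, HP, Hu. }
    apply (@is_RInt_derive R_CompleteNormedModule (fun x => Q u x) (fun x => D u x)).
    - intros x _; apply HQ, Hu.
    - intros x _; apply HDx. }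
  rewrite <- (is_RInt_unique _ _ _ _ HI).
  apply (is_derive_RInt_param P (- b) b u).
  - revert Hloc; apply filter_imp; intros u' Hu' t _; exists (D u' t); apply HP, Hu'.
  - intros t _; apply continuity_2d_pt_ext_loc with D; [|apply HD, Hu].
    destruct Hloc as [d Hd]; exists d; intros u' v Hu' _.
    symmetry; apply is_derive_unique, HP, Hd, Hu'.
  - revert Hloc; apply filter_imp; intros u' Hu'.
    apply (@ex_RInt_continuous R_CompleteNormedModule); intros; apply HC, Hu'. }
assert (Hin : forall c, Rmin 0 y <= c <= Rmax 0 y -> lo < c < hi).
{ intros c; unfold Rmin, Rmax; destruct (Rle_dec 0 y); lra. }
destruct (MVT_gen (fun u' => RInt (fun x => P u' x) (- b) b) 0 y
  (fun u => Q u b - Q u (- b))) as [c [Hc Ec]].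
{ intros x Hx; apply Hder, Hin; lra. }
{ intros x Hx; apply continuity_pt_filterlim.
  apply (@ex_derive_continuous R_AbsRing R_NormedModule
    (fun u' => RInt (fun x => P u' x) (- b) b)).
  exists (Q x b - Q x (- b)); apply Hder, Hin, Hx. }
specialize (Hin c Hc); destruct (HM c Hin) as [M1 M2].
change (RInt (P y) (- b) b) with (RInt (fun x => P y x) (- b) b).
change (RInt (P 0) (- b) b) with (RInt (fun x => P 0 x) (- b) b).
rewrite Ec, Rminus_0_r, Rabs_mult; apply Rmult_le_compat_r; [apply Rabs_pos|].
apply Rle_trans with (1 := Rabs_triang _ _); rewrite Rabs_Ropp; lra.
Qed.

Lemma is_lim_seq_exp_neg (a : R) : 0 < a -> is_lim_seq (fun n => exp (- a * INR n)) 0.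
Proof.
intros Ha; apply is_lim_seq_ext with (fun n => exp (- a) ^ n).
{ induction n as [|n IH]; [simpl; rewrite Rmult_0_r, exp_0; reflexivity|].
  rewrite S_INR; simpl; rewrite IH, <- exp_plus; f_equal; ring. }
apply is_lim_seq_geom; rewrite Rabs_pos_eq by apply Rlt_le, exp_pos.
rewrite <- exp_0; apply exp_increasing; lra.
Qed.

(** The vertical sides at abscissas +- n contribute at most 2 M e^(-a n) |y|, which tends to 0. *)
Lemma IntR_shift (lo hi y a M : R) (P Q D : R -> R -> R) :
  lo < 0 < hi -> lo < y < hi -> 0 < a ->
  (forall u x, lo < u < hi -> is_derive (fun u' => P u' x) u (D u x)) ->
  (forall u x, lo < u < hi -> is_derive (fun x' => Q u x') x (D u x)) ->
  (forall u x, lo < u < hi -> continuity_2d_pt D u x) ->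
  (forall u, lo < u < hi -> exp_dominated a M (P u)) ->
  (forall u x, lo < u < hi -> Rabs (Q u x) <= M * exp (- a * Rabs x)) ->
  IntR (P y) = IntR (P 0).
Proof.
intros H0 Hy Ha HP HQ HD HPd HQd.
assert (HM := exp_dominated_M_nonneg a M (P 0) (HPd 0 H0)).
assert (Hb : forall n : nat,
  Rabs (RInt (P y) (- INR n) (INR n) - RInt (P 0) (- INR n) (INR n))
  <= 2 * (M * exp (- a * INR n)) * Rabs y).
{ intros n; assert (Hn := pos_INR n).
  apply (RInt_shift_bound lo hi y (INR n) (M * exp (- a * INR n)) P Q D); auto.
  - intros u x Hu; apply (HPd u Hu).
  - intros u Hu; assert (H1 := HQd u (INR n) Hu); assert (H2 := HQd u (- INR n) Hu).
    rewrite Rabs_Ropp in H2; rewrite (Rabs_pos_eq (INR n)) in H1, H2 by exact Hn; auto. }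
assert (L1 := is_lim_IntR a M _ Ha (HPd y Hy)).
assert (L2 := is_lim_IntR a M _ Ha (HPd 0 H0)).
assert (L := is_lim_seq_abs _ _ (is_lim_seq_minus' _ _ _ _ L1 L2)).
assert (L0 : is_lim_seq (fun n => 2 * M * Rabs y * exp (- a * INR n)) (2 * M * Rabs y * 0))
  by apply (is_lim_seq_scal_l _ _ (Finite 0)), (is_lim_seq_exp_neg a Ha).
assert (L3 : Rabs (IntR (P y) - IntR (P 0)) <= 2 * M * Rabs y * 0).
{ refine (is_lim_seq_le _ _ (Finite _) (Finite _) _ L L0); intros n.
  apply Rle_trans with (1 := Hb n), Req_le; ring. }
assert (H3 := Rabs_pos (IntR (P y) - IntR (P 0))).
apply Rminus_diag_uniq, Rabs_eq_0; lra.
Qed.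

Lemma continuity_2d_pt_Re_Im (f : C -> C) (u x : R) :
  (exists l, is_cderive f (x, u) l) ->
  continuity_2d_pt (fun u' x' => Re (f (x', u'))) u x /\
  continuity_2d_pt (fun u' x' => Im (f (x', u'))) u x.
Proof.
intros [l Hl]; assert (Hc := is_cderive_continuous _ _ _ Hl).
assert (H : forall eps : posreal, exists d : posreal, forall u' x',
  Rabs (u' - u) < d -> Rabs (x' - x) < d -> Cmod (f (x', u') - f (x, u))%C < eps).
{ intros eps; destruct (continuous_C_eps f (x, u) eps Hc) as [d Hd].
  exists (pos_div_2 d); simpl; intros u' x' Hu' Hx'; apply Hd.
  apply Rle_lt_trans with (1 := Cmod_le_Rabs _).
  unfold Re, Im; simpl; unfold Rminus in *; lra. }
split; intros eps; destruct (H eps) as [d Hd]; exists d; intros u' x' Hu' Hx';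
  refine (Rle_lt_trans _ _ _ _ (Hd u' x' Hu' Hx'));
  [exact (re_le_Cmod (f (x', u') - f (x, u))%C)|exact (im_le_Cmod (f (x', u') - f (x, u))%C)].
Qed.

(** The Cauchy-Riemann equations give the conjugate pairs (Re g, - Im g) for the real part and (Im
    g, Re g) for the imaginary part. Differentiability of [g'] enters through the joint continuity
    required for differentiating under the integral. *)
Lemma IntC_shift (lo hi y a M : R) (g g' : C -> C) :
  lo < 0 < hi -> lo < y < hi -> 0 < a ->
  (forall s, lo < Im s < hi -> is_cderive g s (g' s)) ->
  (forall s, lo < Im s < hi -> exists l, is_cderive g' s l) ->
  (forall s, lo < Im s < hi -> Cmod (g s) <= M * exp (- a * Rabs (Re s))) ->
  IntC (fun r => g (r, y)) = IntC (fun r => g (RtoC r)).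
Proof.
intros H0 Hy Ha Hg Hg' HM.
assert (Ex : forall u x : R, ((0, u) + RtoC x * 1)%C = (x, u))
  by (intros; unfold Cplus, Cmult, RtoC; simpl; f_equal; ring).
assert (Eu : forall u x : R, (RtoC x + RtoC u * Ci)%C = (x, u))
  by (intros; unfold Cplus, Cmult, RtoC, Ci; simpl; f_equal; ring).
assert (Hx : forall u x : R, lo < u < hi -> is_line_derive g (0, u) 1 x (g' (x, u))).
{ intros u x Hu; apply is_cderive_line; rewrite Ex; apply Hg, Hu. }
assert (Hu : forall u x : R, lo < u < hi -> is_line_derive g (RtoC x) Ci u (g' (x, u))).
{ intros u x Hu; apply is_cderive_line; rewrite Eu; apply Hg, Hu. }
assert (Hdom : forall u, lo < u < hi -> Cexp_dominated a M (fun r => g (r, u))).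
{ intros u Hu0; apply Cexp_dominated_ext with (fun r => g ((0, u) + RtoC r * 1)%C).
  { intros r; rewrite Ex; reflexivity. }
  apply Cexp_dominated_line; intros r; rewrite Ex; [eexists; apply Hg, Hu0|].
  apply (HM (r, u)), Hu0. }
unfold IntC; f_equal.
- apply (IntR_shift lo hi y a M (fun u x => Re (g (x, u))) (fun u x => - Im (g (x, u)))
    (fun u x => - Im (g' (x, u)))); auto.
  + intros u x Hu0; destruct (Hu u x Hu0) as [H1 _].
    replace (- Im (g' (x, u))) with (Re (Ci * g' (x, u))%C) by (unfold Re, Im; simpl; ring).
    revert H1; apply is_derive_ext; intros t; rewrite Eu; reflexivity.
  + intros u x Hu0; destruct (Hx u x Hu0) as [_ H1].
    assert (H2 : is_derive (fun x' => Im (g (x', u))) x (Im (g' (x, u)))).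
    { replace (Im (g' (x, u))) with (Im (1 * g' (x, u))%C) by (unfold Re, Im; simpl; ring).
      revert H1; apply is_derive_ext; intros t; rewrite Ex; reflexivity. }
    exact (@is_derive_opp R_AbsRing R_NormedModule _ _ _ H2).
  + intros u x Hu0; apply continuity_2d_pt_opp, (continuity_2d_pt_Re_Im g'), Hg', Hu0.
  + intros u Hu0; apply (exp_dominated_Re a M), Hdom, Hu0.
  + intros u x Hu0; rewrite Rabs_Ropp.
    apply Rle_trans with (1 := im_le_Cmod _), (HM (x, u)), Hu0.
- apply (IntR_shift lo hi y a M (fun u x => Im (g (x, u))) (fun u x => Re (g (x, u)))
    (fun u x => Re (g' (x, u)))); auto.
  + intros u x Hu0; destruct (Hu u x Hu0) as [_ H1].
    replace (Re (g' (x, u))) with (Im (Ci * g' (x, u))%C) by (unfold Re, Im; simpl; ring).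
    revert H1; apply is_derive_ext; intros t; rewrite Eu; reflexivity.
  + intros u x Hu0; destruct (Hx u x Hu0) as [H1 _].
    assert (H2 : is_derive (fun x' => Re (g (x', u))) x (Re (g' (x, u)))).
    { replace (Re (g' (x, u))) with (Re (1 * g' (x, u))%C) by (unfold Re, Im; simpl; ring).
      revert H1; apply is_derive_ext; intros t; rewrite Ex; reflexivity. }
    exact H2.
  + intros u x Hu0; apply (continuity_2d_pt_Re_Im g'), Hg', Hu0.
  + intros u Hu0; apply (exp_dominated_Im a M), Hdom, Hu0.
  + intros u x Hu0; apply Rle_trans with (1 := re_le_Cmod _), (HM (x, u)), Hu0.
Qed.

(** * The logarithm of the dilogarithm *)

(** The Fermi function: dt / (t (1 + t)) becomes [fermi s] ds under t = e^s. Its poles are the odd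
    multiples of i PI. *)
Definition fermi (s : C) : C := (/ (1 + Cexp s))%C.

Lemma is_cderive_fermi (s : C) :
  (1 + Cexp s)%C <> 0%C -> is_cderive fermi s (- logistic' s)%C.
Proof.
intros Hs.
replace (- logistic' s)%C
  with ((0 + Cexp s) * - / ((1 + Cexp s) * (1 + Cexp s)))%C
  by (unfold logistic'; field; exact Hs).
apply (is_cderive_comp Cinv (fun w => 1 + Cexp w)%C); [apply is_cderive_inv, Hs|].
apply (is_cderive_plus (fun _ => 1%C)); [apply is_cderive_const|apply is_cderive_Cexp].
Qed.

Lemma Cinv_0 : (/ 0)%C = 0%C.
Proof. unfold Cinv, RtoC; simpl; f_equal; unfold Rdiv; ring. Qed.

Lemma ex_cderive_logistic' (s : C) :
  (1 + Cexp s)%C <> 0%C -> exists l, is_cderive logistic' s l.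
Proof.
intros Hs; eexists.
apply is_cderive_ext_loc with (fun w => logistic w * fermi w)%C.
{ apply filter_forall; intros w; unfold logistic, logistic', fermi, Cdiv.
  (* The factorisation holds at every point: where 1 + e^w vanishes, both sides are 0 because [/ 0]
     is 0. *)
  destruct (Ceq_dec (1 + Cexp w)%C 0%C) as [E|E].
  - rewrite E, Cmult_0_l, Cinv_0; ring.
  - field; exact E. }
apply is_cderive_mult; [apply is_cderive_logistic, Hs|apply is_cderive_fermi, Hs].
Qed.

Lemma cos_half_pos_of_bound (v V : R) : Rabs v <= V -> V < PI -> 0 < cos (V / 2).
Proof.
intros H HV; apply cos_half_pos; rewrite Rabs_pos_eq; [exact HV|].
apply Rle_trans with (2 := H), Rabs_pos.
Qed.

Lemma Cmod_fermi_le (s : C) (V : R) : Rabs (Im s) <= V -> V < PI ->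
  Cmod (fermi s) <= / cos (V / 2) * / (1 + exp (Re s)).
Proof.
intros H HV; assert (H0 := one_Cexp_neq_0 s ltac:(lra)).
unfold fermi; rewrite Cmod_inv by exact H0.
assert (Hc := cos_half_pos_of_bound _ _ H HV); assert (HX := exp_pos (Re s)).
rewrite <- Rinv_mult; apply Rinv_le_contravar; [nra|].
apply Cmod_1_Cexp_ge_strip; assumption.
Qed.

Lemma exp_le (x y : R) : x <= y -> exp x <= exp y.
Proof. intros [H|H]; [apply Rlt_le, exp_increasing, H|rewrite H; lra]. Qed.

Section Sigma.

Variable sigma : R.
Hypothesis Hsigma : 0 < sigma < 1.

(** The integrands are controlled by e^(sigma s) / (1 + e^s), which behaves like e^(sigma s) on the
    left and like e^(- (1 - sigma) s) on the right; [a] is the slower rate. It is positive because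
    |tau| < PI means sigma < 1. *)
Let a := Rmin sigma (1 - sigma).

Lemma decay_rate_bounds : 0 < a /\ a <= sigma /\ a <= 1 - sigma /\ a <= 1 / 2.
Proof.
unfold a, Rmin; destruct (Rle_dec sigma (1 - sigma)); repeat split; lra.
Qed.

Lemma weight_le (s : R) : / (1 + exp s) * exp (sigma * s) <= exp (- a * Rabs s).
Proof.
destruct decay_rate_bounds as [H0 [H1 [H2 H3]]]; assert (HX := exp_pos s).
assert (HY := exp_pos (sigma * s)).
destruct (Rle_dec 0 s) as [Hs|Hs].
- rewrite Rabs_pos_eq by exact Hs.
  apply Rle_trans with (/ exp s * exp (sigma * s)).
  { apply Rmult_le_compat_r; [lra|apply Rinv_le_contravar; lra]. }
  rewrite <- exp_Ropp, <- exp_plus; apply exp_le; nra.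
- rewrite Rabs_left by lra.
  apply Rle_trans with (1 * exp (sigma * s)).
  { apply Rmult_le_compat_r; [lra|].
    rewrite <- Rinv_1; apply Rinv_le_contravar; lra. }
  rewrite Rmult_1_l; apply exp_le; nra.
Qed.

Lemma Cmod_product_le (k l : C) (s K B : R) :
  Cmod k <= K * / (1 + exp s) -> Cmod l <= B * exp (sigma * s) -> 0 <= K -> 0 <= B ->
  Cmod (k * l)%C <= K * B * exp (- a * Rabs s).
Proof.
intros Hk Hl HK HB; rewrite Cmod_mult.
assert (HX := exp_pos s); assert (HW := weight_le s).
apply Rle_trans with ((K * / (1 + exp s)) * (B * exp (sigma * s))).
{ apply Rmult_le_compat; try apply Cmod_ge_0; assumption. }
replace (K * / (1 + exp s) * (B * exp (sigma * s)))
  with (K * B * (/ (1 + exp s) * exp (sigma * s))) by ring.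
apply Rmult_le_compat_l; [apply Rmult_le_pos; assumption|exact HW].
Qed.

(* [2 PI i] times the logarithm of [E_q], after the substitution [t = e^s] in
   the integral defining [L_q]. *)
Definition Fint (z : C) : C :=
  IntC (fun s => fermi (RtoC s) * log1pexp (z + RtoC sigma * RtoC s))%C.

Lemma Re_shift (z s : C) : Re (z + RtoC sigma * s)%C = Re z + sigma * Re s.
Proof. unfold Re; simpl; ring. Qed.

Lemma Im_shift (z s : C) : Im (z + RtoC sigma * s)%C = Im z + sigma * Im s.
Proof. unfold Im; simpl; ring. Qed.

Lemma Im_shift_R (z : C) (s : R) : Im (z + RtoC sigma * RtoC s)%C = Im z.
Proof. rewrite Im_shift; unfold Im; simpl; ring. Qed.

Lemma is_cderive_shift (f : C -> C) (z s l : C) :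
  is_cderive f (z + RtoC sigma * s)%C l ->
  is_cderive (fun w => f (z + RtoC sigma * w)%C) s (RtoC sigma * l)%C.
Proof.
intros H; replace (RtoC sigma * l)%C with ((0 + (0 * s + RtoC sigma * 1)) * l)%C by ring.
apply (is_cderive_comp f (fun w => z + RtoC sigma * w)%C); [exact H|].
apply (is_cderive_plus (fun _ => z)); [apply is_cderive_const|].
apply (is_cderive_mult (fun _ => RtoC sigma) (fun w => w));
  [apply is_cderive_const|apply is_cderive_id].
Qed.

Lemma fermi_dominated (f : C -> C) (z : C) (B : R) : 0 <= B ->
  (forall s : R, exists l, is_cderive f (z + RtoC sigma * RtoC s)%C l) ->
  (forall s : R, Cmod (f (z + RtoC sigma * RtoC s)%C) <= B * exp (sigma * s)) ->
  Cexp_dominated a B (fun s => fermi (RtoC s) * f (z + RtoC sigma * RtoC s))%C.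
Proof.
intros HB Hd Hf.
apply Cexp_dominated_ext with
  (fun s => (fun w => fermi w * f (z + RtoC sigma * w))%C (0 + RtoC s * 1)%C).
{ intros s; replace (0 + RtoC s * 1)%C with (RtoC s) by ring; reflexivity. }
apply (Cexp_dominated_line a B (fun w => fermi w * f (z + RtoC sigma * w))%C 0 1);
  intros s; cbv beta; replace (0 + RtoC s * 1)%C with (RtoC s) by ring.
- destruct (Hd s) as [l Hl]; eexists.
  apply (is_cderive_mult fermi (fun w => f (z + RtoC sigma * w)%C)).
  + apply is_cderive_fermi, one_Cexp_neq_0; unfold Im; simpl.
    rewrite Rabs_R0; apply PI_RGT_0.
  + apply is_cderive_shift, Hl.
- rewrite <- (Rmult_1_l B); apply Cmod_product_le; try lra; [|apply Hf].
  apply Rle_trans with (1 := Cmod_fermi_le (RtoC s) 0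
    ltac:(unfold Im; simpl; rewrite Rabs_R0; lra) PI_RGT_0).
  replace (0 / 2) with 0 by field; rewrite cos_0, Rinv_1; unfold Re; simpl; lra.
Qed.

Lemma log1pexp_shift_bound (z : C) (V : R) (s : R) : Rabs (Im z) <= V -> V < PI ->
  Cmod (log1pexp (z + RtoC sigma * RtoC s)%C)
  <= (1 + 2 * V / cos (V / 2)) * exp (Re z) * exp (sigma * s).
Proof.
intros Hz HV.
apply Rle_trans with (1 := Cmod_log1pexp_le _ V
  ltac:(rewrite Im_shift_R; exact Hz) HV).
rewrite Re_shift, exp_plus; change (Re (RtoC s)) with s; apply Req_le; ring.
Qed.

Lemma log1pexp_const_nonneg (v V : R) : Rabs v <= V -> V < PI -> 0 <= 1 + 2 * V / cos (V / 2).
Proof.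
intros H HV; assert (Hc := cos_half_pos_of_bound _ _ H HV); assert (H0 := Rabs_pos v).
assert (0 <= 2 * V / cos (V / 2)) by (apply Rdiv_le_0_compat; lra); lra.
Qed.

Lemma Fint_integrand_dominated (z : C) (V : R) : Rabs (Im z) <= V -> V < PI ->
  Cexp_dominated a ((1 + 2 * V / cos (V / 2)) * exp (Re z))
    (fun s => fermi (RtoC s) * log1pexp (z + RtoC sigma * RtoC s))%C.
Proof.
intros Hz HV; apply (fermi_dominated log1pexp z).
- apply Rmult_le_pos; [apply (log1pexp_const_nonneg _ _ Hz HV)|apply Rlt_le, exp_pos].
- intros s; eexists; apply is_cderive_log1pexp; rewrite Im_shift_R; lra.
- intros s; apply log1pexp_shift_bound; assumption.
Qed.

(** Differentiation under the integral sign: the second order remainder of [log1pexp] at z + sigma s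
    is at most a constant times e^(sigma s) |h|^2, with a constant independent of s and h, so its
    integral against [fermi] is still O(|h|^2). *)
Lemma ex_cderive_Fint (z : C) : Rabs (Im z) < PI -> exists l, is_cderive Fint z l.
Proof.
intros Hz; exists (IntC (fun s => fermi (RtoC s) * logistic (z + RtoC sigma * RtoC s))%C).
destruct decay_rate_bounds as [Ha _].
set (V := (Rabs (Im z) + PI) / 2).
assert (HzV : Rabs (Im z) <= V) by (unfold V; lra).
assert (HV : V < PI) by (unfold V; lra).
assert (Hc := cos_half_pos_of_bound _ _ HzV HV).
assert (HE := exp_pos (Re z + 1)).
assert (Hi : 0 < / (cos (V / 2) * cos (V / 2))) by (apply Rinv_0_lt_compat; nra).
assert (Hd : 0 < Rmin 1 ((PI - Rabs (Im z)) / 2)) by (apply Rmin_pos; lra).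
(* The 2 is that of [log1pexp_second_order]; the + 1 in the exponent absorbs Re (t h) for |h| < 1.
   The 4 / a in front of it below comes from [IntC_bound]. *)
set (B := 2 * (/ (cos (V / 2) * cos (V / 2)) * exp (Re z + 1))).
assert (HB : 0 <= B) by (unfold B; nra).
apply is_cderive_of_quadratic with (d := mkposreal _ Hd) (M := 4 * (B / a)).
{ assert (0 <= B / a) by (apply Rdiv_le_0_compat; assumption); lra. }
simpl; intros h Hh.
assert (Hh1 := Rlt_le_trans _ _ _ Hh (Rmin_l _ _)).
assert (Hh2 := Rlt_le_trans _ _ _ Hh (Rmin_r _ _)).
assert (HzhV : Rabs (Im (z + h)%C) <= V).
{ replace (Im (z + h)%C) with (Im z + Im h) by (unfold Im; simpl; ring).
  assert (H2 := im_le_Cmod h); assert (H3 := Rabs_triang (Im z) (Im h)); unfold V; lra. }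
assert (D1 := Fint_integrand_dominated _ _ HzhV HV).
assert (D2 := Fint_integrand_dominated _ _ HzV HV).
assert (D3 : Cexp_dominated a (/ cos (V / 2) * exp (Re z))
  (fun s => fermi (RtoC s) * logistic (z + RtoC sigma * RtoC s))%C).
{ apply (fermi_dominated logistic z).
  - apply Rmult_le_pos; [apply Rlt_le, Rinv_0_lt_compat, Hc|apply Rlt_le, exp_pos].
  - intros s; eexists; apply is_cderive_logistic, one_Cexp_neq_0; rewrite Im_shift_R; lra.
  - intros s; apply Rle_trans with (1 := Cmod_logistic_le _ V
      ltac:(rewrite Im_shift_R; exact HzV) HV).
    rewrite Re_shift, exp_plus; change (Re (RtoC s)) with s; apply Req_le; ring. }
assert (D2' := Cexp_dominated_scal _ _ (RtoC (-1)) _ D2).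
assert (D3' := Cexp_dominated_scal _ _ (- h)%C _ D3).
assert (D4 := Cexp_dominated_plus _ _ _ _ _ D1 (Cexp_dominated_plus _ _ _ _ _ D2' D3')).
assert (E : (Fint (z + h) - Fint z
  - h * IntC (fun s => fermi (RtoC s) * logistic (z + RtoC sigma * RtoC s)))%C
  = IntC (fun s => fermi (RtoC s) * log1pexp (z + h + RtoC sigma * RtoC s)
      + (RtoC (-1) * (fermi (RtoC s) * log1pexp (z + RtoC sigma * RtoC s))
      + - h * (fermi (RtoC s) * logistic (z + RtoC sigma * RtoC s))))%C).
{ rewrite (IntC_plus _ _ _ _ _ Ha D1 (Cexp_dominated_plus _ _ _ _ _ D2' D3')).
  rewrite (IntC_plus _ _ _ _ _ Ha D2' D3').
  rewrite (IntC_scal _ _ _ _ Ha D2), (IntC_scal _ _ _ _ Ha D3).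
  unfold Fint; ring. }
rewrite E; clear E.
replace (4 * (B / a) * (Cmod h * Cmod h)) with (4 * (B * (Cmod h * Cmod h) / a))
  by (field; lra).
apply IntC_bound; [exact Ha|].
destruct D4 as [F1 [F2 _]]; split; [exact F1|split; [exact F2|]]; intros s.
replace (fermi (RtoC s) * log1pexp (z + h + RtoC sigma * RtoC s)
  + (RtoC (-1) * (fermi (RtoC s) * log1pexp (z + RtoC sigma * RtoC s))
  + - h * (fermi (RtoC s) * logistic (z + RtoC sigma * RtoC s))))%C
  with (fermi (RtoC s) * (log1pexp (z + RtoC sigma * RtoC s + h)
    - log1pexp (z + RtoC sigma * RtoC s) - h * logistic (z + RtoC sigma * RtoC s)))%C.
2: { replace (z + RtoC sigma * RtoC s + h)%C with (z + h + RtoC sigma * RtoC s)%C by ring.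
  ring. }
rewrite <- (Rmult_1_l (B * _)); apply Cmod_product_le; [| |lra|].
{ apply Rle_trans with (1 := Cmod_fermi_le (RtoC s) 0
    ltac:(unfold Im; simpl; rewrite Rabs_R0; lra) PI_RGT_0).
  replace (0 / 2) with 0 by field; rewrite cos_0, Rinv_1; unfold Re; simpl; lra. }
2: { apply Rmult_le_pos; [exact HB|]; assert (H := Cmod_ge_0 h); nra. }
set (w := (z + RtoC sigma * RtoC s)%C).
assert (Hw : Rabs (Im w) <= V) by (unfold w; rewrite Im_shift_R; exact HzV).
assert (Hwh : Rabs (Im (w + h)%C) <= V).
{ replace (w + h)%C with (z + h + RtoC sigma * RtoC s)%C by (unfold w; ring).
  rewrite Im_shift_R; exact HzhV. }
assert (HM : forall t, 0 <= t <= 1 -> Cmod (logistic' (w + RtoC t * h)%C)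
  <= / (cos (V / 2) * cos (V / 2)) * (exp (Re z + 1) * exp (sigma * s))).
{ intros t Ht; apply Rle_trans with (1 := Cmod_logistic'_le _ V
    (strip_convex w h V t Hw Hwh Ht) HV).
  apply Rmult_le_compat_l; [lra|].
  assert (HX := exp_pos (Re (w + RtoC t * h)%C)).
  apply Rle_trans with (exp (Re (w + RtoC t * h)%C)).
  { set (X := exp (Re (w + RtoC t * h)%C)) in *.
    rewrite <- (Rmult_1_r X) at 4; apply Rmult_le_compat_l; [lra|].
    rewrite <- Rinv_1; apply Rinv_le_contravar; nra. }
  rewrite <- exp_plus; apply exp_le.
  replace (Re (w + RtoC t * h)%C) with (Re z + sigma * s + t * Re h)
    by (unfold w, Re; simpl; ring).
  assert (H1 := re_le_Cmod h); assert (H2 := Rle_abs (Re h)); nra. }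
apply Rle_trans with (1 := log1pexp_second_order w h V _ Hw Hwh HV HM).
unfold B; apply Req_le; ring.
Qed.
End Sigma.

(** * The Poisson kernel of the strip *)

(* The jump [(fermi (r - i theta) - fermi (r + i theta)) / 2i], a Poisson kernel
   of total mass [theta] that concentrates at [0] as [theta] tends to [PI]. *)
Definition kappa (theta r : R) : R :=
  exp r * sin theta / (1 + 2 * exp r * cos theta + exp r * exp r).

Lemma kappa_denominator_pos (theta r : R) : Rabs theta < PI ->
  0 < 1 + 2 * exp r * cos theta + exp r * exp r.
Proof.
intros H; assert (H1 := Cmod_1_Cexp_sqr (r, theta)).
assert (H2 := proj1 (Cmod_gt_0 _) (one_Cexp_neq_0 (r, theta) H)).
unfold Re, Im in H1; simpl in H1; rewrite <- H1; nra.
Qed.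

Lemma fermi_jump (theta r : R) : Rabs theta < PI ->
  (fermi (r, (- theta)%R) - fermi (r, theta))%C = (2 * Ci * RtoC (kappa theta r))%C.
Proof.
intros H; assert (Hp := kappa_denominator_pos theta r H).
assert (Hs := sin2_cos2 theta); unfold Rsqr in Hs.
unfold fermi, kappa, Cinv, Cexp, Cminus, Copp, Cplus, Cmult, Ci, RtoC, Re, Im; simpl.
rewrite cos_neg, sin_neg.
set (X := exp r) in *; set (c := cos theta) in *; set (s := sin theta) in *.
assert (E : 1 + 2 * X * c + X * X = (1 + X * c) * (1 + X * c) + X * s * (X * s)).
{ replace (X * X) with (X * X * (s * s + c * c)) by (rewrite Hs; ring); ring. }
rewrite E in *; f_equal; field; repeat split; try lra.
all: apply Rgt_not_eq; apply Rlt_gt; refine (Rlt_le_trans _ _ _ Hp _);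
  apply Req_le; ring.
Qed.

(** Dividing numerator and denominator by e^r turns the kernel into sin theta / (2 (cosh r + cos
    theta)). *)
Lemma kappa_even (theta r : R) : Rabs theta < PI -> kappa theta (- r) = kappa theta r.
Proof.
intros H; assert (H1 := kappa_denominator_pos theta r H).
unfold kappa; rewrite exp_Ropp; assert (HX := exp_pos r).
set (D := 1 + 2 * exp r * cos theta + exp r * exp r) in *.
replace (1 + 2 * / exp r * cos theta + / exp r * / exp r) with (D / (exp r * exp r))
  by (unfold D; field; lra).
field; lra.
Qed.

Lemma is_derive_kappa_primitive (theta r : R) : 0 < theta < PI ->
  is_derive (fun r => atan ((exp r + cos theta) / sin theta)) r (kappa theta r).
Proof.
intros H; assert (Hs := sin_gt_0 theta ltac:(lra) ltac:(lra)).
assert (Hp := kappa_denominator_pos theta r ltac:(rewrite Rabs_pos_eq; lra)).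
auto_derive; [exact I|].
assert (H2 := sin2_cos2 theta); unfold Rsqr in H2.
unfold kappa; set (X := exp r) in *; set (c := cos theta) in *; set (s := sin theta) in *.
assert (E : 1 + 2 * X * c + X * X = s * s + (X + c) * (X + c)).
{ replace 1 with (s * s + c * c) by exact H2; ring. }
rewrite E in *; field; split; [|lra].
apply Rgt_not_eq, Rlt_gt; refine (Rlt_le_trans _ _ _ Hp _); apply Req_le; ring.
Qed.

Lemma kappa_continuous (theta r : R) : Rabs theta < PI -> continuous (kappa theta) r.
Proof.
intros H; assert (H1 := kappa_denominator_pos theta r H).
apply (@ex_derive_continuous R_AbsRing R_NormedModule); unfold kappa; auto_derive.
repeat split; lra.
Qed.

Lemma atan_cot (theta : R) : 0 < theta < PI -> atan (cos theta / sin theta) = PI / 2 - theta.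
Proof.
intros H; rewrite <- (atan_tan (PI / 2 - theta)) by lra; f_equal.
unfold tan; rewrite sin_shift, cos_shift; reflexivity.
Qed.

Lemma is_lim_seq_atan (u : nat -> R) (l : R) :
  is_lim_seq u l -> is_lim_seq (fun n => atan (u n)) (atan l).
Proof.
intros H; apply (is_lim_seq_continuous atan _ l); [|exact H].
apply continuity_pt_filterlim, (@ex_derive_continuous R_AbsRing R_NormedModule).
auto_derive; exact I.
Qed.

(** The identity atan y = PI/2 - atan (1/y) turns the limit at infinity into continuity at 0. The
    bound -1 < c makes e^n + c positive from n = 0 on. *)
Lemma is_lim_atan_p_infty_seq (c s : R) : 0 < s -> -1 < c ->
  is_lim_seq (fun n => atan ((exp (INR n) + c) / s)) (PI / 2).
Proof.
intros Hs Hc.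
assert (Hn : forall n, 1 <= exp (INR n)).
{ intros n; rewrite <- exp_0; apply exp_le, pos_INR. }
apply is_lim_seq_ext with (fun n => PI / 2 - atan (s / (exp (INR n) + c))).
{ intros n; specialize (Hn n).
  assert (H : 0 < s / (exp (INR n) + c)) by (apply Rdiv_lt_0_compat; lra).
  replace ((exp (INR n) + c) / s) with (/ (s / (exp (INR n) + c))) by (field; lra).
  rewrite atan_inv by exact H; reflexivity. }
replace (PI / 2) with (PI / 2 - atan 0) at 1 by (rewrite atan_0; ring).
apply is_lim_seq_minus'; [apply is_lim_seq_const|apply is_lim_seq_atan].
assert (HE : is_lim_seq (fun n => exp (- INR n)) 0).
{ apply is_lim_seq_ext with (2 := is_lim_seq_exp_neg 1 Rlt_0_1); intros n; f_equal; ring. }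
apply is_lim_seq_ext with (fun n => s * exp (- INR n) / (1 + c * exp (- INR n))).
{ intros n; specialize (Hn n); rewrite exp_Ropp; field; lra. }
replace 0 with (s * 0 / (1 + c * 0)) by (field; lra).
apply is_lim_seq_div'; [| |lra].
- apply (is_lim_seq_scal_l _ s (Finite 0)), HE.
- apply is_lim_seq_plus'; [apply is_lim_seq_const|].
  apply (is_lim_seq_scal_l _ c (Finite 0)), HE.
Qed.

Lemma is_lim_atan_m_infty_seq (c s : R) : 0 < s ->
  is_lim_seq (fun n => atan ((exp (- INR n) + c) / s)) (atan (c / s)).
Proof.
intros Hs.
assert (H : is_lim_seq (fun n => (exp (- INR n) + c) / s) ((0 + c) / s)).
{ apply (is_lim_seq_scal_r _ (/ s) (Finite (0 + c))), is_lim_seq_plus';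
    [|apply is_lim_seq_const].
  apply is_lim_seq_ext with (2 := is_lim_seq_exp_neg 1 Rlt_0_1).
  intros n; f_equal; ring. }
rewrite Rplus_0_l in H.
apply is_lim_seq_atan, H.
Qed.

(** The primitive runs from atan (cot theta) = PI/2 - theta to PI/2. *)
Lemma IntR_kappa (theta : R) : 0 < theta < PI -> IntR (kappa theta) = theta.
Proof.
intros H; assert (Hs := sin_gt_0 theta ltac:(lra) ltac:(lra)).
apply IntR_lim_unique.
apply is_lim_seq_ext with (fun n => atan ((exp (INR n) + cos theta) / sin theta)
  - atan ((exp (- INR n) + cos theta) / sin theta)).
{ intros n; symmetry; apply is_RInt_unique.
  apply (@is_RInt_derive R_CompleteNormedModule
    (fun r => atan ((exp r + cos theta) / sin theta))).
  - intros x _; apply is_derive_kappa_primitive, H.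
  - intros x _; apply kappa_continuous; rewrite Rabs_pos_eq; lra. }
replace (Finite theta) with (Finite (PI / 2 - atan (cos theta / sin theta)))
  by (rewrite atan_cot by exact H; f_equal; ring).
apply is_lim_seq_minus'; [|apply is_lim_atan_m_infty_seq, Hs].
apply is_lim_atan_p_infty_seq; [exact Hs|].
rewrite <- cos_PI; apply cos_decreasing_1; lra.
Qed.

(* Since [1 - e^(-r) >= r / (1 + r)] and [1 + r <= 4 e^(r/4)]. *)
Lemma sqr_exp_le (r : R) :
  r * r * exp r <= 16 * exp (- (1 / 2) * Rabs r) * ((exp r - 1) * (exp r - 1)).
Proof.
assert (Hpos : forall p, 0 <= p -> p * exp (3 / 4 * p) <= 4 * (exp p - 1)).
{ intros p Hp; assert (H1 := exp_ineq1_le p); assert (H2 := exp_ineq1_le (1 / 4 * p)).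
  assert (E : exp p = exp (1 / 4 * p) * exp (3 / 4 * p))
    by (rewrite <- exp_plus; f_equal; field).
  assert (H0 := exp_pos p); assert (H3 := exp_pos (3 / 4 * p)).
  assert (H4 : p * exp p <= (1 + p) * (exp p - 1)) by nra.
  apply Rmult_le_reg_l with (1 + p); [lra|].
  apply Rle_trans with (4 * (p * exp p)); [|lra].
  rewrite E; set (y := exp (3 / 4 * p)) in *; set (x := exp (1 / 4 * p)) in *.
  assert (0 <= p * y) by nra; nra. }
assert (Hsq : forall p, 0 <= p ->
  p * p * exp p <= 16 * exp (- (1 / 2) * p) * ((exp p - 1) * (exp p - 1))).
{ intros p Hp; assert (H := Hpos p Hp).
  replace (exp p) with (exp (- (1 / 2) * p) * (exp (3 / 4 * p) * exp (3 / 4 * p))) at 1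
    by (rewrite <- !exp_plus; f_equal; field).
  set (y := exp (3 / 4 * p)) in *; set (m := exp p - 1) in *.
  assert (Hy : 0 < y) by apply exp_pos.
  assert (He := exp_pos (- (1 / 2) * p)); set (e := exp (- (1 / 2) * p)) in *.
  assert (0 <= p * y) by nra.
  replace (p * p * (e * (y * y))) with (e * ((p * y) * (p * y))) by ring.
  replace (16 * e * (m * m)) with (e * ((4 * m) * (4 * m))) by ring.
  apply Rmult_le_compat_l; [lra|apply Rmult_le_compat; lra]. }
destruct (Rle_dec 0 r) as [Hr|Hr].
- rewrite Rabs_pos_eq by exact Hr; apply Hsq, Hr.
- rewrite Rabs_left by lra; specialize (Hsq (- r) ltac:(lra)).
  assert (E : exp r = / exp (- r)) by (rewrite exp_Ropp, Rinv_inv; reflexivity).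
  rewrite E; assert (HX := exp_pos (- r)).
  set (Y := exp (- r)) in *; set (e := exp (- (1 / 2) * - r)) in *.
  apply Rmult_le_reg_r with (Y * Y); [nra|].
  replace (r * r * / Y * (Y * Y)) with (- r * - r * Y) by (field; lra).
  replace (16 * e * ((/ Y - 1) * (/ Y - 1)) * (Y * Y))
    with (16 * e * ((Y - 1) * (Y - 1))) by (field; lra).
  exact Hsq.
Qed.

Lemma kappa_nonneg (theta r : R) : 0 < theta < PI -> 0 <= kappa theta r.
Proof.
intros H; assert (Hs := sin_gt_0 theta ltac:(lra) ltac:(lra)); assert (HX := exp_pos r).
assert (Hp := kappa_denominator_pos theta r ltac:(rewrite Rabs_pos_eq; lra)).
apply Rdiv_le_0_compat; nra.
Qed.

(** Since cos theta >= -1, the denominator is at least (e^r - 1)^2, whose double zero at r = 0 is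
    compensated by r^2. The bound is therefore uniform in theta except for the factor sin theta,
    which vanishes as theta tends to PI. *)
Lemma kappa_sqr_le (theta r : R) : 0 < theta < PI ->
  kappa theta r * (r * r) <= 16 * sin theta * exp (- (1 / 2) * Rabs r).
Proof.
intros H; assert (Hs := sin_gt_0 theta ltac:(lra) ltac:(lra)); assert (HX := exp_pos r).
assert (Hp := kappa_denominator_pos theta r ltac:(rewrite Rabs_pos_eq; lra)).
assert (HB := sqr_exp_le r); assert (Hc : -1 <= cos theta) by apply COS_bound.
assert (He := exp_pos (- (1 / 2) * Rabs r)).
unfold kappa; set (D := 1 + 2 * exp r * cos theta + exp r * exp r) in *.
apply Rmult_le_reg_r with D; [exact Hp|].
replace (exp r * sin theta / D * (r * r) * D) with (sin theta * (r * r * exp r))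
  by (field; lra).
set (X := exp r) in *; set (e := exp (- (1 / 2) * Rabs r)) in *.
apply Rle_trans with (sin theta * (16 * e * ((X - 1) * (X - 1)))).
{ apply Rmult_le_compat_l; lra. }
replace (16 * sin theta * e * D) with (sin theta * (16 * e * D)) by ring.
apply Rmult_le_compat_l; [lra|]; apply Rmult_le_compat_l; [lra|].
unfold D; nra.
Qed.

(** This constant blows up as theta tends to PI. The bound serves for fixed theta, to give the
    kernel the domination under which its integrals can be split. *)
Lemma kappa_le (theta r : R) : 0 < theta < PI ->
  kappa theta r <= / (cos (theta / 2) * cos (theta / 2))
    * (exp r / ((1 + exp r) * (1 + exp r))).
Proof.
intros H; assert (HX := exp_pos r).
assert (Ht : Rabs theta < PI) by (rewrite Rabs_pos_eq; lra).
assert (H1 := Cmod_1_Cexp_sqr (r, theta)).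
assert (H2 := Cmod_1_Cexp_ge (r, theta) Ht).
assert (Hc := cos_half_pos _ Ht).
unfold Re, Im in *; simpl in *.
unfold kappa; rewrite <- H1.
assert (Hs : sin theta <= 1) by apply SIN_bound.
set (c := cos (theta / 2)) in *; set (X := exp r) in *; set (m := Cmod _) in *.
assert (Hc1 : 0 < c * (1 + X)) by nra.
replace (/ (c * c) * (X / ((1 + X) * (1 + X))))
  with (X * / ((c * (1 + X)) * (c * (1 + X)))) by (field; lra).
apply Rmult_le_compat; [|apply Rlt_le, Rinv_0_lt_compat; nra|nra|].
- assert (H3 := sin_gt_0 theta ltac:(lra) ltac:(lra)); nra.
- apply Rinv_le_contravar; [nra|]; apply Rmult_le_compat; lra.
Qed.

Lemma logistic'_weight_le (r : R) :
  exp r / ((1 + exp r) * (1 + exp r)) <= exp (- (1 / 2) * Rabs r).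
Proof.
assert (HX := exp_pos r).
(* With y = e^(r/2) the left side is the weight y / (1 + y^2) for sigma = 1/2 times a further factor
   y / (1 + y^2) <= 1. *)
assert (H := weight_le (1 / 2) ltac:(lra) r).
replace (Rmin (1 / 2) (1 - 1 / 2)) with (1 / 2) in H
  by (rewrite Rmin_left; lra).
apply Rle_trans with (2 := H).
assert (E : exp r = exp (1 / 2 * r) * exp (1 / 2 * r))
  by (rewrite <- exp_plus; f_equal; field).
assert (Hy := exp_pos (1 / 2 * r)); set (y := exp (1 / 2 * r)) in *.
rewrite E.
replace (y * y / ((1 + y * y) * (1 + y * y)))
  with (/ (1 + y * y) * y * (y / (1 + y * y))) by (field; nra).
rewrite <- (Rmult_1_r (/ (1 + y * y) * y)) at 2.
apply Rmult_le_compat_l.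
- apply Rmult_le_pos; [apply Rlt_le, Rinv_0_lt_compat; nra|lra].
- apply Rmult_le_reg_r with (1 + y * y); [nra|].
  unfold Rdiv; rewrite Rmult_assoc, Rinv_l by nra; nra.
Qed.

(** * The functional equation of the integral *)

Section FunctionalEquation.

Variable sigma : R.
Hypothesis Hsigma : 0 < sigma < 1.

(* The contour moves from the real axis to [Im s = - theta], where it does not
   yet meet the pole of [fermi] at [- i PI]. *)
Lemma Fint_shift (z : C) (theta : R) :
  Rabs theta < PI -> Rabs (Im z) < PI -> Rabs (Im z + sigma * theta) < PI ->
  Fint sigma (z + RtoC (sigma * theta) * Ci)%C
  = IntC (fun r => fermi (r, (- theta)%R) * log1pexp (z + RtoC sigma * RtoC r))%C.
Proof.
intros Ht Hz Hzt; destruct (decay_rate_bounds sigma Hsigma) as [Ha _].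
(* While Im s runs from 0 to - theta, the imaginary part of the argument of [log1pexp] runs from Im
   z + sigma theta to Im z, so [m] bounds it. [U] and [V] lie halfway between the occurring bounds
   and PI, and [d] is the room this leaves for an open strip around the contours. *)
set (m := Rmax (Rabs (Im z)) (Rabs (Im z + sigma * theta))).
assert (Hm1 : Rabs (Im z) <= m) by apply Rmax_l.
assert (Hm2 : Rabs (Im z + sigma * theta) <= m) by apply Rmax_r.
assert (Hm : m < PI) by (apply Rmax_lub_lt; assumption).
set (V := (m + PI) / 2); set (U := (Rabs theta + PI) / 2).
set (d := Rmin ((PI - m) / 2) ((PI - Rabs theta) / 2)).
assert (Hd : 0 < d) by (apply Rmin_pos; lra).
assert (Hd1 : d <= (PI - m) / 2) by apply Rmin_l.
assert (Hd2 : d <= (PI - Rabs theta) / 2) by apply Rmin_r.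
assert (HV : V < PI) by (unfold V; lra).
assert (HU : U < PI) by (unfold U; lra).
set (w := (z + RtoC (sigma * theta) * Ci)%C).
assert (Ew : Im w = Im z + sigma * theta) by (unfold w, Im; simpl; ring).
assert (Erw : Re w = Re z) by (unfold w, Re; simpl; ring).
set (g := fun s => (fermi s * log1pexp (w + RtoC sigma * s))%C).
set (g' := fun s => (- logistic' s * log1pexp (w + RtoC sigma * s)
  + fermi s * (RtoC sigma * logistic (w + RtoC sigma * s)))%C).
assert (HsU : forall s : C, Rmin 0 (- theta) - d < Im s < Rmax 0 (- theta) + d ->
  Rabs (Im s) <= U).
{ intros s Hs; apply Rabs_le; unfold U; apply Rabs_def2 in Ht.
  revert Hs Hd2; unfold Rmin, Rmax, Rabs.
  destruct (Rle_dec 0 (- theta)), (Rcase_abs theta); lra. }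
assert (HsV : forall s : C, Rmin 0 (- theta) - d < Im s < Rmax 0 (- theta) + d ->
  Rabs (Im (w + RtoC sigma * s)%C) <= V).
{ intros s Hs; rewrite Im_shift, Ew; apply Rabs_le; unfold V.
  apply Rabs_le_between in Hm1; apply Rabs_le_between in Hm2.
  revert Hs; unfold Rmin, Rmax; destruct (Rle_dec 0 (- theta)); nra. }
assert (HM := IntC_shift (Rmin 0 (- theta) - d) (Rmax 0 (- theta) + d) (- theta)
  (Rmin sigma (1 - sigma)) (/ cos (U / 2) * ((1 + 2 * V / cos (V / 2)) * exp (Re z))) g g').
assert (HcU : 0 < cos (U / 2)) by (apply (cos_half_pos_of_bound theta U); unfold U; lra).
assert (HcV := log1pexp_const_nonneg (Im z) V ltac:(unfold V; lra) HV).
transitivity (IntC (fun r => g (RtoC r))); [reflexivity|].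
rewrite <- HM; clear HM.
- apply IntC_ext; intros r; unfold g; f_equal; f_equal.
  unfold w; destruct z as [x y]; unfold Cplus, Cmult, RtoC, Ci; simpl; f_equal; ring.
- unfold Rmin, Rmax; destruct (Rle_dec 0 (- theta)); lra.
- unfold Rmin, Rmax; destruct (Rle_dec 0 (- theta)); lra.
- exact Ha.
- intros s Hs; assert (H1 := HsU s Hs); assert (H2 := HsV s Hs).
  apply (is_cderive_mult fermi (fun s => log1pexp (w + RtoC sigma * s)%C)).
  + apply is_cderive_fermi, one_Cexp_neq_0; lra.
  + apply is_cderive_shift, is_cderive_log1pexp; lra.
- intros s Hs; assert (H1 := HsU s Hs); assert (H2 := HsV s Hs).
  assert (N1 := one_Cexp_neq_0 s ltac:(lra)).
  assert (N2 := one_Cexp_neq_0 _ (Rle_lt_trans _ _ _ H2 HV)).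
  destruct (ex_cderive_logistic' s N1) as [l Hl].
  eexists; apply (is_cderive_plus
    (fun s => - logistic' s * log1pexp (w + RtoC sigma * s))%C
    (fun s => fermi s * (RtoC sigma * logistic (w + RtoC sigma * s)))%C).
  + apply (is_cderive_mult (fun s => - logistic' s)%C
      (fun s => log1pexp (w + RtoC sigma * s))%C).
    * apply (@is_derive_opp C_AbsRing C_NormedModule logistic' s l), Hl.
    * apply is_cderive_shift, is_cderive_log1pexp; lra.
  + apply (is_cderive_mult fermi (fun s => RtoC sigma * logistic (w + RtoC sigma * s))%C).
    * apply is_cderive_fermi, N1.
    * apply (is_cderive_mult (fun _ => RtoC sigma)); [apply is_cderive_const|].
      apply is_cderive_shift, is_cderive_logistic, N2.
- intros s Hs; assert (H1 := HsU s Hs); assert (H2 := HsV s Hs).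
  apply Cmod_product_le; [exact Hsigma| | | |].
  + apply Cmod_fermi_le; assumption.
  + apply Rle_trans with (1 := Cmod_log1pexp_le _ V H2 HV).
    rewrite Re_shift, exp_plus, Erw; apply Req_le; ring.
  + apply Rlt_le, Rinv_0_lt_compat, HcU.
  + apply Rmult_le_pos; [exact HcV|apply Rlt_le, exp_pos].
Qed.

Lemma shifted_integrand_dominated (z : C) (theta V : R) :
  Rabs theta < PI -> Rabs (Im z) <= V -> V < PI ->
  Cexp_dominated (Rmin sigma (1 - sigma))
    (/ cos (Rabs theta / 2) * ((1 + 2 * V / cos (V / 2)) * exp (Re z)))
    (fun r => fermi (r, theta) * log1pexp (z + RtoC sigma * RtoC r))%C.
Proof.
intros Ht Hz HV.
(* The line of integration is p + R; subtracting [p] in the second factor confines the vertical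
   displacement to [fermi]. *)
set (p := (0, theta) : C).
assert (Ep : forall r : R, (p + RtoC r * 1)%C = (r, theta)).
{ intros r; unfold p, Cplus, Cmult, RtoC; simpl; f_equal; ring. }
assert (El : forall r : R, (z + RtoC sigma * (p + RtoC r * 1 - p))%C
  = (z + RtoC sigma * RtoC r)%C) by (intros; ring).
apply Cexp_dominated_ext with
  (fun r => (fun w => fermi w * log1pexp (z + RtoC sigma * (w - p)))%C (p + RtoC r * 1)%C).
{ intros r; cbv beta; rewrite El, Ep; reflexivity. }
apply (Cexp_dominated_line _ _ (fun w => fermi w * log1pexp (z + RtoC sigma * (w - p)))%C p 1);
  intros r; cbv beta.
- eexists; apply (is_cderive_mult fermi (fun w => log1pexp (z + RtoC sigma * (w - p)))%C).
  + apply is_cderive_fermi, one_Cexp_neq_0; rewrite Ep; exact Ht.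
  + apply is_cderive_ext_loc with
      (fun w => log1pexp (z - RtoC sigma * p + RtoC sigma * w)%C).
    { apply filter_forall; intros w; f_equal; ring. }
    apply is_cderive_shift, is_cderive_log1pexp.
    replace (z - sigma * p + sigma * (p + r * 1))%C with (z + RtoC sigma * RtoC r)%C by ring.
    rewrite Im_shift_R; lra.
- rewrite El, Ep; apply Cmod_product_le; [exact Hsigma| | | |].
  + apply (Cmod_fermi_le (r, theta)); [apply Rle_refl|exact Ht].
  + apply log1pexp_shift_bound; assumption.
  + apply Rlt_le, Rinv_0_lt_compat, (cos_half_pos_of_bound theta); lra.
  + apply Rmult_le_pos; [apply (log1pexp_const_nonneg _ _ Hz HV)|apply Rlt_le, exp_pos].
Qed.

(** Both values of [Fint] are written with the same [log1pexp (z + sigma r)], the displacement being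
    moved into [fermi]. Subtracting leaves the jump of [fermi] between the lines Im = +- theta,
    which is 2 i [kappa]. *)
Lemma Fint_jump (z : C) (theta V : R) : 0 < theta < PI ->
  Rabs (Im z) <= V -> V < PI -> V + sigma * theta < PI ->
  Cexp_dominated (Rmin sigma (1 - sigma))
    (/ cos (theta / 2) * ((1 + 2 * V / cos (V / 2)) * exp (Re z)))
    (fun r => RtoC (kappa theta r) * log1pexp (z + RtoC sigma * RtoC r))%C /\
  (Fint sigma (z + RtoC (sigma * theta) * Ci) - Fint sigma (z + RtoC (sigma * - theta) * Ci)
   = 2 * Ci * IntC (fun r => RtoC (kappa theta r)
       * log1pexp (z + RtoC sigma * RtoC r)))%C.
Proof.
intros Ht Hz HV HVt; destruct (decay_rate_bounds sigma Hsigma) as [Ha _].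
assert (Hst : 0 < sigma * theta) by nra.
assert (Hz' := proj1 (Rabs_le_between _ _) Hz).
assert (Ht1 : Rabs theta < PI) by (rewrite Rabs_pos_eq; lra).
assert (Ht2 : Rabs (- theta) < PI) by (rewrite Rabs_Ropp; exact Ht1).
assert (D1 := shifted_integrand_dominated z (- theta) V Ht2 Hz HV).
assert (D2 := shifted_integrand_dominated z theta V Ht1 Hz HV).
rewrite Rabs_Ropp in D1; rewrite Rabs_pos_eq in D1, D2 by lra.
assert (D2' := Cexp_dominated_scal _ _ (RtoC (-1)) _ D2).
assert (D3 := Cexp_dominated_plus _ _ _ _ _ D1 D2').
assert (HC : (Ci <> 0)%C).
{ intros E; apply (f_equal Im) in E; unfold Im in E; simpl in E; lra. }
assert (E : forall r : R, ((/ (2 * Ci)) * (fermi (r, (- theta)%R) * log1pexp (z + RtoC sigma * RtoC r)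
  + RtoC (-1) * (fermi (r, theta) * log1pexp (z + RtoC sigma * RtoC r)))
  = RtoC (kappa theta r) * log1pexp (z + RtoC sigma * RtoC r))%C).
{ intros r.
  replace (fermi (r, (- theta)%R) * log1pexp (z + RtoC sigma * RtoC r)
    + RtoC (-1) * (fermi (r, theta) * log1pexp (z + RtoC sigma * RtoC r)))%C
    with ((fermi (r, (- theta)%R) - fermi (r, theta))
      * log1pexp (z + RtoC sigma * RtoC r))%C by ring.
  rewrite fermi_jump by exact Ht1; field; exact HC. }
assert (D4 := Cexp_dominated_scal _ _ (/ (2 * Ci))%C _ D3).
assert (D5 := Cexp_dominated_ext _ _ _ _ E D4).
split.
- destruct D5 as [F1 [F2 _]]; split; [exact F1|split; [exact F2|]]; intros r.
  assert (Hc : 0 < cos (theta / 2)) by (apply cos_half_pos; exact Ht1).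
  apply Cmod_product_le; [exact Hsigma| | | |].
  + rewrite Cmod_R, Rabs_pos_eq by (apply kappa_nonneg, Ht).
    assert (Hk := fermi_jump theta r Ht1); apply (f_equal Cmod) in Hk.
    rewrite !Cmod_mult, Cmod_Ci, !Cmod_R, (Rabs_pos_eq 2), (Rabs_pos_eq (kappa _ _)) in Hk
      by (try apply kappa_nonneg; lra).
    assert (B1 := Cmod_fermi_le (r, theta) theta ltac:(simpl; rewrite Rabs_pos_eq; lra)
      (proj2 Ht)).
    assert (B2 := Cmod_fermi_le (r, (- theta)%R) theta
      ltac:(simpl; rewrite Rabs_Ropp, Rabs_pos_eq; lra) (proj2 Ht)).
    assert (B3 := Cmod_triangle (fermi (r, (- theta)%R)) (- fermi (r, theta))%C).
    rewrite Cmod_opp in B3; unfold Cminus in Hk; simpl in B1, B2; lra.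
  + apply log1pexp_shift_bound; assumption.
  + apply Rlt_le, Rinv_0_lt_compat, Hc.
  + apply Rmult_le_pos; [apply (log1pexp_const_nonneg _ _ Hz HV)|apply Rlt_le, exp_pos].
- rewrite Fint_shift, Fint_shift, Ropp_involutive; try assumption; try lra.
  + rewrite <- (IntC_ext _ _ E), (IntC_scal _ _ _ _ Ha D3), (IntC_plus _ _ _ _ _ Ha D1 D2').
    rewrite (IntC_scal _ _ _ _ Ha D2); field; exact HC.
  + replace (sigma * - theta) with (- (sigma * theta)) by ring; apply Rabs_def1; lra.
  + apply Rabs_def1; lra.
Qed.

End FunctionalEquation.

Lemma Cexp_dominated_reverse (a M : R) (f : R -> C) :
  Cexp_dominated a M f -> Cexp_dominated a M (fun s => f (- s)).
Proof.
intros [F1 [F2 F3]]; split; [|split]; intros s.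
- apply (continuous_comp Ropp (fun t => Re (f t))); [|apply F1].
  apply (@continuous_opp R_UniformSpace R_AbsRing R_NormedModule (fun t => t)), continuous_id.
- apply (continuous_comp Ropp (fun t => Im (f t))); [|apply F2].
  apply (@continuous_opp R_UniformSpace R_AbsRing R_NormedModule (fun t => t)), continuous_id.
- rewrite <- (Rabs_Ropp s); apply F3.
Qed.

Lemma Cmod_logistic'_le_const (w : C) (V : R) : Rabs (Im w) <= V -> V < PI ->
  Cmod (logistic' w) <= / (cos (V / 2) * cos (V / 2)).
Proof.
intros H HV; apply Rle_trans with (1 := Cmod_logistic'_le w V H HV).
assert (Hc := cos_half_pos_of_bound _ _ H HV).
assert (Hi : 0 < / (cos (V / 2) * cos (V / 2))) by (apply Rinv_0_lt_compat; nra).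
apply Rle_trans with (/ (cos (V / 2) * cos (V / 2)) * 1); [|lra].
apply Rmult_le_compat_l; [lra|].
apply Rle_trans with (1 := logistic'_weight_le (Re w)).
apply Rle_trans with (exp 0); [|rewrite exp_0; lra].
apply exp_le; assert (H0 := Rabs_pos (Re w)); lra.
Qed.

(** The first order terms for h and - h cancel, and the two remainders add up. For real h the points
    z +- h stay at the height of z, where [logistic'] is bounded by a constant. *)
Lemma log1pexp_second_difference (z h : C) (V : R) :
  Im h = 0 -> Rabs (Im z) <= V -> V < PI ->
  Cmod (log1pexp (z + h) + log1pexp (z - h) - 2 * log1pexp z)%C
  <= 4 * / (cos (V / 2) * cos (V / 2)) * (Cmod h * Cmod h).
Proof.
intros Hh Hz HV.
assert (Him : forall k : C, Im k = 0 -> Rabs (Im (z + k)%C) <= V).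
{ intros k Hk; replace (Im (z + k)%C) with (Im z + Im k) by (unfold Im; simpl; ring).
  rewrite Hk, Rplus_0_r; exact Hz. }
assert (Hb : forall k : C, Im k = 0 ->
  Cmod (log1pexp (z + k) - log1pexp z - k * logistic z)%C
  <= 2 * / (cos (V / 2) * cos (V / 2)) * (Cmod k * Cmod k)).
{ intros k Hk; apply log1pexp_second_order with (V := V); auto.
  intros t _; apply Cmod_logistic'_le_const; [|exact HV]; apply Him.
  replace (Im (RtoC t * k)%C) with (t * Im k) by (unfold Im; simpl; ring).
  rewrite Hk; ring. }
assert (H1 := Hb h Hh).
assert (H2 := Hb (- h)%C ltac:(unfold Im in *; simpl; lra)).
rewrite Cmod_opp in H2.
replace (log1pexp (z + h) + log1pexp (z - h) - 2 * log1pexp z)%C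
  with ((log1pexp (z + h) - log1pexp z - h * logistic z)
    + (log1pexp (z + - h) - log1pexp z - - h * logistic z))%C by (unfold Cminus; ring).
apply Rle_trans with (1 := Cmod_triangle _ _); lra.
Qed.

Lemma kappa_dominated (a theta : R) : 0 < theta < PI -> a <= 1 / 2 ->
  Cexp_dominated a (/ (cos (theta / 2) * cos (theta / 2))) (fun r => RtoC (kappa theta r)).
Proof.
intros Ht Ha; split; [|split]; intros s.
- apply kappa_continuous; rewrite Rabs_pos_eq; lra.
- apply continuous_const.
- rewrite Cmod_R, Rabs_pos_eq by (apply kappa_nonneg, Ht).
  apply Rle_trans with (1 := kappa_le theta s Ht).
  assert (Hc : 0 < cos (theta / 2)) by (apply cos_half_pos; rewrite Rabs_pos_eq; lra).
  apply Rmult_le_compat_l; [apply Rlt_le, Rinv_0_lt_compat; nra|].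
  apply Rle_trans with (1 := logistic'_weight_le s), exp_le.
  assert (H0 := Rabs_pos s); nra.
Qed.

Lemma IntC_kappa (theta : R) : 0 < theta < PI ->
  IntC (fun r => RtoC (kappa theta r)) = RtoC theta.
Proof.
intros Ht; unfold IntC, RtoC; f_equal.
- apply (IntR_kappa theta Ht).
- apply IntR_lim_unique, is_lim_seq_ext with (fun _ => 0); [|apply is_lim_seq_const].
  intros n; symmetry; unfold Im; simpl.
  rewrite RInt_const; unfold scal; simpl; unfold mult; simpl; ring.
Qed.

Section FunctionalEquation.

Variable sigma : R.
Hypothesis Hsigma : 0 < sigma < 1.

(* As [kappa] is even, only the second difference of [log1pexp] matters; it is
   [O(r^2)], which makes up for the loss of integrability of [kappa / sin theta]
   at [0] when [theta] tends to [PI]. *)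
Lemma Fint_jump_approx (z : C) (V : R) :
  Rabs (Im z) <= V -> V + sigma * PI < PI ->
  exists K : R, 0 <= K /\ forall theta, 0 < theta < PI ->
    Cmod (Fint sigma (z + RtoC (sigma * theta) * Ci)
      - Fint sigma (z + RtoC (sigma * - theta) * Ci)
      - 2 * Ci * RtoC theta * log1pexp z)%C <= K * sin theta.
Proof.
intros Hz HVs; destruct (decay_rate_bounds sigma Hsigma) as [Ha [_ [_ Ha2]]].
set (a := Rmin sigma (1 - sigma)) in *.
assert (Hpi := PI_RGT_0); assert (HV : V < PI) by nra.
assert (Hc := cos_half_pos_of_bound _ _ Hz HV).
set (M := / (cos (V / 2) * cos (V / 2))).
assert (HM : 0 < M) by (apply Rinv_0_lt_compat; nra).
(* 64 = 4 * 16, from [log1pexp_second_difference] and [kappa_sqr_le]; the outer 4 and the division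
   by [a] are those of [IntC_bound]. *)
exists (4 * (64 * M / a)); split.
{ assert (0 <= 64 * M / a) by (apply Rdiv_le_0_compat; lra); lra. }
intros theta Ht.
assert (Ht1 : Rabs theta < PI) by (rewrite Rabs_pos_eq; lra).
destruct (Fint_jump sigma Hsigma z theta V Ht Hz HV ltac:(nra)) as [D1 EJ].
fold a in D1; rewrite EJ; clear EJ.
set (f := fun r => (RtoC (kappa theta r) * log1pexp (z + RtoC sigma * RtoC r))%C) in *.
assert (D2 := Cexp_dominated_reverse _ _ _ D1).
assert (Dk := kappa_dominated a theta Ht Ha2).
assert (D3 := Cexp_dominated_scal _ _ (- (2 * log1pexp z))%C _ Dk).
assert (D12 := Cexp_dominated_plus _ _ _ _ _ D1 D2).
assert (D := Cexp_dominated_plus _ _ _ _ _ D12 D3).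
(* Symmetrising doubles the integral, and the mass theta of the kernel turns the subtracted constant
   into theta times [log1pexp z]. *)
assert (E : IntC (fun s => f s + f (- s)%R + - (2 * log1pexp z) * RtoC (kappa theta s))%C
  = (2 * (IntC f - RtoC theta * log1pexp z))%C).
{ rewrite (IntC_plus _ _ _ _ _ Ha D12 D3), (IntC_plus _ _ _ _ _ Ha D1 D2).
  rewrite (IntC_scal _ _ _ _ Ha Dk), (IntC_even _ _ _ Ha D1), IntC_kappa by exact Ht.
  ring. }
replace (2 * Ci * IntC f - 2 * Ci * RtoC theta * log1pexp z)%C
  with (Ci * (2 * (IntC f - RtoC theta * log1pexp z)))%C by ring.
rewrite <- E, Cmod_mult, Cmod_Ci, Rmult_1_l.
replace (4 * (64 * M / a) * sin theta) with (4 * (64 * M * sin theta / a)) by (field; lra).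
apply IntC_bound; [exact Ha|].
destruct D as [F1 [F2 _]]; split; [exact F1|split; [exact F2|]]; intros r.
replace (f r + f (- r)%R + - (2 * log1pexp z) * RtoC (kappa theta r))%C
  with (RtoC (kappa theta r) * (log1pexp (z + RtoC (sigma * r))
    + log1pexp (z - RtoC (sigma * r)) - 2 * log1pexp z))%C.
2: { unfold f; rewrite kappa_even by exact Ht1.
  rewrite RtoC_mult, RtoC_opp; replace (z + sigma * - r)%C with (z - sigma * r)%C by ring.
  ring. }
rewrite Cmod_mult, Cmod_R, Rabs_pos_eq by (apply kappa_nonneg, Ht).
assert (H2 := log1pexp_second_difference z (RtoC (sigma * r)) V eq_refl Hz HV).
fold M in H2; rewrite Cmod_R in H2.
assert (Hsq : Rabs (sigma * r) * Rabs (sigma * r) <= r * r).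
{ assert (H0 : 0 <= r * r) by apply Rle_0_sqr.
  assert (H3 : sigma * sigma <= 1) by nra.
  rewrite <- Rabs_mult; replace (sigma * r * (sigma * r)) with (sigma * sigma * (r * r)) by ring.
  rewrite Rabs_pos_eq; nra. }
assert (Hk := kappa_nonneg theta r Ht).
apply Rle_trans with (kappa theta r * (4 * M * (r * r))).
{ apply Rmult_le_compat_l; [exact Hk|]; apply Rle_trans with (1 := H2).
  apply Rmult_le_compat_l; lra. }
replace (kappa theta r * (4 * M * (r * r))) with (4 * M * (kappa theta r * (r * r))) by ring.
apply Rle_trans with (4 * M * (16 * sin theta * exp (- (1 / 2) * Rabs r))).
{ apply Rmult_le_compat_l; [lra|]; apply kappa_sqr_le, Ht. }
replace (4 * M * (16 * sin theta * exp (- (1 / 2) * Rabs r)))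
  with (64 * M * sin theta * exp (- (1 / 2) * Rabs r)) by ring.
assert (Hs := sin_gt_0 theta ltac:(lra) ltac:(lra)).
apply Rmult_le_compat_l; [nra|]; apply exp_le; assert (H0 := Rabs_pos r); nra.
Qed.

(** Put theta = PI - eta and let eta tend to 0: the error K sin theta vanishes, and [Fint] is
    continuous at the two limit points because the hypothesis places them inside |Im| < PI. *)
Lemma Fint_functional_equation (z : C) : Rabs (Im z) + sigma * PI < PI ->
  (Fint sigma (z + RtoC (sigma * PI) * Ci) - Fint sigma (z - RtoC (sigma * PI) * Ci)
   = 2 * RtoC PI * Ci * log1pexp z)%C.
Proof.
intros Hz; assert (Hpi := PI_RGT_0).
destruct (Fint_jump_approx z _ (Rle_refl _) Hz) as [K [HK HJ]].
set (zp := (z + RtoC (sigma * PI) * Ci)%C); set (zm := (z - RtoC (sigma * PI) * Ci)%C).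
assert (Hsp : 0 < sigma * PI) by nra.
assert (Hz' := proj1 (Rabs_le_between _ _) (Rle_refl (Rabs (Im z)))).
assert (Hc : forall w, Rabs (Im w) < PI -> @continuous C_UniformSpace C_UniformSpace (Fint sigma) w).
{ intros w Hw; destruct (ex_cderive_Fint sigma Hsigma w Hw) as [l Hl].
  apply (is_cderive_continuous _ _ _ Hl). }
assert (Cp := Hc zp ltac:(unfold zp, Im in *; simpl in *; apply Rabs_def1; lra)).
assert (Cm := Hc zm ltac:(unfold zm, Im in *; simpl in *; apply Rabs_def1; lra)).
apply Ceq_minus, Cmod_eq_0, Rle_antisym; [|apply Cmod_ge_0].
apply le_epsilon; intros eps He; rewrite Rplus_0_l.
assert (He3 : 0 < eps / 3) by lra.
destruct (continuous_C_eps _ _ (mkposreal _ He3) Cp) as [d1 H1].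
destruct (continuous_C_eps _ _ (mkposreal _ He3) Cm) as [d2 H2].
(* [B * eta] covers the replacement of PI by PI - eta in front of [log1pexp z] and the term K sin
   (PI - eta) <= K eta. The other two thirds of [eps] go to the continuity of [Fint] at [zp] and
   [zm]. *)
set (B := 2 * Cmod (log1pexp z) + K).
assert (HB : 0 <= B) by (unfold B; assert (H := Cmod_ge_0 (log1pexp z)); lra).
set (eta := Rmin (Rmin d1 d2) (Rmin 1 (eps / 3 / (1 + B))) / 2).
assert (Heta : 0 < eta /\ eta < d1 /\ eta < d2 /\ eta < 1 /\ eta * (1 + B) < eps / 3).
{ assert (P1 := cond_pos d1); assert (P2 := cond_pos d2).
  assert (P3 : 0 < eps / 3 / (1 + B)) by (apply Rdiv_lt_0_compat; lra).
  assert (P4 : 0 < Rmin (Rmin d1 d2) (Rmin 1 (eps / 3 / (1 + B))))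
    by (repeat apply Rmin_pos; lra).
  assert (Q1 := Rmin_l (Rmin d1 d2) (Rmin 1 (eps / 3 / (1 + B)))).
  assert (Q2 := Rmin_r (Rmin d1 d2) (Rmin 1 (eps / 3 / (1 + B)))).
  assert (Q3 := Rmin_l d1 d2); assert (Q4 := Rmin_r d1 d2).
  assert (Q5 := Rmin_l 1 (eps / 3 / (1 + B))); assert (Q6 := Rmin_r 1 (eps / 3 / (1 + B))).
  assert (Q7 : eta < eps / 3 / (1 + B)) by (unfold eta; lra).
  unfold eta in *; repeat split; try lra.
  apply Rmult_lt_reg_r with (/ (1 + B)); [apply Rinv_0_lt_compat; lra|].
  rewrite Rmult_assoc, Rinv_r, Rmult_1_r by lra; exact Q7. }
destruct Heta as [E0 [E1 [E2 [E3 E4]]]].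
assert (Hpi3 := PI2_1).
specialize (HJ (PI - eta) ltac:(lra)).
set (wp := (z + RtoC (sigma * (PI - eta)) * Ci)%C) in *.
set (wm := (z + RtoC (sigma * - (PI - eta)) * Ci)%C) in *.
assert (Dp : Cmod (wp - zp) < d1).
{ replace (wp - zp)%C with (RtoC (- (sigma * eta)) * Ci)%C.
  2: { unfold wp, zp; rewrite !RtoC_mult, RtoC_opp, RtoC_mult, RtoC_minus; ring. }
  rewrite Cmod_mult, Cmod_Ci, Cmod_R, Rabs_Ropp, Rabs_pos_eq; nra. }
assert (Dm : Cmod (wm - zm) < d2).
{ replace (wm - zm)%C with (RtoC (sigma * eta) * Ci)%C.
  2: { unfold wm, zm; rewrite !RtoC_mult, RtoC_opp, RtoC_minus; ring. }
  rewrite Cmod_mult, Cmod_Ci, Cmod_R, Rabs_pos_eq; nra. }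
specialize (H1 _ Dp); specialize (H2 _ Dm); simpl in H1, H2.
replace (Fint sigma zp - Fint sigma zm - 2 * RtoC PI * Ci * log1pexp z)%C
  with ((Fint sigma wp - Fint sigma wm - 2 * Ci * RtoC (PI - eta) * log1pexp z)
    + (- (Fint sigma wp - Fint sigma zp)) + (Fint sigma wm - Fint sigma zm)
    + - (2 * Ci * RtoC eta * log1pexp z))%C by (rewrite RtoC_minus; ring).
assert (Hs : sin (PI - eta) <= eta).
{ rewrite sin_PI_x; apply Rlt_le, sin_lt_x, E0. }
assert (T1 := Cmod_triangle ((Fint sigma wp - Fint sigma wm
  - 2 * Ci * RtoC (PI - eta) * log1pexp z)
    + (- (Fint sigma wp - Fint sigma zp)) + (Fint sigma wm - Fint sigma zm))%C
  (- (2 * Ci * RtoC eta * log1pexp z))%C).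
assert (T2 := Cmod_triangle ((Fint sigma wp - Fint sigma wm
  - 2 * Ci * RtoC (PI - eta) * log1pexp z)
    + (- (Fint sigma wp - Fint sigma zp)))%C (Fint sigma wm - Fint sigma zm)%C).
assert (T3 := Cmod_triangle (Fint sigma wp - Fint sigma wm
  - 2 * Ci * RtoC (PI - eta) * log1pexp z)%C (- (Fint sigma wp - Fint sigma zp))%C).
rewrite Cmod_opp in T1, T3; rewrite !Cmod_mult, Cmod_Ci, !Cmod_R in T1.
rewrite (Rabs_pos_eq 2), (Rabs_pos_eq eta) in T1 by lra.
unfold B in E4; nra.
Qed.

End FunctionalEquation.

(** * The integral representation on the real line *)

Definition log_integrand (sigma x s : R) : R :=
  / (1 + exp s) * ln (1 + exp (x + sigma * s)).

Lemma Fint_integrand_R (sigma x s : R) :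
  (fermi (RtoC s) * log1pexp (RtoC x + RtoC sigma * RtoC s))%C
  = RtoC (log_integrand sigma x s).
Proof.
rewrite <- RtoC_mult, <- RtoC_plus, log1pexp_RtoC.
unfold fermi, log_integrand; rewrite Cexp_RtoC, <- RtoC_plus, RtoC_mult, RtoC_inv; [reflexivity|].
assert (H := exp_pos s); lra.
Qed.

Section RealLine.

Variable sigma : R.
Hypothesis Hsigma : 0 < sigma < 1.

Lemma log_integrand_dominated (x : R) :
  exists M, exp_dominated (Rmin sigma (1 - sigma)) M (log_integrand sigma x).
Proof.
assert (H := Fint_integrand_dominated sigma Hsigma (RtoC x) 0
  ltac:(unfold Im; simpl; rewrite Rabs_R0; lra) PI_RGT_0).
eexists.
assert (H1 := Cexp_dominated_ext _ _ _ _ (Fint_integrand_R sigma x) H).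
exact (exp_dominated_Re _ _ _ H1).
Qed.

Lemma Fint_RtoC (x : R) : Fint sigma (RtoC x) = RtoC (IntR (log_integrand sigma x)).
Proof.
unfold Fint; rewrite (IntC_ext _ _ (Fint_integrand_R sigma x)).
unfold IntC, RtoC; f_equal.
apply IntR_lim_unique, is_lim_seq_ext with (fun _ => 0); [|apply is_lim_seq_const].
intros n; symmetry; unfold Im; simpl.
rewrite RInt_const; unfold scal; simpl; unfold mult; simpl; ring.
Qed.

Lemma is_RInt_L_integrand (eta t1 t2 : R) : 0 < eta -> 0 < t1 -> 0 < t2 ->
  is_RInt (L_integrand (sigma * PI) eta) t1 t2
    (RInt (log_integrand sigma (ln eta)) (ln t1) (ln t2)).
Proof.
intros He H1 H2.
destruct (log_integrand_dominated (ln eta)) as [M [Hc _]].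
assert (Hpos : forall t, Rmin t1 t2 <= t -> 0 < t).
{ intros t Ht; apply Rlt_le_trans with (2 := Ht); apply Rmin_pos; assumption. }
apply is_RInt_ext with (fun t => scal (/ t) (log_integrand sigma (ln eta) (ln t))).
{ intros t [Ht _]; specialize (Hpos t (Rlt_le _ _ Ht)).
  unfold scal; simpl; unfold mult; simpl; unfold log_integrand, L_integrand, Rpower.
  rewrite exp_ln, exp_plus, (exp_ln eta) by assumption.
  assert (Hpi := PI_RGT_0).
  replace (sigma * PI / PI) with sigma by (field; lra).
  field; lra. }
apply (is_RInt_comp (log_integrand sigma (ln eta)) ln Rinv).
- intros t _; apply Hc.
- intros t [Ht _]; specialize (Hpos t Ht); split.
  + auto_derive; [exact Hpos|field; lra].
  + apply (@ex_derive_continuous R_AbsRing R_NormedModule); auto_derive; lra.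
Qed.

(** Under s = ln t the neighbourhoods 0 < t < e^(-N) and t > e^N become s < - N and s > N, so
    [IntR_approx] bounds the error for both ends at once. *)
Lemma is_RInt_gen_L_integrand (eta : R) : 0 < eta ->
  is_RInt_gen (L_integrand (sigma * PI) eta) (at_right 0) (Rbar_locally p_infty)
    (IntR (log_integrand sigma (ln eta))).
Proof.
intros He P [eps HP].
destruct (log_integrand_dominated (ln eta)) as [M HM].
destruct (decay_rate_bounds sigma Hsigma) as [Ha _].
set (a := Rmin sigma (1 - sigma)) in *.
destruct (exp_tail_small a M _ Ha HM eps (cond_pos eps)) as [N HN].
exists (fun t => 0 < t < exp (- INR N)) (fun t => exp (INR N) < t).
- exists (mkposreal _ (exp_pos (- INR N))); intros t Ht Ht0; simpl in Ht.
  unfold ball in Ht; simpl in Ht; unfold AbsRing_ball, abs, minus, plus, opp in Ht; simpl in Ht.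
  apply Rabs_def2 in Ht; lra.
- exists (exp (INR N)); intros t Ht; exact Ht.
- intros t1 t2 [H1 H1'] H2; simpl.
  assert (H2' : 0 < t2) by (apply Rlt_trans with (2 := H2), exp_pos).
  exists (RInt (log_integrand sigma (ln eta)) (ln t1) (ln t2)); split.
  { apply is_RInt_L_integrand; assumption. }
  apply HP.
  assert (L1 : ln t1 < - INR N).
  { rewrite <- (ln_exp (- INR N)); apply ln_increasing; assumption. }
  assert (L2 : INR N < ln t2).
  { rewrite <- (ln_exp (INR N)); apply ln_increasing; [apply exp_pos|assumption]. }
  assert (HN0 := pos_INR N).
  assert (HA := IntR_approx a M _ Ha HM (- ln t1) (ln t2) ltac:(lra) ltac:(lra)).
  rewrite Ropp_involutive in HA.
  refine (Rle_lt_trans _ _ _ HA _).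
  apply Rle_lt_trans with (2 := HN (INR N) (Rle_refl _)).
  apply Rmult_le_compat_l.
  + apply Rdiv_le_0_compat; [apply (exp_dominated_M_nonneg a M _ HM)|exact Ha].
  + apply Rplus_le_compat; apply exp_le; nra.
Qed.

Lemma L_integral_eq (eta : R) : 0 < eta ->
  L_integral (sigma * PI) eta = IntR (log_integrand sigma (ln eta)).
Proof.
intros He; unfold L_integral; apply is_RInt_gen_unique, is_RInt_gen_L_integrand, He.
Qed.

End RealLine.

(** * Meromorphic continuation *)

Lemma locally_C_ball (z : C) (P : C -> Prop) :
  @locally C_UniformSpace z P <->
  exists d : posreal, forall w : C, Cmod (w - z) < d -> P w.
Proof.
split; intros H.
- apply locally_C in H; destruct H as [d Hd]; exists d; intros w Hw; exact (Hd w Hw).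
- apply locally_C; destruct H as [d Hd]; exists d; intros w Hw; exact (Hd w Hw).
Qed.

Lemma locally_Im_bound (z : C) (b B : R) : Rabs (Im z - b) < B ->
  @locally C_UniformSpace z (fun w => Rabs (Im w - b) < B).
Proof.
intros H; apply locally_C_ball.
assert (Hd : 0 < B - Rabs (Im z - b)) by lra.
exists (mkposreal _ Hd); simpl; intros w Hw.
assert (H1 := im_le_Cmod (w - z)%C).
replace (Im (w - z)%C) with (Im w - Im z) in H1 by (unfold Im; simpl; ring).
replace (Im w - b) with ((Im w - Im z) + (Im z - b)) by ring.
apply Rle_lt_trans with (1 := Rabs_triang _ _); lra.
Qed.

Lemma locally_neq_0 (f : C -> C) (z : C) :
  @continuous C_UniformSpace C_UniformSpace f z -> f z <> 0%C ->
  @locally C_UniformSpace z (fun w => f w <> 0%C).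
Proof.
intros Hc H; apply Cmod_gt_0 in H.
destruct (continuous_C_eps f z (mkposreal _ H) Hc) as [d Hd]; simpl in Hd.
apply locally_C_ball; exists d; intros w Hw E; specialize (Hd w Hw).
rewrite E in Hd; replace (0 - f z)%C with (- f z)%C in Hd by ring.
rewrite Cmod_opp in Hd; lra.
Qed.

Lemma meromorphic_of_differentiable (f : C -> C) (z0 : C) :
  @locally C_UniformSpace z0 (fun z => C_differentiable f z) -> meromorphic_at f z0.
Proof.
intros H; exists 0%nat, f; split; [exact H|].
apply filter_forall; intros z _; simpl; field.
Qed.

Lemma C_differentiable_mult (f g : C -> C) (z : C) :
  C_differentiable f z -> C_differentiable g z -> C_differentiable (fun w => f w * g w)%C z.
Proof. intros [lf Hf] [lg Hg]; eexists; apply (is_cderive_mult f g z lf lg Hf Hg). Qed.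

Lemma C_differentiable_const (c z : C) : C_differentiable (fun _ => c) z.
Proof. eexists; apply is_cderive_const. Qed.

Lemma C_differentiable_inv (f : C -> C) (z : C) :
  C_differentiable f z -> f z <> 0%C -> C_differentiable (fun w => / f w)%C z.
Proof.
intros [l Hl] H; eexists.
apply (is_cderive_comp Cinv f z _ _ (is_cderive_inv _ H) Hl).
Qed.

Lemma C_differentiable_translate (f : C -> C) (c z : C) :
  C_differentiable f (z + c)%C -> C_differentiable (fun w => f (w + c))%C z.
Proof.
intros [l Hl]; eexists; apply (is_cderive_comp f (fun w => w + c)%C z l (1 + 0)%C Hl).
apply (is_cderive_plus (fun w => w)); [apply is_cderive_id|apply is_cderive_const].
Qed.

Lemma C_differentiable_ext_loc (f g : C -> C) (z : C) :
  @locally C_UniformSpace z (fun w => f w = g w) ->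
  C_differentiable f z -> C_differentiable g z.
Proof. intros H [l Hl]; exists l; apply (is_cderive_ext_loc f g z l H Hl). Qed.

Lemma Cpow_minus_neq_0 (z z0 : C) (k : nat) : z <> z0 -> Cpow (z - z0)%C k <> 0%C.
Proof. intros H; apply Cpow_nz; intros E; apply H, Ceq_minus, E. Qed.

Lemma meromorphic_mult (f g : C -> C) (z0 : C) :
  meromorphic_at f z0 -> meromorphic_at g z0 -> meromorphic_at (fun z => f z * g z)%C z0.
Proof.
intros [k [F [F1 F2]]] [m [G [G1 G2]]].
exists (k + m)%nat, (fun z => F z * G z)%C; split.
- generalize (filter_and _ _ F1 G1); apply filter_imp; intros z [H1 H2].
  apply C_differentiable_mult; assumption.
- generalize (filter_and _ _ F2 G2); apply filter_imp; intros z [H1 H2] Hz.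
  rewrite H1, H2, Cpow_add_r by exact Hz.
  assert (N1 := Cpow_minus_neq_0 z z0 k Hz); assert (N2 := Cpow_minus_neq_0 z z0 m Hz).
  field; auto.
Qed.

Lemma meromorphic_ext_loc (f g : C -> C) (z0 : C) :
  @locally C_UniformSpace z0 (fun z => f z = g z) ->
  meromorphic_at f z0 -> meromorphic_at g z0.
Proof.
intros H [k [F [F1 F2]]]; exists k, F; split; [exact F1|].
generalize (filter_and _ _ H F2); apply filter_imp; intros z [H1 H2] Hz.
rewrite <- H1; apply H2, Hz.
Qed.

Lemma locally_translate (z c : C) (P : C -> Prop) :
  @locally C_UniformSpace (z + c)%C P -> @locally C_UniformSpace z (fun w => P (w + c)%C).
Proof.
intros H; apply locally_C_ball in H; apply locally_C_ball; destruct H as [d Hd].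
exists d; intros w Hw; apply Hd; replace (w + c - (z + c))%C with (w - z)%C by ring; exact Hw.
Qed.

Lemma meromorphic_translate (f : C -> C) (z0 c : C) :
  meromorphic_at f (z0 + c)%C -> meromorphic_at (fun z => f (z + c)%C) z0.
Proof.
intros [k [F [F1 F2]]]; exists k, (fun z => F (z + c)%C); split.
- generalize (locally_translate _ _ _ F1); apply filter_imp; intros z Hz.
  apply C_differentiable_translate, Hz.
- generalize (locally_translate _ _ _ F2); apply filter_imp; intros z Hz Hne.
  rewrite Hz; [replace (z + c - (z0 + c))%C with (z - z0)%C by ring; reflexivity|].
  intros E; apply Hne, Ceq_minus.
  replace (z - z0)%C with (z + c - (z0 + c))%C by ring; rewrite E; ring.
Qed.

Lemma meromorphic_Cprod (u : nat -> C -> C) (N : nat) (z0 : C) :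
  (forall k, meromorphic_at (u k) z0) -> meromorphic_at (fun z => Cprod (fun k => u k z) N) z0.
Proof.
intros H; induction N as [|N IH]; simpl.
- apply meromorphic_of_differentiable, filter_forall; intros; apply C_differentiable_const.
- apply meromorphic_mult; auto.
Qed.

Lemma C_differentiable_Cprod (u : nat -> C -> C) (N : nat) (z : C) :
  (forall k, (k < N)%nat -> C_differentiable (u k) z) ->
  C_differentiable (fun z => Cprod (fun k => u k z) N) z.
Proof.
induction N as [|N IH]; intros H; simpl; [apply C_differentiable_const|].
apply C_differentiable_mult; [apply IH; intros; apply H|apply H]; auto with arith.
Qed.

Lemma Cprod_S_left (u : nat -> C) (N : nat) :
  Cprod u (S N) = (u 0%nat * Cprod (fun k => u (S k)) N)%C.
Proof.
induction N as [|N IH]; [simpl; ring|].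
change (Cprod u (S (S N))) with (Cprod u (S N) * u (S N))%C.
rewrite IH; simpl; ring.
Qed.

Lemma C_differentiable_1_Cexp (z : C) : C_differentiable (fun w => 1 + Cexp w)%C z.
Proof.
eexists; apply (is_cderive_plus (fun _ => 1%C));
  [apply is_cderive_const|apply is_cderive_Cexp].
Qed.

Lemma continuous_1_Cexp (z : C) :
  @continuous C_UniformSpace C_UniformSpace (fun w => 1 + Cexp w)%C z.
Proof. destruct (C_differentiable_1_Cexp z) as [l Hl]; apply (is_cderive_continuous _ _ l Hl). Qed.

Lemma Cexp_minus_1_bound (eps : posreal) :
  exists d : posreal, forall h : C, Cmod h < d -> Cmod (Cexp h - 1 - h)%C <= eps * Cmod h.
Proof.
destruct (proj1 (is_cderive_eps _ _ _) (is_cderive_Cexp 0%C) eps) as [d Hd].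
exists d; intros h Hh; specialize (Hd h).
replace (h - 0)%C with h in Hd by ring; rewrite Cexp_0 in Hd.
replace (h * 1)%C with h in Hd by ring; exact (Hd Hh).
Qed.

(** It follows from |e^h - 1 - h| <= |h| / 2 near 0. It isolates the zero of 1 - e^h at h = 0 and
    shows that the zero is simple. *)
Lemma Cexp_minus_1_ge :
  exists d : posreal, forall h : C, Cmod h < d -> Cmod h / 2 <= Cmod (1 - Cexp h)%C.
Proof.
assert (H2 : 0 < 1 / 2) by lra.
destruct (Cexp_minus_1_bound (mkposreal _ H2)) as [d Hd]; exists d; intros h Hh.
specialize (Hd h Hh); simpl in Hd.
assert (T := Cmod_triangle (1 - Cexp h)%C (Cexp h - 1 - h)%C).
replace (1 - Cexp h + (Cexp h - 1 - h))%C with (- h)%C in T by ring.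
rewrite Cmod_opp in T; lra.
Qed.

(* The pole of [1 / (1 - e^h)] at [0] is simple; multiplying by [h ^ 2] instead
   of [h] makes the derivative at [0] a consequence of the first order
   expansion of the exponential. *)
Lemma differentiable_sqr_div_1_Cexp :
  @locally C_UniformSpace (RtoC 0) (fun z => C_differentiable (fun h => h * h / (1 - Cexp h))%C z).
Proof.
destruct Cexp_minus_1_ge as [d Hd].
apply locally_C_ball; exists d; intros z Hz.
replace (z - 0)%C with z in Hz by ring.
destruct (Ceq_dec z 0%C) as [E|E].
- subst z; exists (- (1))%C; apply is_cderive_eps; intros eps.
  destruct (Cexp_minus_1_bound (pos_div_2 eps)) as [d' Hd'].
  assert (Hmin : 0 < Rmin d d') by (apply Rmin_pos; apply cond_pos).
  exists (mkposreal _ Hmin); simpl; intros h Hh.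
  replace (h - 0)%C with h in * by ring.
  assert (H1 := Hd h (Rlt_le_trans _ _ _ Hh (Rmin_l _ _))).
  assert (H2 := Hd' h (Rlt_le_trans _ _ _ Hh (Rmin_r _ _))); simpl in H2.
  destruct (Ceq_dec h 0%C) as [E|E].
  { subst h.
    assert (E0 : (0 * 0 / (1 - Cexp 0) - 0 * 0 / (1 - Cexp 0) - 0 * - (1))%C = RtoC 0)
      by (unfold Cdiv; ring).
    rewrite E0, Cmod_0; lra. }
  assert (Hm : 0 < Cmod h) by (apply Cmod_gt_0, E).
  assert (N : (1 - Cexp h)%C <> 0%C) by (apply Cmod_gt_0; lra).
  replace (h * h / (1 - Cexp h) - 0 * 0 / (1 - Cexp 0) - h * - (1))%C
    with (h * (- (Cexp h - 1 - h) / (1 - Cexp h)))%C.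
  2: { replace (0 * 0 / (1 - Cexp 0))%C with (RtoC 0) by (unfold Cdiv; ring).
    field; exact N. }
  rewrite Cmod_mult, Cmod_div, Cmod_opp, Rmult_comm by exact N.
  apply Rmult_le_compat_r; [lra|].
  apply Rmult_le_reg_r with (Cmod (1 - Cexp h)%C); [lra|].
  unfold Rdiv; rewrite Rmult_assoc, Rinv_l, Rmult_1_r by lra.
  assert (He := cond_pos eps); apply Rle_trans with (1 := H2); nra.
- assert (Hm : 0 < Cmod z) by (apply Cmod_gt_0, E).
  assert (N : (1 - Cexp z)%C <> 0%C) by (apply Cmod_gt_0; specialize (Hd z Hz); lra).
  apply (C_differentiable_mult (fun h => h * h)%C (fun h => / (1 - Cexp h))%C).
  + apply C_differentiable_mult; eexists; apply is_cderive_id.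
  + apply C_differentiable_inv; [|exact N].
    eexists; apply (is_cderive_minus (fun _ => 1%C));
      [apply is_cderive_const|apply is_cderive_Cexp].
Qed.

Lemma meromorphic_inv_1_Cexp (z0 : C) : meromorphic_at (fun w => / (1 + Cexp w))%C z0.
Proof.
destruct (Ceq_dec (1 + Cexp z0)%C 0%C) as [E|E].
(* Here e^z0 = -1, so 1 + e^z = 1 - e^(z - z0); the exponent 2 matches the square in
   [differentiable_sqr_div_1_Cexp]. *)
- exists 2%nat, (fun z => (fun h => h * h / (1 - Cexp h))%C (z + - z0)%C); split.
  + assert (H := differentiable_sqr_div_1_Cexp).
    replace (RtoC 0) with (z0 + - z0)%C in H by ring.
    generalize (locally_translate _ _ _ H); apply filter_imp; intros z Hz.
    exact (C_differentiable_translate (fun h => h * h / (1 - Cexp h))%C (- z0)%C z Hz).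
  + destruct Cexp_minus_1_ge as [d Hd]; apply locally_C_ball; exists d.
    intros z Hz Hne; specialize (Hd _ Hz).
    assert (Hm : 0 < Cmod (z - z0)%C) by (apply Cmod_gt_0; intros E1; apply Hne, Ceq_minus, E1).
    assert (N : (1 - Cexp (z - z0))%C <> 0%C) by (apply Cmod_gt_0; lra).
    assert (N2 : (z - z0)%C <> 0%C) by (apply Cmod_gt_0, Hm).
    replace (1 + Cexp z)%C with (1 - Cexp (z - z0))%C.
    2: { replace z with (z0 + (z - z0))%C at 2 by ring; rewrite Cexp_plus.
      replace (Cexp z0) with (1 + Cexp z0 - 1)%C by ring; rewrite E; ring. }
    change (z + - z0)%C with (z - z0)%C; simpl; field; auto.
- apply meromorphic_of_differentiable.
  generalize (locally_neq_0 _ _ (continuous_1_Cexp z0) E); apply filter_imp; intros z Hz.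
  apply C_differentiable_inv; [apply C_differentiable_1_Cexp|exact Hz].
Qed.

Lemma meromorphic_1_Cexp (z0 : C) : meromorphic_at (fun w => 1 + Cexp w)%C z0.
Proof.
apply meromorphic_of_differentiable, filter_forall; intros; apply C_differentiable_1_Cexp.
Qed.

Lemma Cprod_ext (u v : nat -> C) (N : nat) :
  (forall k, u k = v k) -> Cprod u N = Cprod v N.
Proof. intros H; induction N as [|N IH]; simpl; [|rewrite IH, H]; reflexivity. Qed.

(** * Extension from a strip to the plane *)

Section StripExtension.

(** The multiplier [c] is kept abstract to treat both signs of tau at once: it is 1 + e^z for tau >
    0 and 1 / (1 + e^z) for tau < 0. *)
Variables (T : R) (G c : C -> C).
Hypothesis HT : 0 < T < PI.
Hypothesis HG : forall z, Rabs (Im z) < PI -> C_differentiable G z.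
Hypothesis Hfe : forall z, Rabs (Im z) + T < PI ->
  G (z + RtoC T * Ci)%C = (c z * G (z - RtoC T * Ci))%C.
Hypothesis Hc0 : forall w, (1 + Cexp w)%C <> 0%C -> c w <> 0%C.
Hypothesis Hcd : forall w, (1 + Cexp w)%C <> 0%C -> C_differentiable c w.
Hypothesis Hcm : forall w, meromorphic_at c w.
Hypothesis Hcim : forall w, meromorphic_at (fun z => / c z)%C w.

Definition strip_index (z : C) : Z := Int_part ((Im z + T) / (2 * T)).

(* The factors collected when [G (z + i T) = c z * G (z - i T)] is applied [n]
   times to bring [z] back to the strip [|Im z| <= T]. *)
Definition strip_factor (n : Z) (z : C) : C :=
  (Cprod (fun k => c (z + RtoC (- ((2 * INR k + 1) * T)) * Ci)) (Z.to_nat n)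
   * Cprod (fun k => / c (z + RtoC ((2 * INR k + 1) * T) * Ci)) (Z.to_nat (- n)))%C.

Definition strip_extension (z : C) : C :=
  (strip_factor (strip_index z) z
   * G (z + RtoC (- (2 * T * IZR (strip_index z))) * Ci))%C.

Lemma Im_vertical (z : C) (y : R) : Im (z + RtoC y * Ci)%C = Im z + y.
Proof. unfold Im; simpl; ring. Qed.

Lemma strip_index_bounds (z : C) :
  - T <= Im z - 2 * T * IZR (strip_index z) < T.
Proof.
unfold strip_index; destruct (base_Int_part ((Im z + T) / (2 * T))) as [H1 H2].
assert (E : (Im z + T) / (2 * T) * (2 * T) = Im z + T) by (field; lra).
set (q := (Im z + T) / (2 * T)) in *; set (n := IZR (Int_part q)) in *; clearbody n q.
assert (n * (2 * T) <= q * (2 * T)) by (apply Rmult_le_compat_r; lra).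
assert (q * (2 * T) < (n + 1) * (2 * T)) by (apply Rmult_lt_compat_r; lra).
lra.
Qed.

Lemma Z_nat_cases (n : Z) :
  (exists m, n = Z.of_nat m) \/ (exists m, n = (- Z.of_nat (S m))%Z).
Proof.
destruct (Z_le_gt_dec 0 n) as [H|H].
- left; exists (Z.to_nat n); lia.
- right; exists (Z.to_nat (- n) - 1)%nat; lia.
Qed.

Lemma strip_factor_succ (n : Z) (z : C) :
  c (z + RtoC (- ((2 * IZR n + 1) * T)) * Ci)%C <> 0%C ->
  strip_factor (n + 1) z
  = (strip_factor n z * c (z + RtoC (- ((2 * IZR n + 1) * T)) * Ci))%C.
Proof.
intros Hn; unfold strip_factor; destruct (Z_nat_cases n) as [[m E]|[m E]]; subst n.
- replace (Z.to_nat (Z.of_nat m + 1)) with (S m) by lia.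
  replace (Z.to_nat (- (Z.of_nat m + 1))) with 0%nat by lia.
  replace (Z.to_nat (Z.of_nat m)) with m by lia.
  replace (Z.to_nat (- Z.of_nat m)) with 0%nat by lia.
  rewrite <- INR_IZR_INZ; simpl; ring.
- replace (Z.to_nat (- Z.of_nat (S m) + 1)) with 0%nat by lia.
  replace (Z.to_nat (- (- Z.of_nat (S m) + 1))) with m by lia.
  replace (Z.to_nat (- Z.of_nat (S m))) with 0%nat by lia.
  replace (Z.to_nat (- - Z.of_nat (S m))) with (S m) by lia.
  revert Hn.
  replace (- ((2 * IZR (- Z.of_nat (S m)) + 1) * T)) with ((2 * INR m + 1) * T)
    by (rewrite opp_IZR, <- INR_IZR_INZ, S_INR; ring).
  intros Hn; simpl; field; exact Hn.
Qed.

Lemma strip_factor_translate (n : Z) (z : C) :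
  c (z + RtoC T * Ci)%C <> 0%C ->
  strip_factor (n + 1) (z + RtoC (2 * T) * Ci)
  = (c (z + RtoC T * Ci) * strip_factor n z)%C.
Proof.
intros Hz; unfold strip_factor; destruct (Z_nat_cases n) as [[m E]|[m E]]; subst n.
- replace (Z.to_nat (Z.of_nat m + 1)) with (S m) by lia.
  replace (Z.to_nat (- (Z.of_nat m + 1))) with 0%nat by lia.
  replace (Z.to_nat (Z.of_nat m)) with m by lia.
  replace (Z.to_nat (- Z.of_nat m)) with 0%nat by lia.
  rewrite Cprod_S_left; simpl (Cprod _ 0).
  replace (z + RtoC (2 * T) * Ci + RtoC (- ((2 * INR 0 + 1) * T)) * Ci)%C
    with (z + RtoC T * Ci)%C.
  2: { simpl; rewrite RtoC_opp, !RtoC_mult, RtoC_plus, RtoC_mult; ring. }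
  rewrite (Cprod_ext _ (fun k => c (z + RtoC (- ((2 * INR k + 1) * T)) * Ci)%C)); [ring|].
  intros k; f_equal; rewrite S_INR, <- Cplus_assoc; f_equal.
  rewrite <- Cmult_plus_distr_r, <- RtoC_plus; do 2 f_equal; ring.
- replace (Z.to_nat (- Z.of_nat (S m) + 1)) with 0%nat by lia.
  replace (Z.to_nat (- (- Z.of_nat (S m) + 1))) with m by lia.
  replace (Z.to_nat (- Z.of_nat (S m))) with 0%nat by lia.
  replace (Z.to_nat (- - Z.of_nat (S m))) with (S m) by lia.
  rewrite Cprod_S_left; simpl (Cprod _ 0).
  replace (z + RtoC ((2 * INR 0 + 1) * T) * Ci)%C with (z + RtoC T * Ci)%C
    by (simpl; rewrite !RtoC_mult, RtoC_plus, RtoC_mult; ring).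
  transitivity (Cprod (fun k => / c (z + RtoC ((2 * INR (S k) + 1) * T) * Ci)) m)%C;
    [|field; exact Hz].
  rewrite Cmult_1_l; apply Cprod_ext; intros k; do 2 f_equal.
  rewrite <- Cplus_assoc; f_equal.
  rewrite <- Cmult_plus_distr_r, <- RtoC_plus; do 2 f_equal; rewrite S_INR; ring.
Qed.

Lemma strip_factor_0 (z : C) : strip_factor 0 z = 1%C.
Proof. unfold strip_factor; simpl; ring. Qed.

(** This is the functional equation at w = z - i (2 n + 1) T, a point near the real axis when z is
    near the common edge of strips n and n + 1. It shows that the two local formulas agree there. *)
Lemma strip_step (n : Z) (z : C) :
  Rabs (Im z - (2 * IZR n + 1) * T) + T < PI ->
  (strip_factor n z * G (z + RtoC (- (2 * T * IZR n)) * Ci)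
   = strip_factor (n + 1) z * G (z + RtoC (- (2 * T * IZR (n + 1))) * Ci))%C.
Proof.
intros H; set (w := (z + RtoC (- ((2 * IZR n + 1) * T)) * Ci)%C).
assert (Hw : Rabs (Im w) + T < PI) by (unfold w; rewrite Im_vertical; exact H).
rewrite strip_factor_succ by (apply Hc0, one_Cexp_neq_0; fold w; lra).
fold w.
replace (z + RtoC (- (2 * T * IZR n)) * Ci)%C with (w + RtoC T * Ci)%C.
2: { unfold w; rewrite <- Cplus_assoc, <- Cmult_plus_distr_r, <- RtoC_plus.
  do 3 f_equal; ring. }
replace (z + RtoC (- (2 * T * IZR (n + 1))) * Ci)%C with (w - RtoC T * Ci)%C.
2: { unfold w, Cminus; replace (- (RtoC T * Ci))%C with (RtoC (- T) * Ci)%C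
    by (rewrite RtoC_opp; ring).
  rewrite <- Cplus_assoc, <- Cmult_plus_distr_r, <- RtoC_plus, plus_IZR.
  do 3 f_equal; ring. }
rewrite (Hfe w Hw); ring.
Qed.

(** [PI - T] is the margin by which the domain of [G] exceeds the strip |Im z| <= T. The cap [T]
    ensures that within this margin only neighbouring strips compete. *)
Definition overlap : R := Rmin T (PI - T).

(** [strip_index] jumps at the edges of the strips, so the definition alone says nothing about
    regularity there. On the enlarged open strip one fixed formula is valid, and local properties
    can be read off from it. *)
Lemma strip_extension_eq (n : Z) (z : C) :
  Rabs (Im z - 2 * T * IZR n) < T + overlap ->
  strip_extension z = (strip_factor n z * G (z + RtoC (- (2 * T * IZR n)) * Ci))%C.
Proof.
intros H; apply Rabs_def2 in H; unfold strip_extension.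
assert (Hb := strip_index_bounds z).
assert (O1 : overlap <= T) by apply Rmin_l.
assert (O2 : overlap <= PI - T) by apply Rmin_r.
set (m := strip_index z) in *; clearbody m.
assert (Hmn : m = n \/ m = (n + 1)%Z \/ n = (m + 1)%Z).
{ assert (A1 : IZR m < IZR (n + 2)) by (rewrite plus_IZR; nra).
  assert (A2 : IZR n < IZR (m + 2)) by (rewrite plus_IZR; nra).
  apply lt_IZR in A1; apply lt_IZR in A2; lia. }
destruct Hmn as [E|[E|E]]; subst.
- reflexivity.
- symmetry; apply strip_step; rewrite plus_IZR in Hb.
  assert (Rabs (Im z - (2 * IZR n + 1) * T) < PI - T); [apply Rabs_def1; lra|lra].
- apply strip_step; rewrite plus_IZR in H.
  assert (Rabs (Im z - (2 * IZR m + 1) * T) < PI - T); [apply Rabs_def1; lra|lra].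
Qed.

Lemma overlap_bounds : 0 < overlap /\ T + overlap <= PI.
Proof.
assert (H : overlap <= PI - T) by apply Rmin_r.
split; [apply Rmin_pos; lra|lra].
Qed.

Lemma strip_extension_loc (n : Z) (z : C) :
  Rabs (Im z - 2 * T * IZR n) < T + overlap ->
  @locally C_UniformSpace z (fun w =>
    (strip_factor n w * G (w + RtoC (- (2 * T * IZR n)) * Ci))%C = strip_extension w).
Proof.
intros H; generalize (locally_Im_bound z _ _ H); apply filter_imp; intros w Hw.
symmetry; apply strip_extension_eq, Hw.
Qed.

Lemma strip_G_differentiable (n : Z) (z : C) :
  Rabs (Im z - 2 * T * IZR n) < T + overlap ->
  C_differentiable (fun w => G (w + RtoC (- (2 * T * IZR n)) * Ci))%C z.
Proof.
intros H; apply C_differentiable_translate, HG; rewrite Im_vertical.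
destruct overlap_bounds; unfold Rminus in H; lra.
Qed.

Lemma strip_extension_meromorphic (z : C) : meromorphic_at strip_extension z.
Proof.
assert (Hb := strip_index_bounds z); set (n := strip_index z) in *.
destruct overlap_bounds as [O1 O2].
assert (H : Rabs (Im z - 2 * T * IZR n) < T + overlap) by (apply Rabs_def1; lra).
apply (meromorphic_ext_loc _ _ _ (strip_extension_loc n z H)).
apply meromorphic_mult.
- unfold strip_factor; apply meromorphic_mult.
  + apply (meromorphic_Cprod (fun k z => c (z + RtoC (- ((2 * INR k + 1) * T)) * Ci))%C).
    intros k; apply meromorphic_translate, Hcm.
  + apply (meromorphic_Cprod (fun k z => / c (z + RtoC ((2 * INR k + 1) * T) * Ci))%C).
    intros k; apply (meromorphic_translate (fun z => / c z)%C), Hcim.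
- apply meromorphic_of_differentiable.
  generalize (locally_Im_bound z _ _ H); apply filter_imp; intros w Hw.
  apply strip_G_differentiable, Hw.
Qed.

(** Excluding zeros at all odd multiples of T avoids tracking which factors occur in
    [strip_factor n]; genericity supplies all of them together. *)
Lemma strip_extension_differentiable (n : Z) (z : C) :
  Rabs (Im z - 2 * T * IZR n) < T + overlap ->
  (forall j : Z, (1 + Cexp (z + RtoC ((2 * IZR j + 1) * T) * Ci))%C <> 0%C) ->
  C_differentiable strip_extension z.
Proof.
intros H Hj; apply (C_differentiable_ext_loc _ _ _ (strip_extension_loc n z H)).
apply C_differentiable_mult; [|apply strip_G_differentiable, H].
assert (Hj2 : forall k : nat,
  (1 + Cexp (z + RtoC (- ((2 * INR k + 1) * T)) * Ci))%C <> 0%C).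
{ intros k; specialize (Hj (- Z.of_nat k - 1)%Z).
  replace ((2 * IZR (- Z.of_nat k - 1) + 1) * T) with (- ((2 * INR k + 1) * T)) in Hj
    by (rewrite minus_IZR, opp_IZR, <- INR_IZR_INZ; ring).
  exact Hj. }
unfold strip_factor; apply C_differentiable_mult.
- apply (C_differentiable_Cprod (fun k z => c (z + RtoC (- ((2 * INR k + 1) * T)) * Ci))%C).
  intros k _; apply C_differentiable_translate, Hcd, Hj2.
- apply (C_differentiable_Cprod (fun k z => / c (z + RtoC ((2 * INR k + 1) * T) * Ci))%C).
  intros k _; specialize (Hj (Z.of_nat k)); rewrite <- INR_IZR_INZ in Hj.
  apply (C_differentiable_translate (fun z => / c z)%C).
  apply C_differentiable_inv; [apply Hcd, Hj|apply Hc0, Hj].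
Qed.

Lemma strip_extension_center (z : C) : Rabs (Im z) <= T -> strip_extension z = G z.
Proof.
intros H; destruct overlap_bounds as [O1 _].
rewrite (strip_extension_eq 0).
- rewrite strip_factor_0, Cmult_1_l; f_equal.
  replace (- (2 * T * 0)) with 0 by ring; ring.
- replace (Im z - 2 * T * 0) with (Im z) by ring; lra.
Qed.

(** For n = 0 both products are empty and [G] alone remains. The closed strip is covered because the
    denominators of [Q_phase] are evaluated on its edges. *)
Lemma strip_extension_center_differentiable (z : C) :
  Rabs (Im z) <= T -> C_differentiable strip_extension z.
Proof.
intros H; destruct overlap_bounds as [O1 _].
assert (H0 : Rabs (Im z - 2 * T * 0) < T + overlap).
{ replace (Im z - 2 * T * 0) with (Im z) by ring; lra. }
apply (C_differentiable_ext_loc _ _ _ (strip_extension_loc 0 z H0)).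
apply C_differentiable_mult; [|apply strip_G_differentiable, H0].
apply (C_differentiable_const (1 * 1)%C).
Qed.

Lemma strip_extension_translate (n : Z) (z : C) :
  Rabs (Im z - 2 * T * IZR n) <= T ->
  (1 + Cexp (z + RtoC T * Ci))%C <> 0%C ->
  strip_extension (z + RtoC (2 * T) * Ci)%C
  = (c (z + RtoC T * Ci) * strip_extension z)%C.
Proof.
intros H Hz; destruct overlap_bounds as [O1 _].
rewrite (strip_extension_eq n z) by lra.
rewrite (strip_extension_eq (n + 1)).
2: { rewrite Im_vertical, plus_IZR.
  replace (Im z + 2 * T - 2 * T * (IZR n + 1)) with (Im z - 2 * T * IZR n) by ring; lra. }
rewrite strip_factor_translate by (apply Hc0, Hz).
rewrite <- Cmult_assoc; do 3 f_equal.
rewrite <- Cplus_assoc; f_equal.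
rewrite <- Cmult_plus_distr_r, <- RtoC_plus, plus_IZR; do 2 f_equal; ring.
Qed.

End StripExtension.

(** * The products *)

Lemma periodic_factor (pt : R -> C) (dil : C -> C) (q : C) (twoJ : nat) :
  determined_up_to_periodic pt dil q twoJ.
Proof.
intros Q0 Q HQ0 Hnz; split.
- intros HQ; exists (fun z => Q z / Q0 z)%C; intros eta Heta.
  destruct (Hnz eta Heta) as [N1 N2].
  assert (E0 := HQ0 eta Heta); assert (E := HQ eta Heta).
  assert (Hp : (1 + RtoC eta)%C <> 0%C).
  { rewrite <- RtoC_plus; intros H; apply (f_equal Re) in H; unfold Re in H; simpl in H; lra. }
  split; [|split; field; assumption].
  set (w := (1 + Cpowz q (- Z.of_nat twoJ) * RtoC eta)%C) in *.
  (* A zero of [w] would make the left side of the equation for [Q0] vanish, although neither [Q0]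
     at the dilated point nor 1 + eta does. *)
  assert (N3 : w <> 0%C).
  { intros H; rewrite H, Cmult_0_r in E0; revert E0; apply Cmult_neq_0; assumption. }
  replace (Q (dil (pt eta))) with (Q (pt eta) * w / (1 + RtoC eta))%C
    by (rewrite <- E; field; exact Hp).
  replace (Q0 (dil (pt eta))) with (Q0 (pt eta) * w / (1 + RtoC eta))%C
    by (rewrite <- E0; field; exact Hp).
  field; auto.
- intros [f Hf] eta Heta; destruct (Hf eta Heta) as [F1 [F2 F3]].
  rewrite F2, F3, F1; assert (E0 := HQ0 eta Heta).
  transitivity (f (pt eta) * (Q0 (dil (pt eta)) * (1 + RtoC eta)))%C; [ring|].
  rewrite E0; ring.
Qed.

Lemma Cpowz_of_nat (q : C) (n : nat) : Cpowz q (Z.of_nat n) = Cpow q n.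
Proof. destruct n; [reflexivity|]; simpl Z.of_nat; unfold Cpowz; rewrite SuccNat2Pos.id_succ; reflexivity. Qed.

Lemma Cpowz_opp_of_nat (q : C) (n : nat) : Cpowz q (- Z.of_nat n) = (/ Cpow q n)%C.
Proof.
destruct n; [simpl; field|]; simpl Z.of_nat; unfold Cpowz; simpl.
rewrite SuccNat2Pos.id_succ; reflexivity.
Qed.

Lemma Cpowz_succ (q : C) (m : Z) : q <> 0%C -> Cpowz q (m + 1) = (Cpowz q m * q)%C.
Proof.
intros Hq; destruct (Z_nat_cases m) as [[n E]|[n E]]; subst m.
- replace (Z.of_nat n + 1)%Z with (Z.of_nat (S n)) by lia.
  rewrite !Cpowz_of_nat, Cpow_S; ring.
- replace (- Z.of_nat (S n) + 1)%Z with (- Z.of_nat n)%Z by lia.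
  rewrite !Cpowz_opp_of_nat, Cpow_S; field; split; [apply Cpow_nz|]; exact Hq.
Qed.

Lemma Cpowz_add_2 (q : C) (m : Z) : q <> 0%C -> Cpowz q (m + 2) = (Cpowz q m * Cpow q 2)%C.
Proof.
intros Hq; replace (m + 2)%Z with (m + 1 + 1)%Z by lia.
rewrite !Cpowz_succ by exact Hq; simpl; ring.
Qed.

Lemma RtoC_neq_0 (x : R) : x <> 0 -> RtoC x <> 0%C.
Proof. intros H E; apply H, (f_equal Re E). Qed.

Lemma Cpowz_RtoC (r : R) (m : Z) : r <> 0 -> Cpowz (RtoC r) m = RtoC (powerRZ r m).
Proof.
intros Hr; destruct m as [|p|p]; simpl; [reflexivity| |].
- rewrite <- RtoC_pow; reflexivity.
- rewrite <- RtoC_pow, <- RtoC_inv; [reflexivity|apply pow_nonzero, Hr].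
Qed.

Lemma Cpowz_Cexp (w : C) (m : Z) : Cpowz (Cexp w) m = Cexp (RtoC (IZR m) * w)%C.
Proof.
assert (Hn : forall n : nat, Cpow (Cexp w) n = Cexp (RtoC (INR n) * w)%C).
{ induction n as [|n IH].
  - simpl; rewrite Cmult_0_l, Cexp_0; reflexivity.
  - rewrite Cpow_S, IH, <- Cexp_plus, S_INR, RtoC_plus; f_equal; ring. }
destruct (Z_nat_cases m) as [[n E]|[n E]]; subst m.
- rewrite Cpowz_of_nat, Hn, INR_IZR_INZ; reflexivity.
- rewrite Cpowz_opp_of_nat, Hn, <- Cexp_opp, opp_IZR, <- INR_IZR_INZ, RtoC_opp.
  f_equal; ring.
Qed.

Lemma Cmod_Cpowz_phase (q : C) (m : Z) : Cmod q = 1 -> Cmod (Cpowz q m) = 1.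
Proof.
intros Hq; assert (Hq0 : q <> 0%C) by (apply Cmod_gt_0; lra).
destruct (Z_nat_cases m) as [[n E]|[n E]]; subst m.
- rewrite Cpowz_of_nat, Cmod_pow, Hq, pow1; reflexivity.
- rewrite Cpowz_opp_of_nat, Cmod_inv by (apply Cpow_nz, Hq0).
  rewrite Cmod_pow, Hq, pow1; lra.
Qed.

(* A zero forces [q ^ m = - 1], hence [q ^ (2 m) = 1]. *)
Lemma generic_phase_factor_neq_0 (q : C) (m : Z) (eta : R) :
  generic_phase q -> m <> 0%Z -> 0 < eta -> (1 + RtoC eta * Cpowz q m)%C <> 0%C.
Proof.
intros [Hq Hg] Hm He E; assert (Hq0 : q <> 0%C) by (apply Cmod_gt_0; lra).
assert (E1 : (RtoC eta * Cpowz q m)%C = (- (1))%C).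
{ replace (RtoC eta * Cpowz q m)%C with ((1 + RtoC eta * Cpowz q m) - 1)%C by ring.
  rewrite E; ring. }
assert (E2 := f_equal Cmod E1).
rewrite Cmod_mult, Cmod_opp, Cmod_1, (Cmod_Cpowz_phase q m Hq), Cmod_R, Rmult_1_r in E2.
rewrite Rabs_pos_eq in E2 by lra; subst eta.
rewrite Cmult_1_l in E1.
destruct (Z_nat_cases m) as [[n En]|[n En]]; subst m.
- rewrite Cpowz_of_nat in E1; apply (Hg (n + n)%nat); [lia|].
  rewrite Cpow_add_r, E1; ring.
- rewrite Cpowz_opp_of_nat in E1; apply (Hg (S n + S n)%nat); [lia|].
  assert (N := Cpow_nz q (S n) Hq0).
  assert (E3 : Cpow q (S n) = (- (1))%C).
  { replace (Cpow q (S n)) with (/ / Cpow q (S n))%C by (field; exact N).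
    rewrite E1; field. }
  rewrite Cpow_add_r, E3; ring.
Qed.

Lemma positive_real_factor_neq_0 (r eta : R) (m : Z) : 0 < r -> 0 < eta ->
  (1 + RtoC eta * Cpowz (RtoC r) m)%C <> 0%C.
Proof.
intros Hr He; rewrite Cpowz_RtoC, <- RtoC_mult, <- RtoC_plus by lra.
apply RtoC_neq_0; assert (H := powerRZ_lt r m Hr); nra.
Qed.

Lemma factor_neq_0 (q : C) (m : Z) (eta : R) :
  positive_real q \/ generic_phase q -> m <> 0%Z -> 0 < eta ->
  (1 + RtoC eta * Cpowz q m)%C <> 0%C.
Proof.
intros [[r [Hr E]]|Hq] Hm He.
- subst q; apply positive_real_factor_neq_0; assumption.
- apply generic_phase_factor_neq_0; assumption.
Qed.

Lemma base_neq_0 (q : C) : positive_real q \/ generic_phase q -> q <> 0%C.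
Proof.
intros [[r [Hr E]]|[Hq _]]; [subst q; apply RtoC_neq_0; lra|].
apply Cmod_gt_0; lra.
Qed.

Lemma Q_integer_factor_dilation (q eta : C) (twoJ k : nat) : q <> 0%C ->
  Q_integer_factor q twoJ (Cpow q 2 * eta)%C k = Q_integer_factor q twoJ eta (S k).
Proof.
intros Hq; unfold Q_integer_factor.
replace (- Z.of_nat twoJ + 2 * Z.of_nat (S k))%Z
  with (- Z.of_nat twoJ + 2 * Z.of_nat k + 2)%Z by lia.
rewrite Cpowz_add_2 by exact Hq; ring.
Qed.

(** The range includes k = J because dilation shifts the index by one. At k = J the exponent is 0
    and the factor is 1 + eta; at the other indices it is nonzero, so genericity applies. *)
Lemma Q_integer_factors_neq_0 (q : C) (J : nat) (eta : R) (k : nat) :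
  positive_real q \/ generic_phase q -> 0 < eta -> (k <= J)%nat ->
  Q_integer_factor q (2 * J) (RtoC eta) k <> 0%C.
Proof.
intros Hq He Hk; unfold Q_integer_factor.
destruct (Nat.eq_dec k J) as [E|E].
- replace (- Z.of_nat (2 * J) + 2 * Z.of_nat k)%Z with 0%Z by lia.
  simpl; rewrite Cmult_1_r, <- RtoC_plus; apply RtoC_neq_0; lra.
- apply factor_neq_0; [exact Hq|lia|exact He].
Qed.

Lemma Q_integer_solves (q : C) (J : nat) :
  positive_real q \/ generic_phase q -> solves q (2 * J) (Q_integer q J).
Proof.
intros Hq eta He; assert (Hq0 := base_neq_0 q Hq); unfold Q_integer.
rewrite (Cprod_ext _ (fun k => 1 / Q_integer_factor q (2 * J) (RtoC eta) (S k))%C)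
  by (intros k; rewrite Q_integer_factor_dilation by exact Hq0; reflexivity).
set (u := fun k => (1 / Q_integer_factor q (2 * J) (RtoC eta) k)%C).
change (fun k => (1 / Q_integer_factor q (2 * J) (RtoC eta) (S k))%C)
  with (fun k => u (S k)).
assert (E0 : (u 0%nat * (1 + Cpowz q (- Z.of_nat (2 * J)) * RtoC eta))%C = 1%C).
{ assert (N := Q_integer_factors_neq_0 q J eta 0 Hq He (Nat.le_0_l _)).
  unfold u; unfold Q_integer_factor in *.
  replace (- Z.of_nat (2 * J) + 2 * Z.of_nat 0)%Z with (- Z.of_nat (2 * J))%Z in * by lia.
  rewrite (Cmult_comm (Cpowz _ _)); field; exact N. }
assert (EJ : (u J * (1 + RtoC eta))%C = 1%C).
{ assert (N := Q_integer_factors_neq_0 q J eta J Hq He (Nat.le_refl _)).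
  unfold u; unfold Q_integer_factor in *.
  replace (- Z.of_nat (2 * J) + 2 * Z.of_nat J)%Z with 0%Z in * by lia.
  simpl Cpowz in *; rewrite Cmult_1_r in *; field; exact N. }
(* The product of the J + 1 factors u 0, ..., u J is split off at either end; its end factors are
   the inverses of 1 + q^(-2J) eta and 1 + eta. *)
assert (ES : (u 0%nat * Cprod (fun k => u (S k)) J)%C = (Cprod u J * u J)%C)
  by (rewrite <- Cprod_S_left; reflexivity).
set (P := Cprod (fun k => u (S k)) J) in *; set (P' := Cprod u J) in *.
set (w := (1 + Cpowz q (- Z.of_nat (2 * J)) * RtoC eta)%C) in *.
set (v := (1 + RtoC eta)%C) in *.
transitivity ((u 0%nat * w) * (P * v))%C; [rewrite E0; ring|].
transitivity ((u 0%nat * P) * (w * v))%C; [ring|]; rewrite ES.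
transitivity ((u J * v) * (P' * w))%C; [ring|]; rewrite EJ; ring.
Qed.

(** * Infinite products with geometric factors *)

Fixpoint Rprod (u : nat -> R) (N : nat) : R :=
  match N with
  | O => 1
  | S k => Rprod u k * u k
  end.

Lemma Cprod_RtoC (u : nat -> R) (N : nat) : Cprod (fun k => RtoC (u k)) N = RtoC (Rprod u N).
Proof. induction N as [|N IH]; simpl; [reflexivity|]; rewrite IH, RtoC_mult; reflexivity. Qed.

Lemma Rprod_S_left (u : nat -> R) (N : nat) :
  Rprod u (S N) = u 0%nat * Rprod (fun k => u (S k)) N.
Proof.
induction N as [|N IH]; [simpl; ring|].
change (Rprod u (S (S N))) with (Rprod u (S N) * u (S N)).
rewrite IH; simpl; ring.
Qed.

Lemma inf_prod_RtoC (u : nat -> C) (v : nat -> R) (l : R) :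
  (forall k, u k = RtoC (v k)) -> is_lim_seq (Rprod v) l -> inf_prod u = RtoC l.
Proof.
intros Huv Hl; unfold inf_prod, RtoC; f_equal.
- rewrite (Lim_seq_ext _ (Rprod v)).
  + rewrite (is_lim_seq_unique _ _ Hl); reflexivity.
  + intros n; rewrite (Cprod_ext _ _ n Huv), Cprod_RtoC; reflexivity.
- rewrite (Lim_seq_ext _ (fun _ => 0)).
  + rewrite Lim_seq_const; reflexivity.
  + intros n; rewrite (Cprod_ext _ _ n Huv), Cprod_RtoC; reflexivity.
Qed.

Lemma ex_inf_prod_RtoC (u : nat -> C) (v : nat -> R) (l : R) :
  (forall k, u k = RtoC (v k)) -> is_lim_seq (Rprod v) l -> l <> 0 -> ex_inf_prod u.
Proof.
intros Huv Hl Hne; exists (RtoC l); split; [apply RtoC_neq_0, Hne|].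
intros P HP; apply locally_C_ball in HP; destruct HP as [d Hd].
destruct (proj2 (is_lim_seq_spec _ _) Hl d) as [N HN]; exists N; intros n Hn.
apply Hd; rewrite (Cprod_ext _ _ n Huv), Cprod_RtoC, <- RtoC_minus, Cmod_R.
apply HN, Hn.
Qed.

Lemma Rprod_1_geom_lim (A rho : R) : 0 < A -> 0 < rho < 1 ->
  exists l, 1 <= l /\ is_lim_seq (Rprod (fun k => 1 + A * rho ^ k)) l.
Proof.
intros HA Hr.
assert (Hk : forall k, 0 < A * rho ^ k).
{ intros k; apply Rmult_lt_0_compat; [exact HA|apply pow_lt; lra]. }
assert (H1 : forall n, 1 <= Rprod (fun k => 1 + A * rho ^ k) n).
{ induction n as [|n IH]; simpl; [lra|]; specialize (Hk n); nra. }
(* By 1 + x <= e^x the product is at most the exponential of the partial geometric sum of A rho^k,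
   kept in closed form so that the induction goes through. *)
assert (HB : forall n, Rprod (fun k => 1 + A * rho ^ k) n
  <= exp (A / (1 - rho) * (1 - rho ^ n))).
{ induction n as [|n IH]; simpl.
  - rewrite Rminus_diag, Rmult_0_r, exp_0; lra.
  - replace (A / (1 - rho) * (1 - rho * rho ^ n))
      with (A / (1 - rho) * (1 - rho ^ n) + A * rho ^ n) by (field; lra).
    rewrite exp_plus; apply Rmult_le_compat; [|specialize (Hk n); lra|exact IH|].
    + specialize (H1 n); lra.
    + apply exp_ineq1_le. }
destruct (ex_finite_lim_seq_incr (Rprod (fun k => 1 + A * rho ^ k)) (exp (A / (1 - rho))))
  as [l Hl].
- intros n; simpl; specialize (Hk n); specialize (H1 n); nra.
- intros n; apply Rle_trans with (1 := HB n), exp_le.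
  assert (0 < A / (1 - rho)) by (apply Rdiv_lt_0_compat; lra).
  assert (0 < rho ^ n) by (apply pow_lt; lra); nra.
- exists l; split; [|exact Hl].
  exact (is_lim_seq_le _ _ (Finite 1) (Finite l) H1 (is_lim_seq_const 1) Hl).
Qed.

(** Common shape of the factors in part (ii), with rho = q^2 for q < 1 and rho = q^(-2) for q >
    1. *)
Definition geom_factor (A B rho : R) (k : nat) : R := (1 + A * rho ^ k) / (1 + B * rho ^ k).

(** Numerators and denominators converge separately to limits at least 1, so the quotient has a
    positive limit, as convergence of an infinite product demands. *)
Lemma Rprod_geom_factor_lim (A B rho : R) : 0 < A -> 0 < B -> 0 < rho < 1 ->
  exists l, 0 < l /\ is_lim_seq (Rprod (geom_factor A B rho)) l.
Proof.
intros HA HB Hr.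
destruct (Rprod_1_geom_lim A rho HA Hr) as [a [Ha La]].
destruct (Rprod_1_geom_lim B rho HB Hr) as [b [Hb Lb]].
exists (a / b); split; [apply Rdiv_lt_0_compat; lra|].
apply is_lim_seq_ext with (fun n => Rprod (fun k => 1 + A * rho ^ k) n
  / Rprod (fun k => 1 + B * rho ^ k) n); [|apply is_lim_seq_div'; auto; lra].
assert (Hp : forall n, 0 < Rprod (fun k => 1 + B * rho ^ k) n).
{ induction n as [|n IH]; simpl; [lra|].
  assert (0 < rho ^ n) by (apply pow_lt; lra); apply Rmult_lt_0_compat; [exact IH|nra]. }
induction n as [|n IH]; simpl; [field|].
rewrite <- IH; unfold geom_factor; assert (0 < rho ^ n) by (apply pow_lt; lra).
specialize (Hp n); field; split; [nra|lra].
Qed.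

(** Multiplying both parameters by rho advances the index by one, so the two products differ by the
    factor (1 + A) / (1 + B) of index 0. *)
Lemma geom_product_shift (A B rho l l' : R) : 0 < A -> 0 < B -> 0 < rho < 1 ->
  is_lim_seq (Rprod (geom_factor A B rho)) l ->
  is_lim_seq (Rprod (geom_factor (A * rho) (B * rho) rho)) l' ->
  l' * (1 + A) = l * (1 + B).
Proof.
intros HA HB Hr L L'.
apply is_lim_seq_incr_1 in L.
assert (E : l = (1 + A) / (1 + B) * l').
{ apply is_lim_seq_unique in L.
  assert (L2 : is_lim_seq (fun n => Rprod (geom_factor A B rho) (S n))
    ((1 + A) / (1 + B) * l')).
  { apply is_lim_seq_ext with
      (fun n => (1 + A) / (1 + B) * Rprod (geom_factor (A * rho) (B * rho) rho) n).
    - intros n; rewrite Rprod_S_left; f_equal.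
      + unfold geom_factor; simpl; rewrite !Rmult_1_r; reflexivity.
      + induction n as [|n IH]; simpl; [reflexivity|]; rewrite IH; f_equal.
        unfold geom_factor; simpl; rewrite !Rmult_assoc; reflexivity.
    - apply (is_lim_seq_scal_l _ _ (Finite l')), L'. }
  apply is_lim_seq_unique in L2; rewrite L in L2; injection L2; auto. }
rewrite E; field; lra.
Qed.

Lemma powerRZ_even (r : R) (k : nat) : powerRZ r (2 * Z.of_nat k) = (r * r) ^ k.
Proof.
replace (2 * Z.of_nat k)%Z with (Z.of_nat (2 * k)) by lia.
rewrite <- pow_powerRZ, pow_mult; f_equal; simpl; ring.
Qed.

Lemma powerRZ_opp_even (r : R) (k : nat) :
  powerRZ r (- (2 * Z.of_nat k)) = (/ (r * r)) ^ k.
Proof.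
rewrite powerRZ_neg', powerRZ_even, pow_inv; reflexivity.
Qed.

Lemma Q_small_factor_geom (r eta : R) (twoJ k : nat) : 0 < r -> 0 < eta ->
  Q_small_factor (RtoC r) twoJ (RtoC eta) k
  = RtoC (geom_factor eta (powerRZ r (- Z.of_nat twoJ) * eta) (r * r) k).
Proof.
intros Hr He; unfold Q_small_factor, geom_factor.
rewrite !Cpowz_RtoC, powerRZ_add, powerRZ_even by lra.
assert (H1 := powerRZ_lt r (- Z.of_nat twoJ) Hr).
assert (H2 : 0 < (r * r) ^ k) by (apply pow_lt; nra).
assert (H3 : 0 < powerRZ r (- Z.of_nat twoJ) * eta * (r * r) ^ k)
  by (repeat apply Rmult_lt_0_compat; assumption).
rewrite <- !RtoC_mult, <- !RtoC_plus, <- RtoC_div.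
- f_equal; f_equal; ring.
- lra.
Qed.

Lemma Q_large_factor_geom (r eta : R) (twoJ k : nat) : 0 < r -> 0 < eta ->
  Q_large_factor (RtoC r) twoJ (RtoC eta) k
  = RtoC (geom_factor (powerRZ r (- Z.of_nat twoJ) * eta * / (r * r))
      (eta * / (r * r)) (/ (r * r)) k).
Proof.
intros Hr He; unfold Q_large_factor, geom_factor.
assert (E : powerRZ r (- 2 * Z.of_nat k - 2) = / (r * r) * (/ (r * r)) ^ k).
{ replace (- 2 * Z.of_nat k - 2)%Z with (- (2 * Z.of_nat (S k)))%Z by lia.
  rewrite powerRZ_opp_even; reflexivity. }
rewrite !Cpowz_RtoC by lra.
replace (- Z.of_nat twoJ - 2 * Z.of_nat k - 2)%Z
  with (- Z.of_nat twoJ + (- 2 * Z.of_nat k - 2))%Z by lia.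
rewrite powerRZ_add, E by lra.
assert (H1 := powerRZ_lt r (- Z.of_nat twoJ) Hr).
assert (H0 : 0 < / (r * r)) by (apply Rinv_0_lt_compat; nra).
assert (H2 : 0 < (/ (r * r)) ^ k) by (apply pow_lt, H0).
assert (H3 : 0 < / (r * r) * (/ (r * r)) ^ k * eta)
  by (repeat apply Rmult_lt_0_compat; assumption).
rewrite <- !RtoC_mult, <- !RtoC_plus, <- RtoC_div.
- f_equal; f_equal; ring.
- lra.
Qed.

Lemma small_products (r : R) (twoJ : nat) : 0 < r < 1 ->
  (forall eta : R, 0 < eta -> ex_inf_prod (Q_small_factor (RtoC r) twoJ (RtoC eta))) /\
  solves (RtoC r) twoJ (fun eta => inf_prod (Q_small_factor (RtoC r) twoJ eta)).
Proof.
intros Hr; assert (Hrho : 0 < r * r < 1) by nra.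
assert (HJ := powerRZ_lt r (- Z.of_nat twoJ) (proj1 Hr)).
set (p := powerRZ r (- Z.of_nat twoJ)) in *.
assert (Hlim : forall eta, 0 < eta -> exists l, 0 < l /\
  is_lim_seq (Rprod (geom_factor eta (p * eta) (r * r))) l).
{ intros eta He; apply Rprod_geom_factor_lim; auto; nra. }
split.
- intros eta He; destruct (Hlim eta He) as [l [Hl L]].
  apply (ex_inf_prod_RtoC _ _ l) with (2 := L); [|lra].
  intros k; apply Q_small_factor_geom; tauto.
- intros eta He; assert (He2 : 0 < r * r * eta) by (repeat apply Rmult_lt_0_compat; lra).
  destruct (Hlim eta He) as [l [Hl L]]; destruct (Hlim _ He2) as [l' [Hl' L']].
  replace (Cpow (RtoC r) 2 * RtoC eta)%C with (RtoC (r * r * eta))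
    by (rewrite !RtoC_mult; simpl; ring).
  rewrite (inf_prod_RtoC _ _ l (fun k => Q_small_factor_geom r eta twoJ k (proj1 Hr) He) L).
  rewrite (inf_prod_RtoC _ _ l' (fun k => Q_small_factor_geom r _ twoJ k (proj1 Hr) He2) L').
  rewrite Cpowz_RtoC, <- !RtoC_mult, <- !RtoC_plus, <- !RtoC_mult by lra; fold p; f_equal.
  apply (geom_product_shift eta (p * eta) (r * r)); auto; [nra|].
  replace (eta * (r * r)) with (r * r * eta) by ring.
  replace (p * eta * (r * r)) with (p * (r * r * eta)) by ring; exact L'.
Qed.

Lemma large_products (r : R) (twoJ : nat) : 1 < r ->
  (forall eta : R, 0 < eta -> ex_inf_prod (Q_large_factor (RtoC r) twoJ (RtoC eta))) /\
  solves (RtoC r) twoJ (fun eta => inf_prod (Q_large_factor (RtoC r) twoJ eta)).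
Proof.
intros Hr; assert (Hr0 : 0 < r) by lra.
assert (Hrho : 0 < / (r * r) < 1).
{ split; [apply Rinv_0_lt_compat; nra|]; rewrite <- Rinv_1; apply Rinv_lt_contravar; nra. }
assert (HJ := powerRZ_lt r (- Z.of_nat twoJ) Hr0).
set (p := powerRZ r (- Z.of_nat twoJ)) in *.
assert (Hlim : forall eta, 0 < eta -> exists l, 0 < l /\
  is_lim_seq (Rprod (geom_factor (p * eta * / (r * r)) (eta * / (r * r)) (/ (r * r)))) l).
{ intros eta He; apply Rprod_geom_factor_lim; auto;
    repeat apply Rmult_lt_0_compat; tauto. }
split.
- intros eta He; destruct (Hlim eta He) as [l [Hl L]].
  apply (ex_inf_prod_RtoC _ _ l) with (2 := L); [|lra].
  intros k; apply Q_large_factor_geom; assumption.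
- intros eta He; assert (He2 : 0 < r * r * eta) by (repeat apply Rmult_lt_0_compat; lra).
  destruct (Hlim eta He) as [l [Hl L]]; destruct (Hlim _ He2) as [l' [Hl' L']].
  replace (Cpow (RtoC r) 2 * RtoC eta)%C with (RtoC (r * r * eta))
    by (rewrite !RtoC_mult; simpl; ring).
  rewrite (inf_prod_RtoC _ _ l (fun k => Q_large_factor_geom r eta twoJ k Hr0 He) L).
  rewrite (inf_prod_RtoC _ _ l' (fun k => Q_large_factor_geom r _ twoJ k Hr0 He2) L').
  rewrite Cpowz_RtoC, <- !RtoC_mult, <- !RtoC_plus, <- !RtoC_mult by lra; fold p; f_equal.
  (* Here rho = q^(-2), so dilation by q^2 goes against the shift: the product at q^2 eta is the one
     with the extra first factor. *)
  symmetry; apply (geom_product_shift (p * eta) eta (/ (r * r))); auto;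
    [apply Rmult_lt_0_compat; assumption|].
  replace (p * (r * r * eta) * / (r * r)) with (p * eta) in L' by (field; lra).
  replace (r * r * eta * / (r * r)) with eta in L' by (field; lra); exact L'.
Qed.

(** * The half-integer case on the unit circle *)

Definition phase_continuation (tau : R) (E : C -> C) : Prop :=
  continues_E_q tau E /\
  (forall (x : R) (n : Z), C_differentiable E (RtoC x + RtoC (2 * IZR n * tau) * Ci)%C) /\
  (forall x : R, C_differentiable E (RtoC x + RtoC tau * Ci)%C /\
     C_differentiable E (RtoC x + RtoC (- tau) * Ci)%C /\
     E (RtoC x + RtoC (- tau) * Ci)%C <> 0%C /\ E (RtoC x + RtoC tau * Ci)%C <> 0%C /\
     E (RtoC x + RtoC tau * Ci)%C
     = ((1 + Cexp (RtoC x)) * E (RtoC x + RtoC (- tau) * Ci))%C) /\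
  (forall (x : R) (n : Z),
     E (RtoC x + RtoC (2 * (IZR n + 1) * tau) * Ci)%C
     = ((1 + Cexp (RtoC x + RtoC ((2 * IZR n + 1) * tau) * Ci))
        * E (RtoC x + RtoC (2 * IZR n * tau) * Ci))%C).

Definition log_dilog (T : R) (z : C) : C := (1 / (2 * RtoC PI * Ci) * Fint (T / PI) z)%C.

Lemma ratio_bounds (T : R) : 0 < T < PI -> 0 < T / PI < 1.
Proof.
intros H; assert (Hpi := PI_RGT_0); split; [apply Rdiv_lt_0_compat; lra|].
apply Rmult_lt_reg_r with PI; [lra|]; unfold Rdiv.
rewrite Rmult_assoc, Rinv_l by lra; lra.
Qed.

Lemma two_PI_Ci_neq_0 : (2 * RtoC PI * Ci)%C <> 0%C.
Proof.
assert (Hpi := PI_RGT_0); intros H; apply (f_equal Im) in H.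
unfold Im in H; simpl in H; nra.
Qed.

Lemma log_dilog_functional_equation (T : R) (z : C) : 0 < T < PI -> Rabs (Im z) + T < PI ->
  log_dilog T (z + RtoC T * Ci)%C = (log1pexp z + log_dilog T (z - RtoC T * Ci))%C.
Proof.
intros HT Hz; assert (Hpi := PI_RGT_0).
assert (ET : T / PI * PI = T) by (field; lra).
assert (H := Fint_functional_equation (T / PI) (ratio_bounds T HT) z
  ltac:(rewrite ET; exact Hz)).
rewrite ET in H; unfold log_dilog; assert (N := two_PI_Ci_neq_0).
replace (Fint (T / PI) (z + RtoC T * Ci))
  with (2 * RtoC PI * Ci * log1pexp z + Fint (T / PI) (z - RtoC T * Ci))%C
  by (rewrite <- H; ring).
field; split.
- intros E; apply N; rewrite E; ring.
- apply RtoC_neq_0; lra.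
Qed.

Lemma log_dilog_differentiable (T : R) (z : C) : 0 < T < PI -> Rabs (Im z) < PI ->
  C_differentiable (log_dilog T) z.
Proof.
intros HT Hz; destruct (ex_cderive_Fint (T / PI) (ratio_bounds T HT) z Hz) as [l Hl].
apply C_differentiable_mult; [apply C_differentiable_const|exists l; exact Hl].
Qed.

Lemma log_dilog_L_integral (T x : R) : 0 < T < PI ->
  (1 / (2 * RtoC PI * Ci) * RtoC (L_integral T (exp x)))%C = log_dilog T (RtoC x).
Proof.
intros HT; assert (Hpi := PI_RGT_0); assert (Hs := ratio_bounds T HT).
unfold log_dilog; rewrite (Fint_RtoC (T / PI)); rewrite <- (ln_exp x) at 2.
rewrite <- (L_integral_eq (T / PI) Hs) by apply exp_pos.
do 3 f_equal; field; lra.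
Qed.

Lemma C_differentiable_Cexp_comp (f : C -> C) (z : C) :
  C_differentiable f z -> C_differentiable (fun w => Cexp (f w)) z.
Proof. intros [l Hl]; eexists; apply (is_cderive_comp Cexp f z _ _ (is_cderive_Cexp _) Hl). Qed.

Lemma Cinv_Cinv (z : C) : (/ / z)%C = z.
Proof.
destruct (Ceq_dec z 0%C) as [E|E]; [|field; exact E].
rewrite E, Cinv_0; apply Cinv_0.
Qed.

Lemma Cinv_neq_0 (z : C) : z <> 0%C -> (/ z)%C <> 0%C.
Proof.
intros H E; apply H; rewrite <- (Cinv_Cinv z), E; apply Cinv_0.
Qed.

(** The condition reads 1 + e^x q^(2j+1) <> 0. An odd exponent is never 0, so genericity of q
    implies it. *)
Definition no_odd_zero (tau : R) : Prop :=
  forall (x : R) (j : Z), (1 + Cexp (RtoC x + RtoC ((2 * IZR j + 1) * tau) * Ci))%C <> 0%C.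

Lemma one_Cexp_RtoC_neq_0 (x : R) : (1 + Cexp (RtoC x))%C <> 0%C.
Proof.
apply one_Cexp_neq_0; unfold Im; simpl; rewrite Rabs_R0; apply PI_RGT_0.
Qed.

Lemma Im_RtoC_vertical (x y : R) : Im (RtoC x + RtoC y * Ci)%C = y.
Proof. unfold Im; simpl; ring. Qed.

Lemma vertical_translate (x y d : R) :
  (RtoC x + RtoC y * Ci + RtoC d * Ci)%C = (RtoC x + RtoC (y + d) * Ci)%C.
Proof. rewrite RtoC_plus; ring. Qed.

Lemma phase_continuation_pos (T : R) : 0 < T < PI -> no_odd_zero T ->
  exists E, phase_continuation T E.
Proof.
intros HT Hodd; set (c := fun w => (1 + Cexp w)%C); set (G := fun z => Cexp (log_dilog T z)).
assert (HG : forall z, Rabs (Im z) < PI -> C_differentiable G z).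
{ intros z Hz; apply C_differentiable_Cexp_comp, log_dilog_differentiable; assumption. }
assert (Hfe : forall z, Rabs (Im z) + T < PI ->
  G (z + RtoC T * Ci)%C = (c z * G (z - RtoC T * Ci))%C).
{ intros z Hz; unfold G, c.
  rewrite log_dilog_functional_equation, Cexp_plus, Cexp_log1pexp by (auto; lra).
  reflexivity. }
assert (Hc0 : forall w, (1 + Cexp w)%C <> 0%C -> c w <> 0%C) by (intros w Hw; exact Hw).
assert (Hcd : forall w, (1 + Cexp w)%C <> 0%C -> C_differentiable c w)
  by (intros w _; apply C_differentiable_1_Cexp).
assert (HTp : Rabs T <= T) by (rewrite Rabs_pos_eq; lra).
assert (HTn : Rabs (- T) <= T) by (rewrite Rabs_Ropp; exact HTp).
assert (Hn : forall (x : R) (n : Z),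
  Rabs (Im (RtoC x + RtoC (2 * IZR n * T) * Ci)%C - 2 * T * IZR n) = 0).
{ intros x n; rewrite Im_RtoC_vertical.
  replace (2 * IZR n * T - 2 * T * IZR n) with 0 by ring; apply Rabs_R0. }
exists (strip_extension T G c); split; [split|split; [|split]].
- apply strip_extension_meromorphic; auto.
  + exact meromorphic_1_Cexp.
  + exact meromorphic_inv_1_Cexp.
- intros x; rewrite (strip_extension_center T G c HT Hfe Hc0).
  2: { unfold Im; simpl; rewrite Rabs_R0; lra. }
  unfold G, L_q; destruct (Rlt_dec 0 T) as [_|h]; [|lra].
  rewrite log_dilog_L_integral by exact HT; reflexivity.
- intros x n; apply (strip_extension_differentiable T G c HT HG Hfe Hc0 Hcd n).
  + rewrite Hn; destruct (overlap_bounds T HT); lra.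
  + intros j; rewrite vertical_translate.
    replace (2 * IZR n * T + (2 * IZR j + 1) * T) with ((2 * IZR (n + j) + 1) * T)
      by (rewrite plus_IZR; ring).
    apply Hodd.
- intros x.
  rewrite !(strip_extension_center T G c HT Hfe Hc0)
    by (rewrite Im_RtoC_vertical; assumption).
  split; [|split; [|split; [|split]]].
  + apply (strip_extension_center_differentiable T G c HT HG Hfe Hc0).
    rewrite Im_RtoC_vertical; exact HTp.
  + apply (strip_extension_center_differentiable T G c HT HG Hfe Hc0).
    rewrite Im_RtoC_vertical; exact HTn.
  + apply Cexp_neq_0.
  + apply Cexp_neq_0.
  + rewrite Hfe by (unfold Im; simpl; rewrite Rabs_R0; lra).
    unfold c; do 2 f_equal; rewrite RtoC_opp; ring.
- intros x n.
  assert (H := strip_extension_translate T G c HT Hfe Hc0 n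
    (RtoC x + RtoC (2 * IZR n * T) * Ci)%C).
  rewrite !vertical_translate in H.
  replace (2 * IZR n * T + 2 * T) with (2 * (IZR n + 1) * T) in H by ring.
  replace (2 * IZR n * T + T) with ((2 * IZR n + 1) * T) in H by ring.
  apply H; [rewrite Hn; lra|apply Hodd].
Qed.

(* For negative [tau] the sign of [L_q] changes, so that the continuation is
   built from [exp (- F)] and the factors [1 / (1 + e^z)]. *)
Lemma phase_continuation_neg (T : R) : 0 < T < PI -> no_odd_zero T ->
  exists E, phase_continuation (- T) E.
Proof.
intros HT Hodd; set (c := fun w => (/ (1 + Cexp w))%C).
set (G := fun z => Cexp (- log_dilog T z)).
assert (HG : forall z, Rabs (Im z) < PI -> C_differentiable G z).
{ intros z Hz; apply (C_differentiable_Cexp_comp (fun z => - log_dilog T z)%C).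
  destruct (log_dilog_differentiable T z HT Hz) as [l Hl].
  exists (- l)%C; apply (@is_derive_opp C_AbsRing C_NormedModule (log_dilog T) z l), Hl. }
assert (Hfe : forall z, Rabs (Im z) + T < PI ->
  G (z + RtoC T * Ci)%C = (c z * G (z - RtoC T * Ci))%C).
{ intros z Hz; unfold G, c.
  rewrite log_dilog_functional_equation by (auto; lra).
  replace (- (log1pexp z + log_dilog T (z - RtoC T * Ci)))%C
    with (- log1pexp z + - log_dilog T (z - RtoC T * Ci))%C by ring.
  rewrite Cexp_plus, (Cexp_opp (log1pexp z)), Cexp_log1pexp by lra; reflexivity. }
assert (Hc0 : forall w, (1 + Cexp w)%C <> 0%C -> c w <> 0%C)
  by (intros w Hw; apply Cinv_neq_0, Hw).
assert (Hcd : forall w, (1 + Cexp w)%C <> 0%C -> C_differentiable c w).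
{ intros w Hw; apply C_differentiable_inv; [apply C_differentiable_1_Cexp|exact Hw]. }
assert (HTp : Rabs T <= T) by (rewrite Rabs_pos_eq; lra).
assert (HTn : Rabs (- T) <= T) by (rewrite Rabs_Ropp; exact HTp).
assert (Hn : forall (x : R) (n : Z),
  Rabs (Im (RtoC x + RtoC (2 * IZR n * T) * Ci)%C - 2 * T * IZR n) = 0).
{ intros x n; rewrite Im_RtoC_vertical.
  replace (2 * IZR n * T - 2 * T * IZR n) with 0 by ring; apply Rabs_R0. }
exists (strip_extension T G c); split; [split|split; [|split]].
- apply strip_extension_meromorphic; auto.
  + exact meromorphic_inv_1_Cexp.
  + intros w; apply meromorphic_ext_loc with (2 := meromorphic_1_Cexp w).
    apply filter_forall; intros z; symmetry; apply Cinv_Cinv.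
- intros x; rewrite (strip_extension_center T G c HT Hfe Hc0).
  2: { unfold Im; simpl; rewrite Rabs_R0; lra. }
  unfold G, L_q; destruct (Rlt_dec 0 (- T)) as [h|_]; [lra|].
  rewrite Ropp_involutive, log_dilog_L_integral by exact HT; reflexivity.
- intros x n; replace (2 * IZR n * - T) with (2 * IZR (- n) * T) by (rewrite opp_IZR; ring).
  apply (strip_extension_differentiable T G c HT HG Hfe Hc0 Hcd (- n)).
  + rewrite Hn; destruct (overlap_bounds T HT); lra.
  + intros j; rewrite vertical_translate.
    replace (2 * IZR (- n) * T + (2 * IZR j + 1) * T) with ((2 * IZR (- n + j) + 1) * T)
      by (rewrite plus_IZR; ring).
    apply Hodd.
- intros x; rewrite Ropp_involutive.
  rewrite !(strip_extension_center T G c HT Hfe Hc0)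
    by (rewrite Im_RtoC_vertical; assumption).
  split; [|split; [|split; [|split]]].
  + apply (strip_extension_center_differentiable T G c HT HG Hfe Hc0).
    rewrite Im_RtoC_vertical; exact HTn.
  + apply (strip_extension_center_differentiable T G c HT HG Hfe Hc0).
    rewrite Im_RtoC_vertical; exact HTp.
  + apply Cexp_neq_0.
  + apply Cexp_neq_0.
  + rewrite Hfe by (unfold Im; simpl; rewrite Rabs_R0; lra).
    replace (RtoC x + RtoC (- T) * Ci)%C with (RtoC x - RtoC T * Ci)%C
      by (rewrite RtoC_opp; ring).
    unfold c; field; apply one_Cexp_RtoC_neq_0.
- intros x n.
  (* Since 2 (m + 1) T = - 2 n T, step n in units of - T is step m in units of T traversed
     backwards; the multiplier 1 / (1 + e^w) is then inverted. *)
  set (m := (- n - 1)%Z).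
  assert (H := strip_extension_translate T G c HT Hfe Hc0 m
    (RtoC x + RtoC (2 * IZR m * T) * Ci)%C).
  rewrite !vertical_translate in H.
  replace (2 * IZR m * T + 2 * T) with (2 * IZR n * - T) in H
    by (unfold m; rewrite minus_IZR, opp_IZR; ring).
  replace (2 * IZR m * T + T) with ((2 * IZR n + 1) * - T) in H
    by (unfold m; rewrite minus_IZR, opp_IZR; ring).
  assert (N : (1 + Cexp (RtoC x + RtoC ((2 * IZR n + 1) * - T) * Ci))%C <> 0%C).
  { replace ((2 * IZR n + 1) * - T) with ((2 * IZR m + 1) * T)
      by (unfold m; rewrite minus_IZR, opp_IZR; ring); apply Hodd. }
  rewrite H; [|rewrite Hn; lra|exact N].
  replace (2 * IZR m * T) with (2 * (IZR n + 1) * - T)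
    by (unfold m; rewrite minus_IZR, opp_IZR; ring).
  unfold c; field; exact N.
Qed.

Lemma phase_no_odd_zero (q : C) (tau : R) :
  generic_phase q -> q = Cexp (Ci * RtoC tau)%C -> no_odd_zero tau.
Proof.
intros Hq E x j.
replace (Cexp (RtoC x + RtoC ((2 * IZR j + 1) * tau) * Ci)%C)
  with (RtoC (exp x) * Cpowz q (2 * j + 1))%C.
- apply generic_phase_factor_neq_0; [exact Hq|lia|apply exp_pos].
- rewrite E, Cpowz_Cexp, <- Cexp_RtoC, <- Cexp_plus, plus_IZR, mult_IZR; f_equal.
  rewrite !RtoC_mult; ring.
Qed.

Lemma generic_phase_angle (q : C) (tau : R) : - PI < tau < PI ->
  generic_phase q -> q = Cexp (Ci * RtoC tau)%C -> 0 < Rabs tau < PI.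
Proof.
intros Ht [_ Hg] E; split; [|apply Rabs_def1; lra].
(* tau = 0 would make q = 1, a root of unity of order 1. *)
apply Rabs_pos_lt; intros H0; apply (Hg 1%nat); [lia|].
rewrite E, H0, Cmult_0_r, Cexp_0; simpl; ring.
Qed.

Lemma phase_continuation_exists (q : C) (tau : R) : - PI < tau < PI ->
  generic_phase q -> q = Cexp (Ci * RtoC tau)%C -> exists E, phase_continuation tau E.
Proof.
intros Ht Hq Eq; assert (Ha := generic_phase_angle q tau Ht Hq Eq).
assert (Ho := phase_no_odd_zero q tau Hq Eq).
destruct (Rlt_dec 0 tau) as [H|H].
- apply phase_continuation_pos; [lra|exact Ho].
- rewrite Rabs_left1 in Ha by lra.
  rewrite <- (Ropp_involutive tau); apply phase_continuation_neg; [exact Ha|].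
  intros x j; replace ((2 * IZR j + 1) * - tau) with ((2 * IZR (- j - 1) + 1) * tau)
    by (rewrite minus_IZR, opp_IZR; ring).
  apply Ho.
Qed.

Lemma odd_shift (tau x : R) (m : nat) :
  (RtoC x - Ci * RtoC (INR (2 * m + 1) + 1) * RtoC tau)%C
  = (RtoC x + RtoC (2 * IZR (- Z.of_nat m - 1) * tau) * Ci)%C.
Proof.
rewrite minus_IZR, opp_IZR, <- INR_IZR_INZ, plus_INR, mult_INR.
change (INR 2) with 2; change (INR 1) with 1.
replace (2 * (- INR m - 1) * tau) with (- ((2 * INR m + 1 + 1) * tau)) by ring.
rewrite RtoC_opp, RtoC_mult; ring.
Qed.

Lemma odd_shift_dilated (tau x : R) (m : nat) :
  (RtoC x + 2 * Ci * RtoC tau - Ci * RtoC (INR (2 * m + 1) + 1) * RtoC tau)%C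
  = (RtoC x + RtoC (2 * (IZR (- Z.of_nat m - 1) + 1) * tau) * Ci)%C.
Proof.
replace (2 * (IZR (- Z.of_nat m - 1) + 1) * tau)
  with (2 * IZR (- Z.of_nat m - 1) * tau + 2 * tau) by ring.
rewrite (RtoC_plus (2 * IZR (- Z.of_nat m - 1) * tau)), Cmult_plus_distr_r, Cplus_assoc.
rewrite <- odd_shift, (RtoC_mult 2 tau); ring.
Qed.

Lemma unit_shift (tau x : R) :
  (RtoC x - Ci * RtoC tau)%C = (RtoC x + RtoC (- tau) * Ci)%C.
Proof. rewrite RtoC_opp; ring. Qed.

Lemma unit_shift_dilated (tau x : R) :
  (RtoC x + 2 * Ci * RtoC tau - Ci * RtoC tau)%C = (RtoC x + RtoC tau * Ci)%C.
Proof. ring. Qed.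

Lemma phase_continuation_regular (tau : R) (m : nat) (E : C -> C) (x : R) :
  phase_continuation tau E ->
  Q_phase_regular tau (2 * m + 1) E (RtoC x) /\
  Q_phase_regular tau (2 * m + 1) E (RtoC x + 2 * Ci * RtoC tau)%C.
Proof.
intros [_ [Hd [Hc _]]]; destruct (Hc x) as [D1 [D2 [N1 [N2 _]]]].
unfold Q_phase_regular.
rewrite odd_shift, odd_shift_dilated, unit_shift, unit_shift_dilated.
repeat split; auto.
replace (IZR (- Z.of_nat m - 1) + 1) with (IZR (- Z.of_nat m - 1 + 1))
  by apply plus_IZR.
apply Hd.
Qed.

(** Dilation multiplies the denominator by 1 + eta, the step across the real axis, and the numerator
    by 1 + q^(-2J) eta, the step centred at - 2J = 2 (- m - 1) + 1 times tau. The equation for [Q]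
    is the quotient of these two steps. *)
Lemma phase_continuation_solves (tau : R) (q : C) (m : nat) (E : C -> C) :
  q = Cexp (Ci * RtoC tau)%C -> phase_continuation tau E ->
  solves_log tau q (2 * m + 1) (Q_phase tau (2 * m + 1) E).
Proof.
intros Eq [_ [_ [Hc Hs]]] eta He; unfold Q_phase.
rewrite odd_shift, odd_shift_dilated, unit_shift, unit_shift_dilated.
destruct (Hc (ln eta)) as [_ [_ [N1 [_ E1]]]].
rewrite Hs, E1, Cexp_RtoC, exp_ln by exact He.
replace (Cpowz q (- Z.of_nat (2 * m + 1)) * RtoC eta)%C
  with (Cexp (RtoC (ln eta) + RtoC ((2 * IZR (- Z.of_nat m - 1) + 1) * tau) * Ci)).
- field; split; [exact N1|].
  rewrite <- (exp_ln eta He), <- Cexp_RtoC; apply one_Cexp_RtoC_neq_0.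
- rewrite Cexp_plus, Cexp_RtoC, exp_ln, Eq, Cpowz_Cexp, Cmult_comm by exact He.
  f_equal; f_equal.
  replace (- Z.of_nat (2 * m + 1))%Z with (2 * (- Z.of_nat m - 1) + 1)%Z by lia.
  rewrite plus_IZR, mult_IZR, RtoC_mult; ring.
Qed.

Theorem proposition3p2 (twoJ : nat) (q : C)
    (hq : positive_real q \/ generic_phase q) :
  (* the equation determines Q up to a factor f with f(q^2 eta) = f(eta) *)
  determined_up_to_periodic RtoC (fun z => Cpow q 2 * z)%C q twoJ /\
  (forall tau : R, (- PI < tau < PI)%R -> q = Cexp (Ci * tau)%C ->
     determined_up_to_periodic (fun eta => RtoC (ln eta))
       (fun x => x + 2 * Ci * tau)%C q twoJ) /\
  (* (i) *)
  (forall J : nat, twoJ = (2 * J)%nat ->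
     (forall eta : R, (0 < eta)%R -> forall k : nat, (k < J)%nat ->
        Q_integer_factor q twoJ eta k <> RtoC 0 /\
        Q_integer_factor q twoJ (Cpow q 2 * eta)%C k <> RtoC 0) /\
     solves q twoJ (Q_integer q J)) /\
  (* (ii) *)
  (Nat.Odd twoJ -> forall r : R, q = RtoC r -> (0 < r < 1)%R ->
     (forall eta : R, (0 < eta)%R -> ex_inf_prod (Q_small_factor q twoJ eta)) /\
     solves q twoJ (fun eta => inf_prod (Q_small_factor q twoJ eta))) /\
  (Nat.Odd twoJ -> forall r : R, q = RtoC r -> (1 < r)%R ->
     (forall eta : R, (0 < eta)%R -> ex_inf_prod (Q_large_factor q twoJ eta)) /\
     solves q twoJ (fun eta => inf_prod (Q_large_factor q twoJ eta))) /\
  (* (iii) *)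
  (Nat.Odd twoJ -> generic_phase q ->
   forall tau : R, (- PI < tau < PI)%R -> q = Cexp (Ci * tau)%C ->
     (forall eta : R, (0 < eta)%R ->
        ex_RInt_gen (L_integrand (Rabs tau) eta)
          (at_right 0) (Rbar_locally p_infty)) /\
     exists E : C -> C,
       continues_E_q tau E /\
       (forall eta : R, (0 < eta)%R ->
          Q_phase_regular tau twoJ E (RtoC (ln eta)) /\
          Q_phase_regular tau twoJ E (RtoC (ln eta) + 2 * Ci * tau)%C) /\
       solves_log tau q twoJ (Q_phase tau twoJ E)).
Proof.
split; [apply periodic_factor|].
split; [intros; apply periodic_factor|].
split.
{ intros J E; subst twoJ; split; [|apply Q_integer_solves, hq].
  intros eta He k Hk; rewrite Q_integer_factor_dilation by (apply base_neq_0, hq).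
  split; apply Q_integer_factors_neq_0; auto with arith. }
split; [intros _ r E Hr; subst q; apply small_products, Hr|].
split; [intros _ r E Hr; subst q; apply large_products, Hr|].
intros [m Em] Hg tau Ht Eq; subst twoJ; split.
- intros eta He; assert (Ha := generic_phase_angle q tau Ht Hg Eq).
  exists (IntR (log_integrand (Rabs tau / PI) (ln eta))).
  assert (H := is_RInt_gen_L_integrand (Rabs tau / PI) (ratio_bounds _ Ha) eta He).
  replace (Rabs tau / PI * PI) with (Rabs tau) in H by (field; apply PI_neq0).
  exact H.
- destruct (phase_continuation_exists q tau Ht Hg Eq) as [E HE]; exists E.
  split; [apply HE|split].
  + intros eta _; apply phase_continuation_regular, HE.
  + apply phase_continuation_solves; assumption.
Qed.
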